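(* Let $(X,\|\cdot\|)$ be a complex Banach space, let $(M_p)_{p\ge0}$ be a sequence of positive real numbers with $M_0=1$ satisfying (M.1), (M.2) and (M.3'), and let $T\in\mathcal{D}'^{(M_p)}(X)$ (Beurling case, $*=(M_p)$), resp. $T\in\mathcal{D}'^{\{M_p\}}(X)$ (Roumieu case, $*=\{M_p\}$). Then the following holds: (i) Suppose that there exist an ultradifferential operator $P(D)=\sum_{p=0}^\infty a_pD^p$ of class $(M_p)$, resp. of class $\{M_p\}$, and $f,g\in\mathcal{D}'^{*}_{AA(\mathbb{R}:X)}(X)$ such that $T=P(D)f+g$. Then $T\in\mathcal{D}'^{*}_{AA(\mathbb{R}:X)}(X)$. (ii) If $T\in\mathcal{D}'_{L^1}((M_p):X)$ and $T*\varphi\in AA(\mathbb{R}:X)$ for all $\varphi\in\mathcal{D}^{(M_p)}$, then there exists $h>0$ such that for each compact set $K\subseteq\mathbb{R}$ we have $T*\varphi\in AA(\mathbb{R}:X)$ for all $\varphi\in\mathcal{D}^{M_p,h}_K$. (iii) Suppose that $T\in\mathcal{D}'^{(M_p)}(X)$ and that there exists $h>0$ such that for each compact set $K\subseteq\mathbb{R}$ we have $T*\varphi\in AA(\mathbb{R}:X)$ for all $\varphi\in\mathcal{D}^{M_p,h}_K$. If $(M_p)$ additionally satisfies (M.3), then there exist $l>0$ and two elements $f,g\in AA(\mathbb{R}:X)$ such that $T=P_l(D)f+g$.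
   Context: Conditions on $(M_p)$: (M.1) $M_p^2\le M_{p+1}M_{p-1}$ for $p\in\mathbb{N}$; (M.2) there are $A,H>1$ with $M_p\le AH^p\sup_{0\le i\le p}M_iM_{p-i}$ for $p\in\mathbb{N}$; (M.3') $\sum_{p=1}^\infty M_{p-1}/M_p<\infty$; (M.3) $\sup_{p\in\mathbb{N}}\sum_{q=p+1}^\infty \frac{M_{q-1}M_{p+1}}{pM_pM_q}<\infty$. Put $m_p=M_p/M_{p-1}$, $p\in\mathbb{N}$. Almost automorphic functions: $AA(\mathbb{R}:X)$ is the space of continuous $f:\mathbb{R}\to X$ such that every real sequence $(b_n)$ has a subsequence $(a_n)$ for which there is a map $g:\mathbb{R}\to X$ with $\lim_n f(t+a_n)=g(t)$ and $\lim_n g(t-a_n)=f(t)$ pointwise for $t\in\mathbb{R}$. Test spaces: for compact $K\subseteq\mathbb{R}$ and $h>0$, $\mathcal{D}^{M_p,h}_K=\{\phi\in C^\infty(\mathbb{R}):\operatorname{supp}\phi\subseteq K,\ \|\phi\|_{M_p,h,K}:=\sup_{t\in K,\,p\in\mathbb{N}_0}h^p|\phi^{(p)}(t)|/M_p<\infty\}$. Put $\mathcal{D}^{(M_p)}_K=\operatorname{projlim}_{h\to\infty}\mathcal{D}^{M_p,h}_K$, $\mathcal{D}^{\{M_p\}}_K=\operatorname{indlim}_{h\to0}\mathcal{D}^{M_p,h}_K$ and $\mathcal{D}^{*}=\operatorname{indlim}_{K}\mathcal{D}^{*}_K$ over compact $K\subseteq\mathbb{R}$, where $*$ stands for $(M_p)$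 (Beurling) or $\{M_p\}$ (Roumieu). $\mathcal{D}'^{*}(X)$ is the space of continuous linear maps $\mathcal{D}^{*}\to X$. A locally integrable function $f:\mathbb{R}\to X$ is identified with $\varphi\mapsto\int f\varphi\,dt$. Bounded ultradistributions: for $h>0$, $\mathcal{D}_{L^1}((M_p),h)$ is the Banach space of $f\in C^\infty(\mathbb{R})$ (complex-valued) with all derivatives in $L^1(\mathbb{R})$ and $\|f\|_{1,h}:=\sup_{p\in\mathbb{N}_0}h^p\|f^{(p)}\|_{L^1}/M_p<\infty$; $\mathcal{D}_{L^1}((M_p))=\operatorname{projlim}_{h\to+\infty}\mathcal{D}_{L^1}((M_p),h)$; $\mathcal{D}'_{L^1}((M_p):X)$ is the space of continuous linear maps $\mathcal{D}_{L^1}((M_p))\to X$, regarded as a subspace of $\mathcal{D}'^{(M_p)}(X)$ by restriction to $\mathcal{D}^{(M_p)}$. Convolution: for $T\in\mathcal{D}'^{*}(X)$ and $\varphi\in\mathcal{D}^{*}$, $T*\varphi$ is the smooth $X$-valued function $(T*\varphi)(x)=\langle T,\varphi(x-\cdot)\rangle$. For a general $\varphi\in\mathcal{D}^{M_p,h}_K$ (which need not lie in $\mathcal{D}^{*}$), $T*\varphi\in\mathcal{D}'^{*}(X)$ is the convolution of $T$ with the compactly supported function $\varphi$ regarded as a scalar compactly supported ultradistribution, i.e. $\langle T*\varphi,\psi\rangle=\langle T,\int\varphi(s)\psi(\cdot+s)\,ds\rangle$ for $\psi\in\mathcal{D}^{*}$; ''$T*\varphi\in AA(\mathbb{R}:X)$''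 means that this ultradistribution is (given by) an element of $AA(\mathbb{R}:X)$. For $A\subseteq\mathcal{D}'^{*}(X)$, $\mathcal{D}'^{*}_{A}(X):=\{T\in\mathcal{D}'^{*}(X): T*\varphi\in A\text{ for all }\varphi\in\mathcal{D}^{*}\}$. Ultradifferential operators: $P(D)=\sum_{p\ge0}a_pD^p$ ($a_p\in\mathbb{C}$, $D=-i\,d/dx$) is of class $(M_p)$, resp. $\{M_p\}$, if there exist $l>0$ and $C>0$, resp. for every $l>0$ there exists $C>0$, such that $|a_p|\le Cl^p/M_p$ for all $p\in\mathbb{N}$. It acts on $\mathcal{D}'^{*}(X)$ by $\langle P(D)T,\varphi\rangle=\langle T,\sum_p(-1)^pa_pD^p\varphi\rangle$. For $l>0$, $P_l(x)=(1+x^2)\prod_{p\in\mathbb{N}}\bigl(1+\frac{x^2}{l^2m_p^2}\bigr)$; under (M.1), (M.2), (M.3) it defines an ultradifferential operator $P_l(D)$ of class $(M_p)$. Equalities $T=P(D)f+g$ are in $\mathcal{D}'^{*}(X)$.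
   Formalization: (M.2), printed with the sup over 0≤i≤p of M_i M_{p-i}, holds for every sequence (take i=0), and then P(D) and P_l(D) need not act on D'*(X), e.g. for M_p=exp(p^3); it is read as Komatsu's condition, with inf in place of sup. *)

(* Defs.v *)
(* Stdlib reals with Coquelicot.  Spaces of functions are predicates on
   R -> C, and an (ultra)distribution is a total map (R -> C) -> X of which
   only the values on the test space are meaningful. *)
From Stdlib Require Import Reals Factorial.
From Coquelicot Require Import Coquelicot.
Open Scope R_scope.

Definition cond_M1 (M : nat -> R) : Prop :=
  forall p, (1 <= p)%nat -> M p ^ 2 <= M (p + 1)%nat * M (p - 1)%nat.

(* Komatsu's stability under ultradifferential operators,
   M_p <= A H^p inf_{0 <= i <= p} M_i M_{p-i}.  With "sup" in place of "inf"
   the condition would be void (take i = 0, M_0 = 1). *)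
Definition cond_M2 (M : nat -> R) : Prop :=
  exists A H : R, 1 < A /\ 1 < H /\
    forall p i, (1 <= p)%nat -> (i <= p)%nat ->
      M p <= A * H ^ p * (M i * M (p - i)%nat).

Definition cond_M3' (M : nat -> R) : Prop :=
  ex_series (fun k => M k / M (S k)).

(* The inner sum over q >= p + 1 is indexed by q = p + 1 + k. *)
Definition cond_M3 (M : nat -> R) : Prop :=
  exists B : R, forall p, (1 <= p)%nat ->
    let u k := M (p + k)%nat * M (p + 1)%nat
               / (INR p * M p * M (p + 1 + k)%nat) in
    ex_series u /\ Series u <= B.

Definition m_ (M : nat -> R) (p : nat) : R := M p / M (p - 1)%nat.

Section RestrictScalars.
Variable X : CompleteNormedModule C_AbsRing.

Let rscal (r : R) (x : X) : X := scal (RtoC r) x.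

Lemma rscal_assoc (r s : R) (x : X) : rscal r (rscal s x) = rscal (r * s) x.
Proof.
unfold rscal; rewrite RtoC_mult; exact (scal_assoc (RtoC r) (RtoC s) x).
Qed.

Lemma rscal_one (x : X) : rscal 1 x = x.
Proof. exact (scal_one x). Qed.

Lemma rscal_distr_l (r : R) (x y : X) :
  rscal r (plus x y) = plus (rscal r x) (rscal r y).
Proof. exact (scal_distr_l (RtoC r) x y). Qed.

Lemma rscal_distr_r (r s : R) (x : X) :
  rscal (r + s) x = plus (rscal r x) (rscal s x).
Proof.
unfold rscal; rewrite RtoC_plus; exact (scal_distr_r (RtoC r) (RtoC s) x).
Qed.

Definition rs_ModuleSpace_mixin : ModuleSpace.mixin_of R_Ring X :=
  ModuleSpace.Mixin R_Ring X rscal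
    rscal_assoc rscal_one rscal_distr_l rscal_distr_r.

Definition rs_NormedModuleAux : NormedModuleAux R_AbsRing :=
  NormedModuleAux.Pack R_AbsRing X
    (NormedModuleAux.Class R_AbsRing X
       (ModuleSpace.Class R_Ring X _ rs_ModuleSpace_mixin)
       (UniformSpace.class X)) X.

Lemma norm_rscal (r : R) (x : X) :
  norm (rscal r x) <= abs (r : R_AbsRing) * norm x.
Proof.
eapply Rle_trans; [exact (@norm_scal C_AbsRing X (RtoC r) x) |].
apply Rmult_le_compat_r; [apply norm_ge_0 |].
right; exact (Cmod_R r).
Qed.

Definition rs_NormedModule_mixin :
    NormedModule.mixin_of R_AbsRing rs_NormedModuleAux :=
  NormedModule.Mixin R_AbsRing rs_NormedModuleAux
    (@norm C_AbsRing X) (@norm_factor C_AbsRing X)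
    norm_triangle norm_rscal norm_compat1 norm_compat2 norm_eq_zero.

Definition restrict_scalars : CompleteNormedModule R_AbsRing :=
  CompleteNormedModule.Pack R_AbsRing X
    (CompleteNormedModule.Class R_AbsRing X
       (NormedModule.Class R_AbsRing X _ rs_NormedModule_mixin)
       (CompleteSpace.class X)) X.

End RestrictScalars.

(* Only continuous integrands occur below, so the improper Riemann integral is
   the Lebesgue (Bochner) integral whenever the latter exists. *)
Definition integral {V : CompleteNormedModule R_AbsRing} (f : R -> V) : V :=
  RInt_gen f (Rbar_locally m_infty) (Rbar_locally p_infty).

Definition integrable {V : NormedModule R_AbsRing} (f : R -> V) : Prop :=
  ex_RInt_gen f (Rbar_locally m_infty) (Rbar_locally p_infty).

Definition smooth (phi : R -> C) : Prop :=
  forall (p : nat) (x : R),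
    ex_derive_n (fun t => Re (phi t)) p x /\
    ex_derive_n (fun t => Im (phi t)) p x.

(* phi^(p), without the factor (-i)^p of D^p *)
Definition deriv (phi : R -> C) (p : nat) (x : R) : C :=
  (Derive_n (fun t => Re (phi t)) p x, Derive_n (fun t => Im (phi t)) p x).

Definition support (phi : R -> C) : R -> Prop :=
  adherence (fun x => phi x <> 0%C).

Definition CSeries (a : nat -> C) : C :=
  (Series (fun n => Re (a n)), Series (fun n => Im (a n))).

Definition abs_convex (V : (R -> C) -> Prop) : Prop :=
  forall (a b : C) (phi psi : R -> C), Cmod a + Cmod b <= 1 ->
    V phi -> V psi -> V (fun x => a * phi x + b * psi x)%C.

Definition normed_nbhd0 (E : (R -> C) -> Prop) (N : (R -> C) -> Rbar)
    (U : (R -> C) -> Prop) : Prop :=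
  exists eps : R, 0 < eps /\
    forall phi, E phi -> Rbar_lt (N phi) eps -> U phi.

(* Projective limit as h -> +oo.  The norms used below increase with h, so
   the balls of a single N h already form a neighbourhood basis. *)
Definition projlim_nbhd0 (E : (R -> C) -> Prop) (N : R -> (R -> C) -> Rbar)
    (U : (R -> C) -> Prop) : Prop :=
  exists h : R, 0 < h /\ normed_nbhd0 E (N h) U.

(* Locally convex inductive limit of the spaces indexed by i in J, where nb i
   is the filter of neighbourhoods of zero of the i-th space. *)
Definition indlim_nbhd0 {I : Type} (J : I -> Prop)
    (nb : I -> ((R -> C) -> Prop) -> Prop) (U : (R -> C) -> Prop) : Prop :=
  exists V, abs_convex V /\ (forall phi, V phi -> U phi) /\
    forall i, J i -> nb i V.

Definition linear_on {X : ModuleSpace C_Ring} (E : (R -> C) -> Prop)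
    (T : (R -> C) -> X) : Prop :=
  forall (a b : C) (phi psi : R -> C), E phi -> E psi ->
    T (fun x => a * phi x + b * psi x)%C
    = plus (scal a (T phi)) (scal b (T psi)).

Definition continuous_linear {X : NormedModule C_AbsRing}
    (E : (R -> C) -> Prop) (nbhd0 : ((R -> C) -> Prop) -> Prop)
    (T : (R -> C) -> X) : Prop :=
  linear_on E T /\
  forall eps : R, 0 < eps -> nbhd0 (fun phi => norm (T phi) < eps).

Inductive ultra_class : Set := Beurling | Roumieu.

Section Ultradistributions.
Variable star : ultra_class.
Variable M : nat -> R.
Variable X : CompleteNormedModule C_AbsRing.

(* Rbar-valued, so that the norm may be infinite; it is m_infty if K is empty *)
Definition norm_MhK (h : R) (K : R -> Prop) (phi : R -> C) : Rbar :=
  Lub_Rbar (fun y => exists (t : R) (p : nat),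
    K t /\ y = h ^ p * Cmod (deriv phi p t) / M p).

Definition D_MhK (h : R) (K : R -> Prop) (phi : R -> C) : Prop :=
  smooth phi /\ included (support phi) K /\
  Rbar_lt (norm_MhK h K phi) p_infty.

Definition D_K (K : R -> Prop) (phi : R -> C) : Prop :=
  match star with
  | Beurling => forall h, 0 < h -> D_MhK h K phi
  | Roumieu => exists h, 0 < h /\ D_MhK h K phi
  end.

Definition D_K_nbhd0 (K : R -> Prop) : ((R -> C) -> Prop) -> Prop :=
  match star with
  | Beurling => projlim_nbhd0 (D_K K) (fun h => norm_MhK h K)
  | Roumieu =>
      indlim_nbhd0 (fun h => 0 < h)
        (fun h => normed_nbhd0 (D_MhK h K) (norm_MhK h K))
  end.

Definition D_star (phi : R -> C) : Prop := exists K, compact K /\ D_K K phi.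

Definition D_star_nbhd0 : ((R -> C) -> Prop) -> Prop :=
  indlim_nbhd0 compact D_K_nbhd0.

Definition ultradistribution (T : (R -> C) -> X) : Prop :=
  continuous_linear D_star D_star_nbhd0 T.

Definition ud_eq (S T : (R -> C) -> X) : Prop :=
  forall phi, D_star phi -> S phi = T phi.

Definition ud_plus (S T : (R -> C) -> X) (phi : R -> C) : X :=
  plus (S phi) (T phi).

Definition ud_of_fun (f : R -> X) (phi : R -> C) : X :=
  integral (V := restrict_scalars X) (fun t => scal (phi t) (f t)).

Definition AA (f : R -> X) : Prop :=
  (forall t, continuous f t) /\
  forall b : nat -> R, exists (s : nat -> nat) (g : R -> X),
    (forall n, (s n < s (S n))%nat) /\
    forall t,
      filterlim (fun n => f (t + b (s n))) eventually (locally (g t)) /\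
      filterlim (fun n => g (t - b (s n))) eventually (locally (f t)).

Definition conv (T : (R -> C) -> X) (phi : R -> C) (x : R) : X :=
  T (fun t => phi (x - t)).

Definition ud_conv (T : (R -> C) -> X) (phi psi : R -> C) : X :=
  T (fun t => integral (V := C_R_CompleteNormedModule)
                (fun s => phi s * psi (t + s)%R)%C).

Definition ud_in_AA (T : (R -> C) -> X) : Prop :=
  exists F, AA F /\ ud_eq T (ud_of_fun F).

Definition D'_AA (T : (R -> C) -> X) : Prop :=
  ultradistribution T /\ forall phi, D_star phi -> AA (conv T phi).

Definition udo_class (a : nat -> C) : Prop :=
  match star with
  | Beurling => exists l K : R, 0 < l /\ 0 < K /\
      forall p, (1 <= p)%nat -> Cmod (a p) <= K * l ^ p / M p
  | Roumieu => forall l : R, 0 < l -> exists K : R, 0 < K /\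
      forall p, (1 <= p)%nat -> Cmod (a p) <= K * l ^ p / M p
  end.

Definition udo_apply (a : nat -> C) (T : (R -> C) -> X) (phi : R -> C) : X :=
  T (fun x => CSeries (fun p =>
       (- RtoC 1) ^ p * a p * ((- Ci) ^ p * deriv phi p x))%C).

Definition P_ (l x : R) : R :=
  (1 + x ^ 2) *
  real (Lim_seq (fun n =>
          prod_f_R0 (fun k => 1 + x ^ 2 / (l ^ 2 * m_ M (S k) ^ 2)) n)).

(* P_l(D) = sum_p c_p D^p, where P_l(x) = sum_p c_p x^p. *)
Definition P_coef (l : R) (p : nat) : C :=
  RtoC (Derive_n (P_ l) p 0 / INR (fact p)).

Definition norm_1h (h : R) (f : R -> C) : Rbar :=
  Lub_Rbar (fun y => exists p : nat,
    y = h ^ p * integral (V := R_CompleteNormedModule)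
                  (fun t => Cmod (deriv f p t)) / M p).

(* For continuous functions, absolute improper Riemann integrability is
   membership in L^1, with the same value of the L^1 norm. *)
Definition D_L1_h (h : R) (f : R -> C) : Prop :=
  smooth f /\
  (forall p, integrable (V := R_NormedModule) (fun t => Cmod (deriv f p t))) /\
  Rbar_lt (norm_1h h f) p_infty.

Definition D_L1 (f : R -> C) : Prop := forall h, 0 < h -> D_L1_h h f.

Definition D'_L1 (S : (R -> C) -> X) : Prop :=
  continuous_linear D_L1 (projlim_nbhd0 D_L1 norm_1h) S.

End Ultradistributions.

Arguments ultradistribution star M {X} T.
Arguments ud_eq star M {X} S T.
Arguments ud_plus {X} S T phi.
Arguments ud_of_fun {X} f phi.
Arguments AA {X} f.
Arguments conv {X} T phi x.
Arguments ud_conv {X} T phi psi.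
Arguments ud_in_AA star M {X} T.
Arguments D'_AA star M {X} T.
Arguments udo_apply {X} a T phi.
Arguments D'_L1 M {X} S.

(* Main.v *)
(* (i) P(D) maps D^* into itself and (P(D) f) * phi = f * (P(D) phi), so that
   T * phi is a sum of two almost automorphic functions.

   For (ii) and (iii) there is nothing to show if D^(M_p) = {0}; otherwise the
   square of a nonzero real test function yields a mollifier rho and, by
   integration, a cutoff chi.

   (ii) By continuity |T phi| is bounded by a single norm of index h0, and (M.2)
   lets the norms of index h = H h0 control one derivative more.  Hence for phi
   of class h the functions T * (phi * rho_n) form a uniform Cauchy sequence,
   almost automorphy survives uniform limits, and Riemann sums identify the
   limit with the ultradistribution T * phi.

   (iii) A parametrix P_l(D) u = delta - psi gives T = P_l(D)(T * u) + T * psi.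
   Here u = chi G with G a fundamental solution, the limit of the products of
   the resolvents (1 - a_j^-2 d^2/dx^2)^-1, a_0 = 1 and a_j = l m_j, applied to
   heat kernels g_tau with tau -> 0.  Each resolvent gains one derivative at the
   cost of a factor a_j, whence |G^(p)| <= C l^p M_p.  Writing the resolvent as
   the average of the heat semigroup over an exponential time shows that G is a
   superposition of heat kernels, so |G^(p)(x)| <= C 4^p p! for |x| >= 1, as for
   g_tau uniformly in tau.  Thus (1 - chi) G is of class (M_p), and so is
   psi = P_l(D)((1 - chi) G). *)
Require Import Defs.
From Stdlib Require Import Reals Factorial Lra Lia Classical ClassicalEpsilon FunctionalExtensionality.
From Coquelicot Require Import Coquelicot.
Open Scope R_scope.

(** The fundamental solution is built on the real line alone: the product of resolvents is
    regularised by heat kernels at the times 4^(-n), so that the n-th approximation is smooth and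
    differs from the next one by a summable amount. Near 0 the only bound on its derivatives is
    |G^(p)| <= 5 l^p M_p, a bound of the single index 1/l; multiplication by the cutoff halves this
    index, whence l = 1/(2h) for the h given in (iii). The remainder psi, on the contrary, must
    satisfy such bounds for every index, which is why the estimates away from 0 are analytic: by
    (M.3'), p! L^p <= C M_p for each L. (M.3) serves to bound the coefficients of P_l. The heat
    kernel is left unnormalised, and its mass c > 0 is divided out at the end. In (ii), the distance
    from phi to its mollification at scale 1/(n+1) is controlled by phi', which accounts for the
    additional derivative. Complex test functions are handled as pairs of real jets, sequences in
    which each function is the derivative of the preceding one, so that bounds and limits concern
    plain functions. *)

(** * Differentiation through quadratic remainders *)

Lemma is_derive_eq (f : R -> R) (x l l' : R) :
  is_derive f x l -> l = l' -> is_derive f x l'.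
Proof. intros H <-; exact H. Qed.

Lemma is_derive_extR (f g : R -> R) (x l : R) :
  (forall t, f t = g t) -> is_derive f x l -> is_derive g x l.
Proof. exact (@is_derive_ext R_AbsRing R_NormedModule f g x l). Qed.

Lemma is_derive_continuous (f : R -> R) (x l : R) :
  is_derive f x l -> continuous f x.
Proof. intros H; apply (ex_derive_continuous f x); exists l; exact H. Qed.

(** A quadratic remainder survives limits, sums and integrals. Together with [taylor_quad], this
    criterion justifies the differentiations under a limit, a series or an integral sign below. *)
Lemma is_derive_quad (F : R -> R) (x l B e : R) :
  0 < e ->
  (forall y, Rabs (y - x) < e ->
     Rabs (F y - F x - (y - x) * l) <= B * (y - x) ^ 2) ->
  is_derive F x l.
Proof.
intros He H; apply is_derive_Reals; intros eps Heps.
set (B' := Rabs B + 1).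
assert (HB : 0 < B') by (unfold B'; pose proof (Rabs_pos B); lra).
assert (Hd : 0 < Rmin e (eps / B')).
{ apply Rmin_glb_lt; [lra | apply Rdiv_lt_0_compat; lra]. }
exists (mkposreal _ Hd); intros h Hh0 Hh; simpl in Hh.
assert (H1 : Rabs h < e) by (eapply Rlt_le_trans; [exact Hh | apply Rmin_l]).
assert (H2 : Rabs h < eps / B') by (eapply Rlt_le_trans; [exact Hh | apply Rmin_r]).
specialize (H (x + h)); replace (x + h - x) with h in H by ring.
specialize (H H1).
replace ((F (x + h) - F x) / h - l) with ((F (x + h) - F x - h * l) / h)
  by (field; exact Hh0).
assert (Hp : 0 < Rabs h) by (apply Rabs_pos_lt; exact Hh0).
unfold Rdiv; rewrite Rabs_mult, Rabs_inv.
apply Rmult_lt_reg_r with (Rabs h); [exact Hp |].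
rewrite Rmult_assoc, Rinv_l, Rmult_1_r by lra.
eapply Rle_lt_trans; [exact H |].
rewrite <- (pow2_abs h).
apply Rle_lt_trans with (B' * (Rabs h * Rabs h)).
{ simpl; rewrite Rmult_1_r; apply Rmult_le_compat_r; [nra |].
  unfold B'; pose proof (Rle_abs B); lra. }
assert (B' * Rabs h < eps).
{ apply Rmult_lt_compat_l with (r := B') in H2; [| lra].
  replace (B' * (eps / B')) with eps in H2 by (field; lra). lra. }
nra.
Qed.

Lemma mvt (f f' : R -> R) (x y : R) :
  (forall z, Rabs (z - x) <= Rabs (y - x) -> is_derive f z (f' z)) ->
  exists c, Rabs (c - x) <= Rabs (y - x) /\ f y - f x = f' c * (y - x).
Proof.
intros H.
assert (Hin : forall z, Rmin x y <= z <= Rmax x y -> Rabs (z - x) <= Rabs (y - x)).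
{ intros z; unfold Rmin, Rmax, Rabs; destruct (Rle_dec x y);
    repeat destruct Rcase_abs; lra. }
destruct (MVT_gen f x y f') as [c [Hc1 Hc2]].
- intros z Hz; apply H, Hin; lra.
- intros z Hz; apply continuity_pt_filterlim.
  apply (is_derive_continuous f z (f' z)), H, Hin, Hz.
- exists c; split; [apply Hin, Hc1 | exact Hc2].
Qed.

Lemma mvt_le (f f' : R -> R) (x y B : R) :
  (forall z, Rabs (z - x) <= Rabs (y - x) -> is_derive f z (f' z)) ->
  (forall z, Rabs (z - x) <= Rabs (y - x) -> Rabs (f' z) <= B) ->
  Rabs (f y - f x) <= B * Rabs (y - x).
Proof.
intros H HB; destruct (mvt f f' x y H) as [c [Hc ->]].
rewrite Rabs_mult; apply Rmult_le_compat_r; [apply Rabs_pos | exact (HB c Hc)].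
Qed.

(** Applying the mean value theorem twice gives the constant B rather than the sharp B/2. *)
Lemma taylor_quad (f f' f'' : R -> R) (x y B : R) :
  (forall z, Rabs (z - x) <= Rabs (y - x) -> is_derive f z (f' z)) ->
  (forall z, Rabs (z - x) <= Rabs (y - x) -> is_derive f' z (f'' z)) ->
  (forall z, Rabs (z - x) <= Rabs (y - x) -> Rabs (f'' z) <= B) ->
  Rabs (f y - f x - (y - x) * f' x) <= B * (y - x) ^ 2.
Proof.
intros H1 H2 HB; destruct (mvt f f' x y H1) as [c [Hc ->]].
replace (f' c * (y - x) - (y - x) * f' x) with ((f' c - f' x) * (y - x)) by ring.
assert (HB0 : 0 <= B).
{ eapply Rle_trans; [apply Rabs_pos | apply (HB x)].
  rewrite Rminus_diag, Rabs_R0; apply Rabs_pos. }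
assert (Rabs (f' c - f' x) <= B * Rabs (c - x)).
{ apply mvt_le with f''; intros z Hz; [apply H2 | apply HB]; lra. }
rewrite Rabs_mult, <- (pow2_abs (y - x)).
pose proof (Rabs_pos (y - x)); pose proof (Rabs_pos (c - x)); simpl.
apply Rle_trans with (B * Rabs (c - x) * Rabs (y - x));
  [apply Rmult_le_compat_r; lra |].
rewrite Rmult_1_r, <- Rmult_assoc; apply Rmult_le_compat_r; [lra |].
apply Rmult_le_compat_l; lra.
Qed.

Lemma Cmod_pair_le a b : Cmod (a, b) <= Rabs a + Rabs b.
Proof.
replace (a, b) with (Cplus (RtoC a) (Cmult Ci (RtoC b))).
- eapply Rle_trans; [apply Cmod_triangle |].
  rewrite Cmod_mult, !Cmod_R.
  replace (Cmod Ci) with 1; [lra |].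
  unfold Cmod, Ci; simpl; rewrite <- sqrt_1 at 1; f_equal; ring.
- unfold Ci, RtoC, Cplus, Cmult; simpl; f_equal; ring.
Qed.

(** * Jets: a smooth function together with its successive derivatives *)

Definition jet (f : nat -> R -> R) : Prop :=
  forall p x, is_derive (f p) x (f (S p) x).

Lemma jet_Derive_n f : jet f -> forall p x, Derive_n (f 0%nat) p x = f p x.
Proof.
intros Hf; induction p as [|p IH]; intros x; [reflexivity |]; simpl.
rewrite (Derive_ext _ _ _ IH); apply is_derive_unique, Hf.
Qed.

Lemma jet_ex_derive_n f : jet f -> forall p x, ex_derive_n (f 0%nat) p x.
Proof.
intros Hf [|p] x; [exact I |]; simpl.
apply ex_derive_ext with (f p).
{ intros t; symmetry; apply jet_Derive_n, Hf. }
exists (f (S p) x); apply Hf.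
Qed.

Lemma jet_of_smooth (h : R -> R) :
  (forall p x, ex_derive_n h p x) -> jet (Derive_n h).
Proof. intros H p x; apply Derive_correct; exact (H (S p) x). Qed.

Lemma jet_unique f g : jet f -> jet g -> (forall x, f 0%nat x = g 0%nat x) ->
  forall p x, f p x = g p x.
Proof.
intros Hf Hg H p x; rewrite <- (jet_Derive_n f Hf), <- (jet_Derive_n g Hg).
apply Derive_n_ext, H.
Qed.

Lemma jet_cont f : jet f -> forall p x, continuous (f p) x.
Proof. intros Hf p x; apply (is_derive_continuous _ _ _ (Hf p x)). Qed.

Lemma jet_vanish f L : jet f ->
  (forall x, L < Rabs x -> f 0%nat x = 0) ->
  forall p x, L < Rabs x -> f p x = 0.
Proof.
intros Hf H p x Hx.
rewrite <- (jet_Derive_n f Hf).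
rewrite (Derive_n_ext_loc _ (fun _ => 0)).
- destruct p; [reflexivity | apply Derive_n_const].
- assert (He : 0 < Rabs x - L) by lra.
  exists (mkposreal _ He); intros y Hy; apply H.
  change (Rabs (y - x) < Rabs x - L) in Hy.
  pose proof (Rabs_triang_inv x y); rewrite (Rabs_minus_sym y x) in Hy; lra.
Qed.

Lemma jet_lin a b f g : jet f -> jet g ->
  jet (fun p x => a * f p x + b * g p x).
Proof.
intros Hf Hg p x.
apply (is_derive_plus (fun x => a * f p x) (fun x => b * g p x));
  apply is_derive_scal; auto.
Qed.

Lemma jet_affine k c f : jet f -> jet (fun p x => k ^ p * f p (k * x + c)).
Proof.
intros Hf p x; simpl.
eapply is_derive_eq.
- apply is_derive_scal.
  apply (is_derive_comp (f p) (fun x => k * x + c)); [apply Hf |].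
  eapply is_derive_eq; [apply (is_derive_plus (fun x => k * x) (fun _ => c)) |].
  + apply is_derive_scal, is_derive_id.
  + apply is_derive_const.
  + reflexivity.
- unfold scal, plus, zero, one; simpl; unfold mult; simpl; ring.
Qed.

(** The n-th derivative of the product of two jets. Leibniz' rule is unfolded one derivative at a
    time into 2^n terms, without collecting binomial coefficients; the count 2^n is the price paid
    in [bnd_at_mul]. *)
Fixpoint jmul (n : nat) (f g : nat -> R -> R) (x : R) : R :=
  match n with
  | O => f 0%nat x * g 0%nat x
  | S n => jmul n (fun p => f (S p)) g x + jmul n f (fun p => g (S p)) x
  end.

Lemma jet_mul f g : jet f -> jet g -> jet (fun n => jmul n f g).
Proof.
intros Hf Hg n; revert f g Hf Hg; induction n as [|n IH]; intros f g Hf Hg x.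
- change (is_derive (fun x => f 0%nat x * g 0%nat x) x
            (f 1%nat x * g 0%nat x + f 0%nat x * g 1%nat x)).
  apply (is_derive_mult (f 0%nat) (g 0%nat)); auto.
  intros; apply Rmult_comm.
- change (is_derive (fun x => jmul n (fun p => f (S p)) g x
                              + jmul n f (fun p => g (S p)) x) x
            (jmul (S n) (fun p => f (S p)) g x + jmul (S n) f (fun p => g (S p)) x)).
  apply (is_derive_plus (jmul n (fun p => f (S p)) g) (jmul n f (fun p => g (S p)))).
  + apply (IH (fun p => f (S p)) g); [intros p; apply Hf | exact Hg].
  + apply (IH f (fun p => g (S p))); [exact Hf | intros p; apply Hg].
Qed.

Lemma jmul_0_l n f g x : (forall p, f p x = 0) -> jmul n f g x = 0.
Proof.
revert f g; induction n as [|n IH]; intros f g H; simpl.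
- rewrite H; ring.
- rewrite (IH (fun p => f (S p))), (IH f); auto; ring.
Qed.

Lemma jmul_1_l n f g x : f 0%nat x = 1 -> (forall p, f (S p) x = 0) ->
  jmul n f g x = g n x.
Proof.
revert g; induction n as [|n IH]; intros g H0 HS; simpl.
- rewrite H0; ring.
- rewrite jmul_0_l by auto; rewrite IH; auto; ring.
Qed.

(** * Series and uniform limits *)

Lemma ex_series_dom (a b : nat -> R) :
  (forall n, Rabs (a n) <= b n) -> ex_series b -> ex_series a.
Proof.
intros H Hb; apply ex_series_Rabs, (@ex_series_le R_AbsRing R_CompleteNormedModule _ b);
  [| exact Hb].
intros n; change (Rabs (Rabs (a n)) <= b n); rewrite Rabs_Rabsolu; apply H.
Qed.

Lemma Series_dom (a b : nat -> R) :
  (forall n, Rabs (a n) <= b n) -> ex_series b -> Rabs (Series a) <= Series b.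
Proof.
intros H Hb; eapply Rle_trans; [apply Series_Rabs |].
- apply (@ex_series_le R_AbsRing R_CompleteNormedModule _ b); [| exact Hb].
  intros n; change (Rabs (Rabs (a n)) <= b n); rewrite Rabs_Rabsolu; apply H.
- apply Series_le; [| exact Hb]; intros n; split; [apply Rabs_pos | apply H].
Qed.

Lemma tail_S (v : nat -> R) n : ex_series v ->
  Series (fun k => v (n + k)%nat) = v n + Series (fun k => v (S n + k)%nat).
Proof.
intros Hv; rewrite Series_incr_1.
- rewrite Nat.add_0_r; f_equal; apply Series_ext; intros k; f_equal; lia.
- exact (proj1 (ex_series_incr_n v n) Hv).
Qed.

Lemma tail_lim (v : nat -> R) : ex_series v ->
  forall eps, 0 < eps -> exists N, forall n, (N <= n)%nat ->
    Rabs (Series (fun k => v (n + k)%nat)) < eps.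
Proof.
intros Hv eps Heps.
assert (Hl : is_lim_seq (sum_n v) (Series v)) by exact (Series_correct v Hv).
apply is_lim_seq_spec in Hl; destruct (Hl (mkposreal eps Heps)) as [N HN]; simpl in HN.
exists (S N); intros n Hn; specialize (HN (pred n) ltac:(lia)).
rewrite (Series_incr_n v n) in HN by (lia || exact Hv).
rewrite sum_n_Reals in HN; rewrite <- Rabs_Ropp.
match goal with |- Rabs ?a < _ => match type of HN with Rabs ?b < _ =>
  replace a with b by ring end end; exact HN.
Qed.

(** The index type is a parameter: I = R gives uniform convergence on the line and I = unit ordinary
    convergence, so that [tannery] serves for both. *)
Definition ucv {I : Type} (f : nat -> I -> R) (g : I -> R) : Prop :=
  forall eps, 0 < eps -> exists N, forall n, (N <= n)%nat ->
    forall i, Rabs (f n i - g i) < eps.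

Lemma ucv_lim {I : Type} (f : nat -> I -> R) (g : I -> R) i :
  ucv f g -> is_lim_seq (fun n => f n i) (g i).
Proof.
intros H; apply is_lim_seq_spec; intros eps.
destruct (H eps (cond_pos eps)) as [N HN]; exists N; intros n Hn; apply HN, Hn.
Qed.

Lemma ucv_le {I : Type} (f : nat -> I -> R) (g : I -> R) i B :
  ucv f g -> (forall n, Rabs (f n i) <= B) -> Rabs (g i) <= B.
Proof.
intros H HB.
exact (is_lim_seq_le (fun n => Rabs (f n i)) (fun _ => B) (Rabs (g i)) B HB
         (is_lim_seq_abs _ _ (ucv_lim f g i H)) (is_lim_seq_const B)).
Qed.

Lemma ucv_const {I : Type} (g : I -> R) : ucv (fun _ => g) g.
Proof. intros eps Heps; exists 0%nat; intros; rewrite Rminus_diag, Rabs_R0; lra. Qed.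

Lemma ucv_plus {I : Type} (f f' : nat -> I -> R) (g g' : I -> R) :
  ucv f g -> ucv f' g' -> ucv (fun n i => f n i + f' n i) (fun i => g i + g' i).
Proof.
intros H H' eps Heps.
destruct (H (eps / 2)) as [N HN]; [lra |]; destruct (H' (eps / 2)) as [N' HN']; [lra |].
exists (N + N')%nat; intros n Hn i.
specialize (HN n ltac:(lia) i); specialize (HN' n ltac:(lia) i).
replace (f n i + f' n i - (g i + g' i)) with ((f n i - g i) + (f' n i - g' i)) by ring.
eapply Rle_lt_trans; [apply Rabs_triang | lra].
Qed.

Lemma ucv_mult {I : Type} (f f' : nat -> I -> R) (g g' : I -> R) B B' :
  ucv f g -> ucv f' g' -> (forall n i, Rabs (f n i) <= B) ->
  (forall i, Rabs (g' i) <= B') ->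
  ucv (fun n i => f n i * f' n i) (fun i => g i * g' i).
Proof.
intros H H' HB HB' eps Heps.
set (b := Rabs B + 1); set (b' := Rabs B' + 1).
assert (Hb : 0 < b) by (unfold b; pose proof (Rabs_pos B); lra).
assert (Hb' : 0 < b') by (unfold b'; pose proof (Rabs_pos B'); lra).
destruct (H (eps / 2 / b')) as [N HN]; [apply Rdiv_lt_0_compat; lra |].
destruct (H' (eps / 2 / b)) as [N' HN']; [apply Rdiv_lt_0_compat; lra |].
exists (N + N')%nat; intros n Hn i.
specialize (HN n ltac:(lia) i); specialize (HN' n ltac:(lia) i).
specialize (HB n i); specialize (HB' i).
replace (f n i * f' n i - g i * g' i)
  with (f n i * (f' n i - g' i) + (f n i - g i) * g' i) by ring.
eapply Rle_lt_trans; [apply Rabs_triang |]; rewrite !Rabs_mult.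
assert (Rabs (f n i) <= b) by (unfold b; pose proof (Rle_abs B); lra).
assert (Rabs (g' i) <= b') by (unfold b'; pose proof (Rle_abs B'); lra).
apply (Rmult_lt_compat_l b') in HN; [| lra].
apply (Rmult_lt_compat_l b) in HN'; [| lra].
replace (b' * (eps / 2 / b')) with (eps / 2) in HN by (field; lra).
replace (b * (eps / 2 / b)) with (eps / 2) in HN' by (field; lra).
pose proof (Rabs_pos (f' n i - g' i)); pose proof (Rabs_pos (f n i - g i)).
pose proof (Rmult_le_compat_r (Rabs (f' n i - g' i)) (Rabs (f n i)) b ltac:(lra) ltac:(lra)).
pose proof (Rmult_le_compat_l (Rabs (f n i - g i)) (Rabs (g' i)) b' ltac:(lra) ltac:(lra)).
lra.
Qed.

(** Past a rank Q given by the tail of b, the terms of both series contribute little, uniformly in n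
    and i; the finitely many terms that remain converge uniformly. *)
Lemma tannery {I : Type} (u : nat -> I -> nat -> R) (v : I -> nat -> R) (b : nat -> R) :
  ex_series b ->
  (forall n i q, Rabs (u n i q) <= b q) -> (forall i q, Rabs (v i q) <= b q) ->
  (forall q, ucv (fun n i => u n i q) (fun i => v i q)) ->
  ucv (fun n i => Series (u n i)) (fun i => Series (v i)).
Proof.
intros Hb Hu Hv Huv eps Heps.
destruct (tail_lim b Hb (eps / 4)) as [Q HQ]; [lra |].
specialize (HQ (S Q) ltac:(lia)).
assert (Hfin : forall m e, 0 < e -> exists N, forall n, (N <= n)%nat -> forall i,
          sum_f_R0 (fun q => Rabs (u n i q - v i q)) m < e).
{ induction m as [|m IH]; intros e He; simpl.
  - exact (Huv 0%nat e He).
  - destruct (IH (e / 2)) as [N HN]; [lra |].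
    destruct (Huv (S m) (e / 2)) as [N' HN']; [lra |].
    exists (N + N')%nat; intros n Hn i.
    specialize (HN n ltac:(lia) i); specialize (HN' n ltac:(lia) i); lra. }
destruct (Hfin Q (eps / 2)) as [N HN]; [lra |].
exists N; intros n Hn i; specialize (HN n Hn i).
assert (Eu : ex_series (u n i)) by (apply ex_series_dom with b; auto).
assert (Ev : ex_series (v i)) by (apply ex_series_dom with b; auto).
assert (Hw : forall q, Rabs (u n i q - v i q) <= 2 * b q).
{ intros q; unfold Rminus; eapply Rle_trans; [apply Rabs_triang |].
  rewrite Rabs_Ropp; specialize (Hu n i q); specialize (Hv i q); lra. }
assert (E2b : ex_series (fun q => 2 * b q)) by (apply (ex_series_scal_l 2 b), Hb).
assert (Ew : ex_series (fun q => Rabs (u n i q - v i q))).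
{ apply ex_series_dom with (fun q => 2 * b q); [| exact E2b].
  intros q; rewrite Rabs_Rabsolu; apply Hw. }
rewrite <- Series_minus by assumption.
eapply Rle_lt_trans; [apply Series_Rabs, Ew |].
rewrite (Series_incr_n _ (S Q)) by (lia || exact Ew).
simpl pred.
assert (Series (fun k => Rabs (u n i (S Q + k)%nat - v i (S Q + k)%nat))
        <= 2 * Series (fun k => b (S Q + k)%nat)).
{ rewrite <- Series_scal_l; apply Series_le.
  - intros k; split; [apply Rabs_pos | apply Hw].
  - apply (ex_series_scal_l 2 (fun k => b (S Q + k)%nat)).
    exact (proj1 (ex_series_incr_n b (S Q)) Hb). }
pose proof (Rle_abs (Series (fun k => b (S Q + k)%nat))).
lra.
Qed.

(** The increments telescope against the tails of v. The hypothesis starts at a rank N because a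
    derivative of an approximate fundamental solution is bounded only once enough resolvents have
    been applied. *)
Lemma ucv_of_summable {I : Type} (f : nat -> I -> R) (v : nat -> R) (N : nat) :
  ex_series v ->
  (forall n i, (N <= n)%nat -> Rabs (f (S n) i - f n i) <= v n) ->
  exists g, ucv f g.
Proof.
intros Hv Hf.
set (T n := Series (fun k => v (n + k)%nat)).
assert (HT : forall n, T n = v n + T (S n)) by (intros n; apply tail_S, Hv).
assert (Hd : forall i n k, (N <= n)%nat -> Rabs (f (k + n)%nat i - f n i) <= T n - T (k + n)%nat).
{ intros i n k Hn; induction k as [|k IH]; simpl.
  - rewrite !Rminus_diag, Rabs_R0; lra.
  - replace (f (S (k + n)) i - f n i)
      with ((f (S (k + n)) i - f (k + n)%nat i) + (f (k + n)%nat i - f n i)) by ring.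
    eapply Rle_trans; [apply Rabs_triang |].
    pose proof (Hf (k + n)%nat i ltac:(lia)); pose proof (HT (k + n)%nat); lra. }
assert (Hc : forall eps, 0 < eps -> exists K, forall n m i, (K <= n)%nat -> (n <= m)%nat ->
          Rabs (f m i - f n i) < eps).
{ intros eps Heps; destruct (tail_lim v Hv (eps / 2)) as [K HK]; [lra |].
  exists (K + N)%nat; intros n m i Hn Hm.
  replace m with ((m - n) + n)%nat by lia.
  eapply Rle_lt_trans; [apply Hd; lia |].
  pose proof (HK n ltac:(lia)) as H1; pose proof (HK (m - n + n)%nat ltac:(lia)) as H2.
  fold (T n) in H1; fold (T (m - n + n)%nat) in H2.
  pose proof (Rle_abs (T n)); pose proof (Rle_abs (- T (m - n + n)%nat)) as H3.
  rewrite Rabs_Ropp in H3; lra. }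
assert (Hl : forall i, exists l : R, is_lim_seq (fun n => f n i) l).
{ intros i; apply ex_lim_seq_cauchy_corr; intros eps.
  destruct (Hc eps (cond_pos eps)) as [K HK]; exists K; intros n m Hn Hm.
  destruct (Nat.le_ge_cases n m) as [H | H].
  - rewrite Rabs_minus_sym; apply HK; lia.
  - apply HK; lia. }
exists (fun i => real (Lim_seq (fun n => f n i))); intros eps Heps.
destruct (Hc (eps / 2)) as [K HK]; [lra |]; exists K; intros n Hn i.
destruct (Hl i) as [l Hi]; rewrite (is_lim_seq_unique _ _ Hi); simpl.
apply Rle_lt_trans with (eps / 2); [| lra].
rewrite Rabs_minus_sym.
apply (is_lim_seq_le_loc (fun m => Rabs (f m i - f n i)) (fun _ => eps / 2)
         (Rabs (l - f n i)) (eps / 2)).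
- exists n; intros m Hm; left; apply HK; lia.
- apply (is_lim_seq_abs _ (l - f n i)).
  apply (is_lim_seq_minus' (fun m => f m i) (fun _ => f n i) l (f n i));
    [exact Hi | apply is_lim_seq_const].
- apply is_lim_seq_const.
Qed.

(** The second-order remainder of [f n p] is controlled by the bound on [f n (p + 2)], uniform in n,
    and so passes to the limit. *)
Lemma jet_ucv (f : nat -> nat -> R -> R) (g : nat -> R -> R) :
  (forall n, jet (f n)) -> (forall p, ucv (fun n => f n p) (g p)) ->
  (forall p, exists B N, forall n, (N <= n)%nat -> forall x, Rabs (f n p x) <= B) -> jet g.
Proof.
intros Jf Hc HB p x; destruct (HB (S (S p))) as [B [N H]].
apply (is_derive_quad _ _ _ B 1 Rlt_0_1); intros y _.
apply (is_lim_seq_le_loc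
         (fun n => Rabs (f n p y - f n p x - (y - x) * f n (S p) x))
         (fun _ => B * (y - x) ^ 2)
         (Rabs (g p y - g p x - (y - x) * g (S p) x)) (B * (y - x) ^ 2)).
- exists N; intros n Hn.
  apply (taylor_quad (f n p) (f n (S p)) (f n (S (S p)))); intros z _; try apply Jf.
  apply H, Hn.
- apply (is_lim_seq_abs _ (g p y - g p x - (y - x) * g (S p) x)).
  apply (is_lim_seq_minus' (fun n => f n p y - f n p x) (fun n => (y - x) * f n (S p) x)).
  + apply (is_lim_seq_minus' (fun n => f n p y) (fun n => f n p x));
      apply (ucv_lim (fun n => f n p)), Hc.
  + apply (is_lim_seq_scal_l _ (y - x) (g (S p) x)), (ucv_lim (fun n => f n (S p))), Hc.
- apply is_lim_seq_const.
Qed.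

(** The n-th derivative of the sum of the b_q f^(q): an operator of infinite order with constant
    coefficients commutes with differentiation. *)
Definition ser (b : nat -> R) (f : nat -> R -> R) (n : nat) (x : R) : R :=
  Series (fun q => b q * f (q + n)%nat x).

Lemma jet_ser b f : jet f ->
  (forall n, exists w : nat -> R, ex_series w /\ forall q x, Rabs (b q * f (q + n)%nat x) <= w q) ->
  jet (ser b f).
Proof.
intros Jf H n x.
destruct (H n) as [w0 [W0 H0]]; destruct (H (S n)) as [w1 [W1 H1]].
destruct (H (S (S n))) as [w2 [W2 H2]].
apply (is_derive_quad _ _ _ (Series w2) 1 Rlt_0_1); intros y _; unfold ser.
assert (E0 : forall z, ex_series (fun q => b q * f (q + n)%nat z))
  by (intros z; apply ex_series_dom with w0; auto).
assert (E1 : ex_series (fun q => b q * f (q + S n)%nat x))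
  by (apply ex_series_dom with w1; auto).
rewrite <- Series_scal_l, <- Series_minus by auto.
rewrite <- Series_minus;
  [| apply (@ex_series_minus R_AbsRing R_NormedModule); auto
   | apply (ex_series_scal_l (y - x) (fun q => b q * f (q + S n)%nat x)), E1].
rewrite (Rmult_comm (Series w2)), <- Series_scal_l; apply Series_dom;
  [| apply (ex_series_scal_l ((y - x) ^ 2) w2), W2].
intros q; rewrite Nat.add_succ_r.
specialize (H2 q); rewrite !Nat.add_succ_r in H2.
rewrite (Rmult_comm ((y - x) ^ 2)).
apply (taylor_quad (fun z => b q * f (q + n)%nat z) (fun z => b q * f (S (q + n)) z)
         (fun z => b q * f (S (S (q + n))) z)); intros z _;
  [apply is_derive_scal, Jf | apply is_derive_scal, Jf | apply H2].
Qed.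

(** * Integrals *)

Lemma ex_RInt_cont (f : R -> R) a b : (forall x, continuous f x) -> ex_RInt f a b.
Proof. intros H; apply (@ex_RInt_continuous R_CompleteNormedModule); auto. Qed.

Lemma RInt_linR (f g : R -> R) c d a b : ex_RInt f a b -> ex_RInt g a b ->
  ex_RInt (fun x => c * f x + d * g x) a b /\
  RInt (fun x => c * f x + d * g x) a b = c * RInt f a b + d * RInt g a b.
Proof.
intros [lf Hf] [lg Hg].
assert (H : is_RInt (fun x => c * f x + d * g x) a b (c * lf + d * lg)).
{ apply (@is_RInt_plus R_NormedModule (fun x => c * f x) (fun x => d * g x));
    [apply (@is_RInt_scal R_NormedModule f) | apply (@is_RInt_scal R_NormedModule g)];
    assumption. }
split; [exists (c * lf + d * lg); exact H |].
rewrite (is_RInt_unique _ _ _ _ Hf), (is_RInt_unique _ _ _ _ Hg).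
exact (is_RInt_unique _ _ _ _ H).
Qed.

Lemma RInt_ChaslesR (f : R -> R) a b c : ex_RInt f a b -> ex_RInt f b c ->
  RInt f a b + RInt f b c = RInt f a c.
Proof. exact (@RInt_Chasles R_CompleteNormedModule f a b c). Qed.

Lemma RInt_extR (f g : R -> R) a b :
  (forall x, Rmin a b < x < Rmax a b -> f x = g x) -> RInt f a b = RInt g a b.
Proof. exact (@RInt_ext R_CompleteNormedModule f g a b). Qed.

Lemma cont_mult (f g : R -> R) x :
  continuous f x -> continuous g x -> continuous (fun x => f x * g x) x.
Proof. intros Hf Hg; exact (continuous_mult f g x Hf Hg). Qed.

Lemma cont_affine (f : R -> R) k c x :
  (forall x, continuous f x) -> continuous (fun x => f (k * x + c)) x.
Proof.
intros Hf; apply (continuous_comp (fun x => k * x + c) f); [| apply Hf].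
apply (continuous_plus (fun x => k * x) (fun _ => c)); [| apply continuous_const].
apply (continuous_scal_r k (fun x : R => x)), continuous_id.
Qed.

Lemma ucv_RInt (f : nat -> R -> R) (g : R -> R) a b : a <= b ->
  (forall n x, continuous (f n) x) -> (forall x, continuous g x) -> ucv f g ->
  is_lim_seq (fun n => RInt (f n) a b) (RInt g a b).
Proof.
intros Hab Cf Cg H; apply is_lim_seq_spec; intros eps.
destruct (H (eps / 2 / (b - a + 1))) as [N HN].
{ pose proof (cond_pos eps); repeat apply Rdiv_lt_0_compat; lra. }
exists N; intros n Hn.
rewrite <- (RInt_minus (f n) g) by (apply ex_RInt_cont; auto).
apply Rle_lt_trans with ((b - a) * (eps / 2 / (b - a + 1))).
- apply abs_RInt_le_const; [exact Hab | |].
  + apply (@ex_RInt_minus R_NormedModule); apply ex_RInt_cont; auto.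
  + intros t _; left; exact (HN n Hn t).
- pose proof (cond_pos eps); apply Rmult_lt_reg_r with (b - a + 1); [lra |].
  replace ((b - a) * (eps / 2 / (b - a + 1)) * (b - a + 1)) with ((b - a) * eps / 2)
    by (field; lra); nra.
Qed.

(** The factor k lets one formula cover correlation (k = 1), mollification at scale d (k = -d), and
    ordinary convolution (k = -1), where the derivatives fall on the second function. *)
Definition cnv (u : R -> R) (k a b : R) (f : nat -> R -> R) (p : nat) (t : R) : R :=
  RInt (fun s => u s * f p (k * s + t)) a b.

Lemma cnv_cont (u : R -> R) k (f : nat -> R -> R) p t x : (forall x, continuous u x) -> (forall x, continuous (f p) x) ->
  continuous (fun s => u s * f p (k * s + t)) x.
Proof. intros Hu Hf; apply cont_mult; [apply Hu | apply cont_affine, Hf]. Qed.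

Lemma cnv_le (u : R -> R) k a b f p t U B : a <= b -> (forall x, continuous u x) ->
  (forall x, continuous (f p) x) -> (forall x, Rabs (u x) <= U) ->
  (forall x, Rabs (f p x) <= B) -> Rabs (cnv u k a b f p t) <= (b - a) * (U * B).
Proof.
intros Hab Cu Cf Hu Hf; apply abs_RInt_le_const; [exact Hab | |].
- apply ex_RInt_cont; intros; apply cnv_cont; auto.
- intros s _; rewrite Rabs_mult; apply Rmult_le_compat; auto using Rabs_pos.
Qed.

Lemma jet_cnv (u : R -> R) k a b f U : a <= b -> (forall x, continuous u x) ->
  (forall x, Rabs (u x) <= U) -> jet f ->
  (forall p, exists B, forall x, Rabs (f p x) <= B) -> jet (cnv u k a b f).
Proof.
intros Hab Cu Hu Jf HB p x; destruct (HB (S (S p))) as [B H].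
pose proof (jet_cont f Jf) as Cf.
apply (is_derive_quad _ _ _ ((b - a) * (U * B)) 1 Rlt_0_1); intros y _; unfold cnv.
assert (E : forall p t, ex_RInt (fun s => u s * f p (k * s + t)) a b)
  by (intros; apply ex_RInt_cont; intros; apply cnv_cont; auto).
destruct (RInt_linR _ _ 1 (-1) a b (E p y) (E p x)) as [E1 R1].
destruct (RInt_linR _ _ 1 (- (y - x)) a b E1 (E (S p) x)) as [E2 R2].
match goal with |- Rabs ?A <= _ => match type of R2 with _ = ?B =>
  replace A with B by (rewrite R1; ring) end end.
rewrite <- R2, Rmult_assoc.
apply abs_RInt_le_const; [exact Hab | exact E2 |]; intros s _.
match goal with |- Rabs ?A <= _ =>
  replace A with (u s * (f p (k * s + y) - f p (k * s + x)
                 - ((k * s + y) - (k * s + x)) * f (S p) (k * s + x))) by ring end.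
rewrite Rabs_mult, Rmult_assoc; apply Rmult_le_compat; auto using Rabs_pos.
replace ((y - x) ^ 2) with (((k * s + y) - (k * s + x)) ^ 2) by ring.
apply (taylor_quad (f p) (f (S p)) (f (S (S p)))); intros z _; auto.
Qed.

(** * Laplace averages and the heat flow *)

Definition cb (f : R -> R) : Prop :=
  (forall t, 0 <= t -> continuous f t) /\
  exists B, forall t, 0 <= t -> Rabs (f t) <= B.

(** The mean of f at an exponential time of expectation 1. For bounded continuous f the limit along
    integers exists by [laplace_lim]. *)
Definition laplace (f : R -> R) : R :=
  real (Lim_seq (fun n => RInt (fun t => exp (- t) * f t) 0 (INR n))).

Lemma cb_lin c d f g : cb f -> cb g -> cb (fun t => c * f t + d * g t).
Proof.
intros [Cf [A HA]] [Cg [B HB]]; split.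
- intros t Ht; apply (continuous_plus (fun t => c * f t) (fun t => d * g t)).
  + apply (continuous_scal_r c f), Cf, Ht.
  + apply (continuous_scal_r d g), Cg, Ht.
- exists (Rabs c * A + Rabs d * B); intros t Ht.
  eapply Rle_trans; [apply Rabs_triang |]; rewrite !Rabs_mult.
  apply Rplus_le_compat; apply Rmult_le_compat_l; auto using Rabs_pos.
Qed.

Lemma expneg_derive t : is_derive (fun t => exp (- t)) t (- exp (- t)).
Proof. auto_derive; [exact I | ring]. Qed.

Lemma expneg_cont t : continuous (fun t => exp (- t)) t.
Proof. exact (is_derive_continuous _ _ _ (expneg_derive t)). Qed.

Lemma ex_RInt_laplace f a b : cb f -> 0 <= a -> a <= b ->
  ex_RInt (fun t => exp (- t) * f t) a b.
Proof.
intros [Cf _] Ha Hab; apply (@ex_RInt_continuous R_CompleteNormedModule).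
intros z Hz; rewrite Rmin_left, Rmax_right in Hz by lra.
apply cont_mult; [apply expneg_cont | apply Cf; lra].
Qed.

Lemma RInt_laplace_le f a b B : cb f -> 0 <= a -> a <= b ->
  (forall t, 0 <= t -> Rabs (f t) <= B) ->
  Rabs (RInt (fun t => exp (- t) * f t) a b) <= B * (exp (- a) - exp (- b)).
Proof.
intros Hf Ha Hab HB.
apply (@norm_RInt_le R_NormedModule (fun t => exp (- t) * f t)
         (fun t => B * exp (- t)) a b); [exact Hab | | |].
- intros x Hx; change (Rabs (exp (- x) * f x) <= B * exp (- x)).
  rewrite Rabs_mult, Rabs_pos_eq by (left; apply exp_pos).
  rewrite Rmult_comm; apply Rmult_le_compat_r; [left; apply exp_pos | apply HB; lra].
- apply (@RInt_correct R_CompleteNormedModule), ex_RInt_laplace; assumption.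
- replace (B * (exp (- a) - exp (- b)))
    with (minus (- (B * exp (- b))) (- (B * exp (- a))))
    by (unfold minus, plus, opp; simpl; ring).
  apply (is_RInt_derive (fun t => - (B * exp (- t)))).
  + intros x _; auto_derive; [exact I | ring].
  + intros x _; apply (continuous_scal_r B (fun t => exp (- t))), expneg_cont.
Qed.

Lemma expneg_lim : is_lim_seq (fun n => exp (- INR n)) 0.
Proof.
apply (is_lim_seq_le_le (fun _ => 0) _ (fun n => / (INR n + 1))).
- intros n; split; [left; apply exp_pos |].
  rewrite exp_Ropp; apply Rinv_le_contravar; [pose proof (pos_INR n); lra |].
  rewrite Rplus_comm; destruct n as [|n]; [simpl; rewrite exp_0; lra |].
  left; apply exp_ineq1; pose proof (lt_0_INR (S n) ltac:(lia)); lra.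
- apply is_lim_seq_const.
- apply (is_lim_seq_inv _ p_infty); [| discriminate].
  apply (is_lim_seq_plus _ _ p_infty 1); [apply is_lim_seq_INR | apply is_lim_seq_const | reflexivity].
Qed.

Lemma laplace_lim f : cb f ->
  is_lim_seq (fun n => RInt (fun t => exp (- t) * f t) 0 (INR n)) (laplace f).
Proof.
intros Hf; destruct (proj2 Hf) as [B HB].
assert (Hc : ex_finite_lim_seq (fun n => RInt (fun t => exp (- t) * f t) 0 (INR n))).
{ apply ex_lim_seq_cauchy_corr; intros eps.
  pose proof expneg_lim as Hl; apply is_lim_seq_spec in Hl.
  assert (HB0 : 0 <= B) by (eapply Rle_trans; [apply Rabs_pos | apply (HB 0); lra]).
  assert (He : 0 < eps / (B + 1))
    by (apply Rdiv_lt_0_compat; [apply cond_pos | lra]).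
  destruct (Hl (mkposreal _ He)) as [N HN]; exists N; simpl in HN.
  assert (Hw : forall n m, (N <= n)%nat -> (n <= m)%nat ->
    Rabs (RInt (fun t => exp (- t) * f t) 0 (INR m)
          - RInt (fun t => exp (- t) * f t) 0 (INR n)) < eps).
  { intros n m Hn Hm; pose proof (pos_INR n) as P; pose proof (le_INR n m Hm) as Q.
    rewrite <- (RInt_ChaslesR _ 0 (INR n) (INR m)) by (apply ex_RInt_laplace; auto; lra).
    assert (Er : forall a b : R, a + b - a = b) by (intros; ring); rewrite Er.
    eapply Rle_lt_trans; [apply (RInt_laplace_le f _ _ B); auto |].
    specialize (HN n Hn); rewrite Rminus_0_r, Rabs_pos_eq in HN by (left; apply exp_pos).
    pose proof (exp_pos (- INR m)).
    apply Rle_lt_trans with (B * exp (- INR n)); [apply Rmult_le_compat_l; lra |].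
    apply Rmult_lt_reg_r with (/ (B + 1)); [apply Rinv_0_lt_compat; lra |].
    eapply Rle_lt_trans; [| exact HN].
    pose proof (exp_pos (- INR n)).
    apply Rmult_le_reg_r with (B + 1); [lra |].
    rewrite Rmult_assoc, Rinv_l by lra; nra. }
  intros n m Hn Hm; destruct (Nat.le_ge_cases n m) as [H | H].
  - rewrite Rabs_minus_sym; apply Hw; lia.
  - apply Hw; lia. }
destruct Hc as [l Hl]; unfold laplace; rewrite (is_lim_seq_unique _ _ Hl); exact Hl.
Qed.

Lemma laplace_ext f g : (forall t, 0 <= t -> f t = g t) -> laplace f = laplace g.
Proof.
intros H; unfold laplace; f_equal; apply Lim_seq_ext; intros n; apply RInt_extR.
intros x Hx; rewrite Rmin_left in Hx by apply pos_INR; rewrite H by lra; reflexivity.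
Qed.

Lemma laplace_lin c d f g : cb f -> cb g ->
  laplace (fun t => c * f t + d * g t) = c * laplace f + d * laplace g.
Proof.
intros Hf Hg.
pose proof (laplace_lim _ (cb_lin c d f g Hf Hg)) as H1.
apply is_lim_seq_unique in H1.
assert (H2 : is_lim_seq (fun n => RInt (fun t => exp (- t) * (c * f t + d * g t)) 0 (INR n))
               (c * laplace f + d * laplace g)).
{ apply is_lim_seq_ext with (fun n => c * RInt (fun t => exp (- t) * f t) 0 (INR n)
                                      + d * RInt (fun t => exp (- t) * g t) 0 (INR n)).
  - intros n.
    destruct (RInt_linR (fun t => exp (- t) * f t) (fun t => exp (- t) * g t) c d 0 (INR n))
      as [_ <-]; try (apply ex_RInt_laplace; auto using pos_INR; lra).
    apply RInt_extR; intros; ring.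
  - apply (is_lim_seq_plus' _ _ (c * laplace f) (d * laplace g)).
    + apply (is_lim_seq_scal_l _ c (laplace f)), laplace_lim, Hf.
    + apply (is_lim_seq_scal_l _ d (laplace g)), laplace_lim, Hg. }
apply is_lim_seq_unique in H2; rewrite H1 in H2; congruence.
Qed.

Lemma laplace_le f B : cb f -> (forall t, 0 <= t -> Rabs (f t) <= B) -> Rabs (laplace f) <= B.
Proof.
intros Hf HB.
assert (HB0 : 0 <= B) by (eapply Rle_trans; [apply Rabs_pos | apply (HB 0); lra]).
apply (is_lim_seq_le (fun n => Rabs (RInt (fun t => exp (- t) * f t) 0 (INR n)))
         (fun _ => B) (Rabs (laplace f)) B).
- intros n; eapply Rle_trans; [apply (RInt_laplace_le f _ _ B); auto using pos_INR; lra |].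
  rewrite Ropp_0, exp_0; pose proof (exp_pos (- INR n)); nra.
- apply (is_lim_seq_abs _ (laplace f)), laplace_lim, Hf.
- apply is_lim_seq_const.
Qed.

Lemma laplace_mono f g : cb f -> cb g -> (forall t, 0 <= t -> f t <= g t) ->
  laplace f <= laplace g.
Proof.
intros Hf Hg H.
apply (is_lim_seq_le (fun n => RInt (fun t => exp (- t) * f t) 0 (INR n))
         (fun n => RInt (fun t => exp (- t) * g t) 0 (INR n)) (laplace f) (laplace g)).
- intros n; apply RInt_le; try (apply ex_RInt_laplace; auto using pos_INR; lra);
    [apply pos_INR |].
  intros x Hx; apply Rmult_le_compat_l; [left; apply exp_pos | apply H; lra].
- apply laplace_lim, Hf.
- apply laplace_lim, Hg.
Qed.

(** Integration by parts against exp (-t). This identity is what makes an exponential average of the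
    heat flow a resolvent. *)
Lemma laplace_derive (F f : R -> R) :
  (forall t, 0 <= t -> is_derive F t (f t)) -> cb f -> (exists B, forall t, 0 <= t -> Rabs (F t) <= B) ->
  laplace f = laplace F - F 0.
Proof.
intros HF Hf HB.
assert (CF : cb F).
{ split; [| exact HB]; intros t Ht; apply (is_derive_continuous _ _ _ (HF t Ht)). }
assert (Hl : is_lim_seq (fun n => RInt (fun t => exp (- t) * f t) 0 (INR n)
                         - RInt (fun t => exp (- t) * F t) 0 (INR n)) (0 - F 0)).
{ apply is_lim_seq_ext with (fun n => exp (- INR n) * F (INR n) - F 0).
  - intros n; symmetry.
    assert (E : is_RInt (fun t => 1 * (exp (- t) * f t) + (-1) * (exp (- t) * F t)) 0 (INR n)
                  (minus (exp (- INR n) * F (INR n)) (exp (- 0) * F 0))).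
    { apply (is_RInt_derive (fun t => exp (- t) * F t)).
      - intros x Hx; rewrite Rmin_left in Hx by apply pos_INR.
        eapply is_derive_eq.
        + apply (is_derive_mult (fun t => exp (- t)) F);
            [apply expneg_derive | apply HF; lra | intros; apply Rmult_comm].
        + unfold plus, mult; simpl; ring.
      - intros x Hx; rewrite Rmin_left in Hx by apply pos_INR.
        apply (continuous_plus (fun t => 1 * (exp (- t) * f t)) (fun t => -1 * (exp (- t) * F t))).
        + apply (continuous_scal_r 1 (fun t => exp (- t) * f t)), cont_mult;
            [apply expneg_cont | apply (proj1 Hf); lra].
        + apply (continuous_scal_r (-1) (fun t => exp (- t) * F t)), cont_mult;
            [apply expneg_cont | apply (proj1 CF); lra]. }
    apply (is_RInt_unique (V := R_CompleteNormedModule)) in E.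
    destruct (RInt_linR (fun t => exp (- t) * f t) (fun t => exp (- t) * F t) 1 (-1) 0 (INR n))
      as [_ E2]; try (apply ex_RInt_laplace; auto using pos_INR; lra).
    assert (E3 := eq_trans (eq_sym E2) E).
    unfold minus, plus, opp in E3; simpl in E3; rewrite Ropp_0, exp_0 in E3; lra.
  - apply (is_lim_seq_minus' _ _ 0 (F 0)); [| apply is_lim_seq_const].
    destruct HB as [B HB].
    apply (is_lim_seq_le_le (fun n => - (B * exp (- INR n))) _ (fun n => B * exp (- INR n))).
    + intros n; pose proof (exp_pos (- INR n)) as P.
      assert (H := HB (INR n) (pos_INR n)); apply Rabs_le_between in H; nra.
    + replace (Finite 0) with (Rbar_opp (B * 0)) by (simpl; f_equal; ring).
      apply is_lim_seq_opp with (l := Finite (B * 0)).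
      apply (is_lim_seq_ext (fun n => B * exp (- INR n))); [intros; reflexivity |].
      apply (is_lim_seq_scal_l _ B 0), expneg_lim.
    + replace (Finite 0) with (Finite (B * 0)) by (f_equal; ring).
      apply (is_lim_seq_scal_l _ B 0), expneg_lim. }
pose proof (is_lim_seq_minus' _ _ _ _ (laplace_lim f Hf) (laplace_lim F CF)) as H2.
apply is_lim_seq_unique in Hl; apply is_lim_seq_unique in H2.
rewrite Hl in H2; injection H2; lra.
Qed.

(* [s p tau x] is the p-th x-derivative of a solution of the heat equation. *)
Record hfam (s : nat -> R -> R -> R) : Prop := {
  hf_x : forall p tau x, 0 < tau -> is_derive (s p tau) x (s (S p) tau x);
  hf_t : forall p tau x, 0 < tau ->
    is_derive (fun tau => s p tau x) tau (s (S (S p)) tau x);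
  hf_b : forall p tau0, 0 < tau0 -> exists B, forall tau x,
    tau0 <= tau -> Rabs (s p tau x) <= B }.

(** The resolvent (1 - c d^2/dx^2)^-1 applied to s: the heat flow is followed for an exponential
    time of expectation c, which sends solutions of the heat equation to solutions. *)
Definition avg (c : R) (s : nat -> R -> R -> R) (p : nat) (tau x : R) : R :=
  laplace (fun t => s p (tau + c * t) x).

Section Average.

Variables (c : R) (s : nat -> R -> R -> R).
Hypotheses (Hc : 0 < c) (Hs : hfam s).

Lemma avg_derive_t p tau x t : 0 < tau + c * t ->
  is_derive (fun t => s p (tau + c * t) x) t (c * s (S (S p)) (tau + c * t) x).
Proof using Hs.
intros Ht; eapply is_derive_eq.
- apply (is_derive_comp (fun u => s p u x) (fun t => tau + c * t));
    [apply (hf_t s Hs), Ht |].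
  eapply is_derive_eq; [apply (is_derive_plus (fun _ => tau) (fun t => c * t)) |].
  + apply is_derive_const.
  + apply is_derive_scal, is_derive_id.
  + reflexivity.
- unfold scal, plus, zero, one; simpl; unfold mult; simpl; ring.
Qed.

Lemma avg_cb p tau x : 0 < tau -> cb (fun t => s p (tau + c * t) x).
Proof using Hc Hs.
intros Ht; split.
- intros t Ht'; eapply is_derive_continuous; apply avg_derive_t; nra.
- destruct (hf_b s Hs p tau Ht) as [B HB]; exists B; intros t Ht'; apply HB; nra.
Qed.

Lemma avg_le p tau x D : 0 < tau ->
  (forall tau', tau <= tau' -> Rabs (s p tau' x) <= D) -> Rabs (avg c s p tau x) <= D.
Proof using Hc Hs.
intros Ht HD; apply laplace_le; [apply avg_cb, Ht |]; intros t Ht'; apply HD; nra.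
Qed.

(** By the heat equation, c s'' is the derivative in t of s at time tau + c t; [laplace_derive] then
    leaves the value at t = 0. *)
Lemma avg_resolvent p tau x : 0 < tau ->
  avg c s p tau x - c * avg c s (S (S p)) tau x = s p tau x.
Proof using Hc Hs.
intros Ht.
assert (H := laplace_derive (fun t => s p (tau + c * t) x)
               (fun t => c * s (S (S p)) (tau + c * t) x)).
replace (s p tau x) with (s p (tau + c * 0) x) by (f_equal; ring).
assert (E : laplace (fun t => c * s (S (S p)) (tau + c * t) x)
            = c * avg c s (S (S p)) tau x).
{ pose proof (laplace_lin c 0 _ _ (avg_cb (S (S p)) tau x Ht) (avg_cb (S (S p)) tau x Ht)) as L.
  unfold avg; rewrite <- (Rplus_0_r (c * _)), <- (Rmult_0_l (laplace (fun t => s (S (S p)) (tau + c * t) x))).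
  rewrite <- L; apply laplace_ext; intros; ring. }
rewrite <- E, H; [unfold avg; lra | | |].
- intros t Ht'; apply avg_derive_t; nra.
- pose proof (cb_lin c 0 _ _ (avg_cb (S (S p)) tau x Ht) (avg_cb (S (S p)) tau x Ht)) as L.
  replace (fun t => c * s (S (S p)) (tau + c * t) x)
    with (fun t => c * s (S (S p)) (tau + c * t) x + 0 * s (S (S p)) (tau + c * t) x);
    [exact L |].
  apply functional_extensionality; intros; ring.
- exact (proj2 (avg_cb p tau x Ht)).
Qed.

Lemma laplace_taylor (f g h : R -> R) d B : cb f -> cb g -> cb h ->
  (forall t, 0 <= t -> Rabs (f t - g t - d * h t) <= B) ->
  Rabs (laplace f - laplace g - d * laplace h) <= B.
Proof.
intros Cf Cg Ch HB.
pose proof (cb_lin 1 (-1) f g Cf Cg) as C1.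
pose proof (cb_lin 1 (- d) _ h C1 Ch) as C2.
replace (laplace f - laplace g - d * laplace h)
  with (laplace (fun t => 1 * (1 * f t + -1 * g t) + - d * h t)).
- apply laplace_le; [exact C2 |]; intros t Ht.
  replace (1 * (1 * f t + -1 * g t) + - d * h t) with (f t - g t - d * h t) by ring; auto.
- rewrite (laplace_lin 1 (- d) (fun t => 1 * f t + -1 * g t) h C1 Ch),
    (laplace_lin 1 (-1) f g Cf Cg); ring.
Qed.

Lemma hfam_avg : hfam (avg c s).
Proof using Hc Hs.
split.
- intros p tau x Ht; destruct (hf_b s Hs (S (S p)) tau Ht) as [B HB].
  apply (is_derive_quad _ _ _ B 1 Rlt_0_1); intros y _.
  apply laplace_taylor; try (apply avg_cb, Ht).
  intros t Ht'; assert (0 < tau + c * t) by nra.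
  apply (taylor_quad (s p (tau + c * t)) (s (S p) (tau + c * t)) (s (S (S p)) (tau + c * t)));
    intros z _; [apply (hf_x s Hs); assumption | apply (hf_x s Hs); assumption |].
  apply HB; nra.
(* The second derivative in time is a fourth derivative in space, and the radius tau / 2 keeps all
   times above tau / 2, where [hf_b] gives a bound. *)
- intros p tau x Ht; destruct (hf_b s Hs (S (S (S (S p)))) (tau / 2)) as [B HB]; [lra |].
  apply (is_derive_quad _ _ _ B (tau / 2)); [lra |]; intros y Hy.
  assert (Hy' : 0 < y) by (revert Hy; unfold Rabs; destruct Rcase_abs; lra).
  apply laplace_taylor; try (apply avg_cb; assumption).
  intros t Ht'.
  assert (Hz : forall z, Rabs (z - tau) <= Rabs (y - tau) -> tau / 2 <= z + c * t).
  { intros z Hz; assert (tau / 2 <= z) by (revert Hz Hy; unfold Rabs;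
      repeat destruct Rcase_abs; lra); nra. }
  assert (D : forall q z, 0 < z + c * t ->
            is_derive (fun u => s q (u + c * t) x) z (s (S (S q)) (z + c * t) x)).
  { intros q z Hzz; eapply is_derive_eq.
    - apply (is_derive_comp (fun u => s q u x) (fun u => u + c * t));
        [apply (hf_t s Hs), Hzz |].
      apply (is_derive_plus (fun u : R => u) (fun _ => c * t));
        [apply is_derive_id | apply is_derive_const].
    - unfold scal, plus, zero, one; simpl; unfold mult; simpl; ring. }
  apply (taylor_quad (fun u => s p (u + c * t) x) (fun u => s (S (S p)) (u + c * t) x)
           (fun u => s (S (S (S (S p)))) (u + c * t) x)); intros z H.
  + apply D; specialize (Hz z H); lra.
  + apply D; specialize (Hz z H); lra.
  + apply HB, Hz, H.
- intros p tau0 Ht; destruct (hf_b s Hs p tau0 Ht) as [B HB]; exists B.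
  intros tau x Htau; apply avg_le; [lra |]; intros tau' Ht'; apply HB; lra.
Qed.

End Average.

(** * Bounded solutions of first-order equations *)

(** If w exceeded D at x0, then exp (- a x) (w - D) would be nondecreasing from there on, so w - D
    would grow exponentially and pass the bound W. *)
Lemma ode_upper (w k : R -> R) a D W : 0 < a ->
  (forall x, is_derive w x (a * w x + k x)) -> (forall x, Rabs (k x) <= a * D) ->
  (forall x, w x <= W) -> forall x, w x <= D.
Proof.
intros Ha Hw Hk HW x0; apply Rnot_lt_le; intros Hlt.
set (z := fun x => exp (- a * x) * (w x - D)).
assert (Hz : forall x, is_derive z x (exp (- a * x) * (k x + a * D))).
{ intros x; eapply is_derive_eq.
  - apply (is_derive_mult (fun x => exp (- a * x)) (fun x => w x - D)).
    + instantiate (1 := - a * exp (- a * x)); auto_derive; [exact I | ring].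
    + apply (is_derive_minus w (fun _ => D)); [apply Hw | apply is_derive_const].
    + intros; apply Rmult_comm.
  - unfold minus, plus, mult, zero, opp; simpl; ring. }
assert (Hmono : forall x, x0 <= x -> z x0 <= z x).
{ intros x Hx; destruct (mvt z _ x0 x (fun y _ => Hz y)) as [c [_ Hc]].
  assert (0 <= k c + a * D).
  { specialize (Hk c); apply Rabs_le_between in Hk; lra. }
  pose proof (exp_pos (- a * c)).
  assert (0 <= exp (- a * c) * (k c + a * D)) by (apply Rmult_le_pos; lra).
  nra. }
set (d := w x0 - D) in *.
(* Far enough for the linear lower bound of the exponential, 1 + a (x - x0), to yield the
   contradiction with W. *)
set (x := x0 + (Rabs (W - D) + 1) / (a * d)).
assert (Hd : 0 < d) by (unfold d; lra).
assert (Hx : x0 < x).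
{ unfold x; assert (0 < (Rabs (W - D) + 1) / (a * d)); [| lra].
  apply Rdiv_lt_0_compat; [pose proof (Rabs_pos (W - D)); lra | nra]. }
specialize (Hmono x ltac:(lra)); unfold z in Hmono; fold d in Hmono.
assert (H1 : exp (a * (x - x0)) * d <= w x - D).
{ replace (exp (a * (x - x0))) with (exp (a * x) * exp (- a * x0))
    by (rewrite <- exp_plus; f_equal; ring).
  apply Rmult_le_reg_l with (exp (- a * x)); [apply exp_pos |].
  replace (exp (- a * x) * (exp (a * x) * exp (- a * x0) * d))
    with (exp (- a * x) * exp (a * x) * (exp (- a * x0) * d)) by ring.
  rewrite <- exp_plus; replace (- a * x + a * x) with 0 by ring.
  rewrite exp_0; lra. }
assert (H2 : 1 + a * (x - x0) < exp (a * (x - x0))) by (apply exp_ineq1; nra).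
assert (H3 : a * (x - x0) * d = Rabs (W - D) + 1) by (unfold x; field; lra).
specialize (HW x); pose proof (Rle_abs (W - D)); nra.
Qed.

Lemma ode_bound (w k : R -> R) a D W : 0 < a ->
  (forall x, is_derive w x (a * w x + k x)) -> (forall x, Rabs (k x) <= a * D) ->
  (forall x, Rabs (w x) <= W) -> forall x, Rabs (w x) <= D.
Proof.
intros Ha Hw Hk HW x; apply Rabs_le; split.
- enough (- w x <= D) by lra.
  apply (ode_upper (fun x => - w x) (fun x => - k x) a D W); auto.
  + intros y; eapply is_derive_eq; [apply (is_derive_opp w), Hw |].
    unfold opp; simpl; ring.
  + intros y; rewrite Rabs_Ropp; auto.
  + intros y; specialize (HW y); apply Rabs_le_between in HW; lra.
- apply (ode_upper w k a D W); auto.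
  intros y; specialize (HW y); apply Rabs_le_between in HW; lra.
Qed.

(* A gain of one derivative: both [a U + U'] and [a U - U'] solve first-order
   equations whose only bounded solutions are controlled by the right-hand side. *)
Lemma resolvent_gain (U U' U'' : R -> R) a B W : 0 < a ->
  (forall x, is_derive U x (U' x)) -> (forall x, is_derive U' x (U'' x)) ->
  (forall x, Rabs (U x) <= W) -> (forall x, Rabs (U' x) <= W) ->
  (forall x, Rabs (U x - / a ^ 2 * U'' x) <= B) -> forall x, Rabs (U' x) <= a * B.
Proof.
intros Ha H1 H2 HW HW' HB x.
assert (HF : forall y, U'' y = a ^ 2 * (U y - (U y - / a ^ 2 * U'' y)))
  by (intros y; field; lra).
assert (HkB : forall y, Rabs (a ^ 2 * (U y - / a ^ 2 * U'' y)) <= a * (a * B)).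
{ intros y; rewrite Rabs_mult, (Rabs_pos_eq (a ^ 2)) by nra.
  replace (a * (a * B)) with (a ^ 2 * B) by ring.
  apply Rmult_le_compat_l; [nra | apply HB]. }
assert (Hb : forall e y, Rabs e = 1 -> Rabs (a * U y + e * U' y) <= a * W + W).
{ intros e y He; eapply Rle_trans; [apply Rabs_triang |].
  rewrite !Rabs_mult, He, (Rabs_pos_eq a) by lra.
  specialize (HW y); specialize (HW' y); nra. }
assert (P1 : Rabs (a * U x + 1 * U' x) <= a * B).
{ apply (ode_bound (fun y => a * U y + 1 * U' y)
           (fun y => - (a ^ 2 * (U y - / a ^ 2 * U'' y))) a (a * B) (a * W + W)); auto.
  - intros y; eapply is_derive_eq.
    + apply (is_derive_plus (fun y => a * U y) (fun y => 1 * U' y));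
        apply is_derive_scal; auto.
    + unfold plus; simpl; field; lra.
  - intros y; rewrite Rabs_Ropp; auto.
  - intros y; apply Hb, Rabs_R1. }
(* a U - U' solves the equation with -a in place of a; the reflection of the line restores the
   sign. *)
assert (P2 : Rabs (a * U x + -1 * U' x) <= a * B).
{ assert (Hopp : forall y : R, is_derive (fun y : R => - y) y (-1)).
  { intros y; eapply is_derive_eq; [apply (is_derive_opp (fun y : R => y)), is_derive_id |].
    reflexivity. }
  replace x with (- (- x)) by ring.
  apply (ode_bound (fun y => a * U (- y) + -1 * U' (- y))
           (fun y => - (a ^ 2 * (U (- y) - / a ^ 2 * U'' (- y)))) a (a * B) (a * W + W)); auto.
  - intros y; eapply is_derive_eq.
    + apply (is_derive_plus (fun y => a * U (- y)) (fun y => -1 * U' (- y)));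
        apply is_derive_scal; [apply (is_derive_comp U (fun y => - y)); auto
                              | apply (is_derive_comp U' (fun y => - y)); auto].
    + unfold plus, scal; simpl; unfold mult; simpl; field; lra.
  - intros y; rewrite Rabs_Ropp; auto.
  - intros y; apply Hb; unfold Rabs; destruct Rcase_abs; lra. }
apply Rabs_le_between in P1; apply Rabs_le_between in P2; apply Rabs_le; lra.
Qed.

(** * Derivatives of the heat kernel *)

(** The heat kernel without its factor 1/sqrt (4 pi). The derivatives are given by the three-term
    recursion of the Hermite polynomials, on which the heat equation and the estimates rest. *)
Fixpoint heat (p : nat) (tau x : R) : R :=
  match p with
  | O => exp (- (x ^ 2 / (4 * tau))) / sqrt tau
  | S q => - (x * heat q tau x
              + match q with O => 0 | S r => INR q * heat r tau x end) / (2 * tau)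
  end.

Lemma is_derive_ext_pos (f g : R -> R) (x l : R) : (forall t, 0 < t -> f t = g t) ->
  0 < x -> is_derive f x l -> is_derive g x l.
Proof.
intros H Hx; apply is_derive_ext_loc; exists (mkposreal x Hx); intros u Hu; apply H.
change (Rabs (u - x) < x) in Hu; revert Hu; unfold Rabs; destruct Rcase_abs; lra.
Qed.

Lemma heat_SS p tau x : heat (S (S p)) tau x
  = - (x * heat (S p) tau x + INR (S p) * heat p tau x) / (2 * tau).
Proof. reflexivity. Qed.

Lemma heat_1 tau x : heat 1 tau x = - (x * heat 0 tau x + 0) / (2 * tau).
Proof. reflexivity. Qed.

Lemma heat_pos tau x : 0 < tau -> 0 < heat 0 tau x.
Proof. intros H; apply Rdiv_lt_0_compat; [apply exp_pos | apply sqrt_lt_R0, H]. Qed.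

Lemma heat_x p tau x : 0 < tau -> is_derive (heat p tau) x (heat (S p) tau x).
Proof.
intros Ht; revert x.
(* The three-term recursion forces the induction to carry two consecutive orders. *)
enough ((forall x, is_derive (heat p tau) x (heat (S p) tau x)) /\
        (forall x, is_derive (heat (S p) tau) x (heat (S (S p)) tau x))) as [H _]
  by exact H.
assert (H0 : forall x, is_derive (heat 0 tau) x (heat 1 tau x)).
{ intros x; simpl; auto_derive; [exact I |].
  pose proof (sqrt_lt_R0 tau Ht); unfold Rdiv; rewrite ?Rmult_1_r; field; lra. }
induction p as [|p [IH1 IH2]].
- split; [exact H0 |]; intros x.
  apply (is_derive_extR (fun x => (- / (2 * tau)) * (x * heat 0 tau x))).
  { intros t; rewrite heat_1; field; lra. }
  eapply is_derive_eq.
  + apply is_derive_scal, (is_derive_mult (fun x : R => x) (heat 0 tau));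
      [apply is_derive_id | apply H0 | intros; apply Rmult_comm].
  + rewrite heat_SS, heat_1; unfold plus, mult, one; cbn -[heat]; field; lra.
- split; [exact IH2 |]; intros x.
  apply (is_derive_extR (fun x => (- / (2 * tau)) *
           (x * heat (S p) tau x + INR (S p) * heat p tau x))).
  { intros t; rewrite heat_SS; field; lra. }
  eapply is_derive_eq.
  + apply is_derive_scal.
    apply (is_derive_plus (fun x => x * heat (S p) tau x) (fun x => INR (S p) * heat p tau x)).
    * apply (is_derive_mult (fun x : R => x) (heat (S p) tau));
        [apply is_derive_id | apply IH2 | intros; apply Rmult_comm].
    * apply is_derive_scal, IH1.
  + rewrite (heat_SS (S p)), (S_INR (S p)).
    unfold plus, mult, one; cbn -[heat INR]; field; lra.
Qed.

Lemma heat_t p tau x : 0 < tau ->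
  is_derive (fun tau => heat p tau x) tau (heat (S (S p)) tau x).
Proof.
intros Ht.
enough (forall tau, 0 < tau ->
          is_derive (fun tau => heat p tau x) tau (heat (S (S p)) tau x) /\
          is_derive (fun tau => heat (S p) tau x) tau (heat (S (S (S p))) tau x)) as H
  by (exact (proj1 (H tau Ht))).
assert (Hinv : forall tau, 0 < tau ->
          is_derive (fun tau => - / (2 * tau)) tau (/ (2 * tau ^ 2))).
{ intros u Hu; auto_derive; [lra | field; lra]. }
clear tau Ht.
assert (H0 : forall tau, 0 < tau -> is_derive (fun tau => heat 0 tau x) tau (heat 2 tau x)).
{ intros tau Ht; pose proof (sqrt_lt_R0 tau Ht); simpl; auto_derive; [lra |].
  assert (E : tau = sqrt tau * sqrt tau) by (rewrite sqrt_sqrt; lra).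
  unfold Rdiv; rewrite !Rmult_1_r.
  set (r := sqrt tau) in *; clearbody r.
  set (ex := exp _); clearbody ex; subst tau; field; lra. }
induction p as [|p IH]; intros tau Ht.
- split; [exact (H0 tau Ht) |].
  apply (is_derive_ext_pos (fun tau => (- / (2 * tau)) * (x * heat 0 tau x))).
  2: exact Ht.
  { intros u Hu.
    rewrite heat_1; field; lra. }
  eapply is_derive_eq.
  + apply (is_derive_mult (fun tau => - / (2 * tau)) (fun tau => x * heat 0 tau x));
      [apply Hinv, Ht | apply is_derive_scal, H0, Ht | intros; apply Rmult_comm].
  + rewrite (heat_SS 1); unfold plus, mult; cbn -[INR heat].
    rewrite (heat_SS 0), heat_1; simpl INR; field; lra.
- destruct (IH tau Ht) as [I1 I2]; split; [exact I2 |].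
  apply (is_derive_ext_pos (fun tau => (- / (2 * tau)) *
           (x * heat (S p) tau x + INR (S p) * heat p tau x))).
  2: exact Ht.
  { intros u Hu.
    rewrite heat_SS; field; lra. }
  eapply is_derive_eq.
  + apply (is_derive_mult (fun tau => - / (2 * tau))
             (fun tau => x * heat (S p) tau x + INR (S p) * heat p tau x));
      [apply Hinv, Ht | | intros; apply Rmult_comm].
    apply (is_derive_plus (fun tau => x * heat (S p) tau x) (fun tau => INR (S p) * heat p tau x));
      apply is_derive_scal; [exact I2 | exact I1].
  + rewrite (heat_SS (S (S p))).
    replace (heat (S (S p)) tau x)
      with (- (x * heat (S p) tau x + INR (S p) * heat p tau x) / (2 * tau))
      by (rewrite heat_SS; reflexivity).
    assert (E : x * heat (S p) tau x + INR (S p) * heat p tau x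
                = - (2 * tau) * heat (S (S p)) tau x) by (rewrite heat_SS; field; lra).
    rewrite E; rewrite (S_INR (S (S p))), (S_INR (S p)).
    unfold plus, mult; cbn -[heat INR]; field; lra.
Qed.

(* The Taylor coefficients of [exp (- (x h) / (2 tau)) * exp (- h^2 / (4 tau))] in
   [h] are dominated by those of the same function with plus signs. *)
Lemma heat_cauchy p tau x r : 0 < tau -> 0 < r ->
  Rabs (heat p tau x) * r ^ p
  <= INR (fact p) * exp ((Rabs x * r + r ^ 2) / (2 * tau)) * heat 0 tau x.
Proof.
intros Ht Hr; set (A := (Rabs x * r + r ^ 2) / (2 * tau)).
assert (HA : 0 <= A).
{ unfold A; apply Rmult_le_pos; [pose proof (Rabs_pos x); nra |].
  left; apply Rinv_0_lt_compat; lra. }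
(* The order q is estimated with the partial sum E q of exp A: the induction closes because A * E q
   <= (q + 1) * E (q + 1), and E q <= exp A is used only at the end. *)
set (E := sum_f_R0 (fun k => A ^ k / INR (fact k))).
assert (Hterm : forall k, 0 <= A ^ k / INR (fact k)).
{ intros k; apply Rmult_le_pos; [apply pow_le, HA |].
  left; apply Rinv_0_lt_compat, INR_fact_lt_0. }
assert (HE0 : forall k, 0 <= E k).
{ induction k as [|k IH]; [apply Hterm |]; unfold E in *; simpl.
  pose proof (Hterm (S k)); simpl in *; lra. }
assert (HES : forall k, E k <= E (S k)).
{ intros k; unfold E; simpl; pose proof (Hterm (S k)); simpl in *; lra. }
assert (HAE : forall k, A * E k <= INR (S k) * E (S k)).
{ induction k as [|k IH].
  - unfold E; simpl; lra.
  - replace (E (S k)) with (E k + A ^ (S k) / INR (fact (S k))) at 1 by reflexivity.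
    replace (E (S (S k))) with (E (S k) + A ^ (S (S k)) / INR (fact (S (S k)))) by reflexivity.
    assert (Hf : A * (A ^ S k / INR (fact (S k)))
                 = INR (S (S k)) * (A ^ S (S k) / INR (fact (S (S k))))).
    { rewrite (fact_simpl (S k)), mult_INR, <- (tech_pow_Rmult A (S k)).
      field; split; [apply INR_fact_neq_0 | apply not_0_INR; lia]. }
    rewrite Rmult_plus_distr_l, Hf, (Rmult_plus_distr_l (INR (S (S k)))).
    apply Rplus_le_compat_r; eapply Rle_trans; [exact IH |].
    apply Rmult_le_compat_r; [apply HE0 | apply le_INR; lia]. }
pose proof (heat_pos tau x Ht) as H0.
assert (HS : forall q, Rabs (heat (S q) tau x)
  <= (Rabs x * Rabs (heat q tau x)
      + match q with O => 0 | S r => INR q * Rabs (heat r tau x) end) / (2 * tau)).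
{ intros q; simpl heat; unfold Rdiv.
  rewrite Rabs_mult, Rabs_Ropp, (Rabs_pos_eq (/ (2 * tau)))
    by (left; apply Rinv_0_lt_compat; lra).
  apply Rmult_le_compat_r; [left; apply Rinv_0_lt_compat; lra |].
  eapply Rle_trans; [apply Rabs_triang |].
  rewrite Rabs_mult; apply Rplus_le_compat_l.
  destruct q; [rewrite Rabs_R0; lra |].
  rewrite Rabs_mult, (Rabs_pos_eq (INR (S q))) by apply pos_INR; lra. }
assert (Hb : forall q, Rabs (heat q tau x) * r ^ q <= INR (fact q) * E q * heat 0 tau x /\
                       Rabs (heat (S q) tau x) * r ^ S q <= INR (fact (S q)) * E (S q) * heat 0 tau x).
{ assert (Step : forall q u v, (* u, v : bounds for orders q, q-1 *)
    0 <= u -> Rabs x * r * u + r ^ 2 * v <= 2 * tau * A * (INR (fact q) * E q * heat 0 tau x) ->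
    (Rabs x * r * u + r ^ 2 * v) / (2 * tau) <= INR (fact (S q)) * E (S q) * heat 0 tau x).
  { intros q u v Hu Huv.
    apply Rle_trans with (A * (INR (fact q) * E q * heat 0 tau x)).
    - apply Rmult_le_reg_r with (2 * tau); [lra |].
      unfold Rdiv; rewrite Rmult_assoc, Rinv_l by lra; lra.
    - replace (A * (INR (fact q) * E q * heat 0 tau x))
        with (INR (fact q) * heat 0 tau x * (A * E q)) by ring.
      rewrite fact_simpl, mult_INR.
      replace (INR (S q) * INR (fact q) * E (S q) * heat 0 tau x)
        with (INR (fact q) * heat 0 tau x * (INR (S q) * E (S q))) by ring.
      apply Rmult_le_compat_l; [| apply HAE].
      pose proof (INR_fact_lt_0 q); nra. }
  assert (EA : 2 * tau * A = Rabs x * r + r ^ 2) by (unfold A; field; lra).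
  pose proof (Rabs_pos x) as Hx.
  induction q as [|q [IH1 IH2]].
  - assert (B0 : Rabs (heat 0 tau x) * r ^ 0 <= INR (fact 0) * E 0%nat * heat 0 tau x).
    { rewrite Rabs_pos_eq by lra; unfold E; simpl; lra. }
    split; [exact B0 |].
    eapply Rle_trans; [apply Rmult_le_compat_r; [apply pow_le; lra | apply HS] |].
    eapply Rle_trans; [| apply (Step 0%nat (Rabs (heat 0 tau x)) 0); [apply Rabs_pos |]].
    + right; simpl pow; field; lra.
    + rewrite EA; simpl in B0; unfold E in *; simpl in *.
      pose proof (Rabs_pos (exp (- (x * (x * 1) / (4 * tau))) / sqrt tau)).
      assert (0 <= Rabs x * r) by nra; nra.
  - split; [exact IH2 |].
    eapply Rle_trans; [apply Rmult_le_compat_r; [apply pow_le; lra | apply HS] |].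
    eapply Rle_trans;
      [| apply (Step (S q) (Rabs (heat (S q) tau x) * r ^ S q)
                  (INR (S q) * (Rabs (heat q tau x) * r ^ q)))].
    + right; rewrite <- !tech_pow_Rmult; field; lra.
    + apply Rmult_le_pos; [apply Rabs_pos | apply pow_le; lra].
    + rewrite EA, Rmult_plus_distr_r; apply Rplus_le_compat.
      * apply Rmult_le_compat_l; [nra | exact IH2].
      * apply Rmult_le_compat_l; [nra |].
        rewrite fact_simpl, mult_INR, !Rmult_assoc.
        apply Rmult_le_compat_l; [apply pos_INR |].
        eapply Rle_trans; [exact IH1 |]; rewrite Rmult_assoc.
        apply Rmult_le_compat_l; [apply pos_INR |].
        apply Rmult_le_compat_r; [lra | apply HES]. }
eapply Rle_trans; [apply (Hb p) |].
apply Rmult_le_compat_r; [lra |]; apply Rmult_le_compat_l; [apply pos_INR |].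
apply exp_ge_taylor, HA.
Qed.

Lemma exp_le x y : x <= y -> exp x <= exp y.
Proof. intros [H | ->]; [left; apply exp_increasing, H | right; reflexivity]. Qed.

(** Cauchy's inequality with radius |x|/4 adds 5/32 x^2/tau to the exponent -1/4 x^2/tau of the
    kernel. The remaining -3/32 x^2/tau absorbs 1/sqrt tau uniformly in tau, and the radius, at
    least 1/4, gives the factor 4^p. *)
Lemma heat_away p tau x : 0 < tau -> 1 <= Rabs x ->
  Rabs (heat p tau x) <= 11 * (INR (fact p) * 4 ^ p).
Proof.
intros Ht Hx.
assert (Hr : 0 < Rabs x / 4) by lra.
pose proof (heat_cauchy p tau x _ Ht Hr) as H.
pose proof (sqrt_lt_R0 tau Ht) as Hs.
assert (E : exp ((Rabs x * (Rabs x / 4) + (Rabs x / 4) ^ 2) / (2 * tau)) * heat 0 tau x <= 11).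
{ unfold heat, Rdiv at 4; rewrite <- Rmult_assoc, <- exp_plus, <- (pow2_abs x).
  assert (Hle : (Rabs x * (Rabs x / 4) + (Rabs x / 4) ^ 2) / (2 * tau)
                + - (Rabs x ^ 2 / (4 * tau)) <= - (3 / 32 * / tau)).
  { pose proof (Rinv_0_lt_compat tau Ht) as Hi.
    replace ((Rabs x * (Rabs x / 4) + (Rabs x / 4) ^ 2) / (2 * tau)
                + - (Rabs x ^ 2 / (4 * tau))) with (- (3 / 32 * / tau) * Rabs x ^ 2)
      by (field; lra).
    assert (1 <= Rabs x ^ 2) by nra; nra. }
  apply exp_le in Hle.
  apply Rle_trans with (exp (- (3 / 32 * / tau)) * / sqrt tau).
  { apply Rmult_le_compat_r; [left; apply Rinv_0_lt_compat, Hs | exact Hle]. }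
  set (v := / sqrt tau).
  assert (Hv : 0 < v) by (apply Rinv_0_lt_compat, Hs).
  assert (Ev : / tau = v * v).
  { unfold v; rewrite <- Rinv_mult, sqrt_sqrt by lra; reflexivity. }
  rewrite Ev, exp_Ropp.
  assert (Hexp : 1 + 3 / 32 * (v * v) < exp (3 / 32 * (v * v))) by (apply exp_ineq1; nra).
  apply Rmult_le_reg_l with (exp (3 / 32 * (v * v))); [apply exp_pos |].
  rewrite <- Rmult_assoc, Rinv_r, Rmult_1_l by (pose proof (exp_pos (3 / 32 * (v * v))); lra).
  pose proof (Rle_0_sqr (v - 1)); unfold Rsqr in *; nra. }
assert (H4 : (/ 4) ^ p <= (Rabs x / 4) ^ p) by (apply pow_incr; lra).
assert (H4' : 0 < 4 ^ p) by (apply pow_lt; lra).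
pose proof (Rabs_pos (heat p tau x)); pose proof (INR_fact_lt_0 p).
assert (H5 : Rabs (heat p tau x) * (/ 4) ^ p <= INR (fact p) * 11).
{ apply Rle_trans with (Rabs (heat p tau x) * (Rabs x / 4) ^ p);
    [apply Rmult_le_compat_l; lra |].
  eapply Rle_trans; [exact H |]; rewrite Rmult_assoc; apply Rmult_le_compat_l; lra. }
rewrite pow_inv in H5.
apply Rmult_le_reg_r with (/ 4 ^ p); [apply Rinv_0_lt_compat, H4' |].
eapply Rle_trans; [exact H5 |]; right; field; lra.
Qed.

Lemma heat_small tau x : 0 < tau -> 1 <= Rabs x -> heat 0 tau x <= 4 * sqrt tau.
Proof.
intros Ht Hx; pose proof (sqrt_lt_R0 tau Ht) as Hs; unfold heat; rewrite <- (pow2_abs x).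
rewrite exp_Ropp.
assert (Hv : 0 < / (4 * tau)) by (apply Rinv_0_lt_compat; lra).
assert (H1 : / (4 * tau) <= exp (Rabs x ^ 2 / (4 * tau))).
{ apply Rle_trans with (exp (/ (4 * tau))).
  - pose proof (exp_ineq1 (/ (4 * tau)) ltac:(lra)); lra.
  - apply exp_le; assert (1 <= Rabs x ^ 2) by nra; unfold Rdiv; nra. }
apply Rinv_le_contravar in H1; [| exact Hv]; rewrite Rinv_inv in H1.
apply Rmult_le_reg_r with (sqrt tau); [exact Hs |].
unfold Rdiv; rewrite Rmult_assoc, Rinv_l, (Rmult_assoc 4), sqrt_sqrt by lra; lra.
Qed.

Lemma hfam_heat : hfam heat.
Proof.
split; [intros; apply heat_x; assumption | intros; apply heat_t; assumption |].
(* Cauchy's inequality with radius 1; the 3 is the maximum of 2|x| + 2 - x^2. *)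
intros p tau0 H0; exists (INR (fact p) * exp (3 / (4 * tau0)) * / sqrt tau0).
intros tau x Ht; assert (Htau : 0 < tau) by lra.
pose proof (heat_cauchy p tau x 1 Htau Rlt_0_1) as H; rewrite pow1, Rmult_1_r in H.
eapply Rle_trans; [exact H |].
pose proof (sqrt_lt_R0 tau0 H0) as Hs0.
assert (Hs : sqrt tau0 <= sqrt tau) by (apply sqrt_le_1; lra).
unfold heat, Rdiv at 2; rewrite !Rmult_assoc; apply Rmult_le_compat_l; [apply pos_INR |].
rewrite <- Rmult_assoc, <- exp_plus; apply Rmult_le_compat.
- left; apply exp_pos.
- left; apply Rinv_0_lt_compat; lra.
- apply exp_le.
  apply Rle_trans with (3 / (4 * tau)).
  + apply Rmult_le_reg_r with (4 * tau); [lra |].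
    replace (((Rabs x * 1 + 1 ^ 2) / (2 * tau) + - (x ^ 2 / (4 * tau))) * (4 * tau))
      with (2 * Rabs x + 2 - x ^ 2) by (field; lra).
    replace (3 / (4 * tau) * (4 * tau)) with 3 by (field; lra).
    rewrite <- (pow2_abs x); pose proof (Rle_0_sqr (Rabs x - 1)); unfold Rsqr in *; nra.
  + apply Rmult_le_compat_l; [lra | apply Rinv_le_contravar; lra].
- apply Rinv_le_contravar; lra.
Qed.

(** The kernel at time u is at most 1/sqrt u, which is bounded by 1 plus the derivative of 2 atan
    (sqrt u). The latter function takes values in [0, 4], so its contribution is at most 4 by
    [laplace_derive], and 4 + 1 = 5 independently of tau. The factor 1 + x^2 of P_l thus supplies
    the uniform bound from which [resol_bound] starts. *)
Lemma heat_avg_bounded tau x : 0 < tau -> Rabs (avg 1 heat 0 tau x) <= 5.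
Proof.
intros Ht.
set (q := fun t => 2 * atan (sqrt (tau + t))).
set (q' := fun t => / (sqrt (tau + t) * (1 + (tau + t)))).
assert (Hq : forall t, 0 <= t -> is_derive q t (q' t)).
{ intros t Ht'; unfold q, q'; pose proof (sqrt_lt_R0 (tau + t) ltac:(lra)).
  auto_derive; [lra |].
  replace (sqrt (tau + t) * (sqrt (tau + t) * 1)) with (tau + t)
    by (rewrite Rmult_1_r, sqrt_sqrt; lra).
  field; lra. }
assert (Hqb : forall t, 0 <= t -> 0 <= q t <= 4).
{ intros t Ht'; unfold q; pose proof (atan_bound (sqrt (tau + t))).
  pose proof PI_4; split; [| lra].
  pose proof (atan_increasing 0 (sqrt (tau + t)) (sqrt_lt_R0 (tau + t) ltac:(lra))) as H1.
  rewrite atan_0 in H1; lra. }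
assert (Cq' : cb q').
{ split.
  - intros t Ht'; unfold q'; pose proof (sqrt_lt_R0 (tau + t) ltac:(lra)).
    apply (ex_derive_continuous (fun t => / (sqrt (tau + t) * (1 + (tau + t))))).
    auto_derive; repeat split; nra.
  - exists (/ sqrt tau); intros t Ht'; unfold q'.
    pose proof (sqrt_lt_R0 tau Ht).
    assert (sqrt tau <= sqrt (tau + t)) by (apply sqrt_le_1; lra).
    rewrite Rabs_pos_eq by (left; apply Rinv_0_lt_compat; nra).
    apply Rinv_le_contravar; nra. }
assert (Cc : cb (fun _ => 1)).
{ split; [intros; apply continuous_const | exists 1; intros; rewrite Rabs_R1; lra]. }
assert (Hh : forall t, 0 <= t -> heat 0 (tau + 1 * t) x <= 1 * q' t + 1 * 1).
{ intros t Ht'; unfold heat, q'; rewrite !Rmult_1_l.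
  set (u := tau + t); assert (Hu : 0 < u) by (unfold u; lra).
  pose proof (sqrt_lt_R0 u Hu) as Hs.
  apply Rle_trans with (/ sqrt u).
  - unfold Rdiv; rewrite <- (Rmult_1_l (/ sqrt u)) at 2.
    apply Rmult_le_compat_r; [left; apply Rinv_0_lt_compat, Hs |].
    rewrite <- exp_0; apply exp_le.
    assert (0 <= x ^ 2 * / (4 * u)); [| unfold Rdiv; lra].
    apply Rmult_le_pos; [apply pow2_ge_0 | left; apply Rinv_0_lt_compat; lra].
  - rewrite <- (sqrt_sqrt u) at 3 by lra; set (r := sqrt u) in *.
    assert (Hr2 : 0 < 1 + r * r) by nra.
    apply Rmult_le_reg_r with (r * (1 + r * r)); [nra |].
    replace (/ r * (r * (1 + r * r))) with (1 + r * r) by (field; lra).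
    replace ((/ (r * (1 + r * r)) + 1) * (r * (1 + r * r))) with (1 + r * (1 + r * r))
      by (field; lra).
    pose proof (Rle_0_sqr (r - 1)); unfold Rsqr in *; nra. }
pose proof (laplace_mono _ _ (avg_cb 1 heat Rlt_0_1 hfam_heat 0 tau x Ht)
              (cb_lin 1 1 _ _ Cq' Cc) Hh) as H1.
rewrite laplace_lin in H1 by assumption.
assert (H2 : laplace q' = laplace q - q 0).
{ apply laplace_derive; [exact Hq | exact Cq' | exists 4].
  intros t Ht'; specialize (Hqb t Ht'); rewrite Rabs_pos_eq; lra. }
assert (Cq : cb q).
{ split; [intros t Ht'; apply (is_derive_continuous _ _ _ (Hq t Ht')) | exists 4].
  intros t Ht'; specialize (Hqb t Ht'); rewrite Rabs_pos_eq; lra. }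
assert (H3 : Rabs (laplace q) <= 4).
{ apply laplace_le; [exact Cq |]; intros t Ht'; specialize (Hqb t Ht'); rewrite Rabs_pos_eq; lra. }
assert (H4 : Rabs (laplace (fun _ => 1)) <= 1).
{ apply laplace_le; [exact Cc |]; intros; rewrite Rabs_R1; lra. }
assert (C0 : cb (fun _ => 0)).
{ split; [intros; apply continuous_const | exists 0; intros; rewrite Rabs_R0; lra]. }
assert (H5 : 0 <= laplace (fun t => heat 0 (tau + 1 * t) x)).
{ apply Rle_trans with (laplace (fun _ => 0)).
  - assert (H6 : Rabs (laplace (fun _ => 0)) <= 0)
      by (apply laplace_le; [exact C0 |]; intros; rewrite Rabs_R0; lra).
    apply Rabs_le_between in H6; lra.
  - apply laplace_mono; [exact C0 | apply avg_cb; auto using Rlt_0_1, hfam_heat |].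
    intros t Ht'; left; apply heat_pos; lra. }
unfold avg; rewrite Rabs_pos_eq by exact H5.
apply Rabs_le_between in H3; apply Rabs_le_between in H4.
specialize (Hqb 0 ltac:(lra)); lra.
Qed.

(** * Vector-valued limits and integrals *)

Lemma minus_plus_plus {G : AbelianGroup} (x y x' y' : G) :
  minus (plus x y) (plus x' y') = plus (minus x x') (minus y y').
Proof.
unfold minus; rewrite opp_plus, !plus_assoc; f_equal.
rewrite <- !plus_assoc; f_equal; apply plus_comm.
Qed.

Section NormedModule.

Context {K : AbsRing} {X : NormedModule K}.

Definition dist (x y : X) : R := norm (minus x y).

Lemma dist_refl x : dist x x = 0.
Proof. unfold dist; rewrite minus_eq_zero; apply norm_zero. Qed.

Lemma dist_sym x y : dist x y = dist y x.
Proof. unfold dist; rewrite <- norm_opp, opp_minus; reflexivity. Qed.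

Lemma dist_tri x y z : dist x z <= dist x y + dist y z.
Proof. unfold dist; rewrite (minus_trans y); apply norm_triangle. Qed.

Lemma dist_ge_0 x y : 0 <= dist x y.
Proof. apply norm_ge_0. Qed.

Lemma dist_plus x y x' y' : dist (plus x y) (plus x' y') <= dist x x' + dist y y'.
Proof.
eapply Rle_trans; [right; exact (f_equal norm (minus_plus_plus x y x' y')) |].
apply norm_triangle.
Qed.

Lemma norm_le_dist (x y : X) : norm x <= norm y + dist x y.
Proof.
assert (E : x = plus (minus x y) y).
{ unfold minus; rewrite <- plus_assoc, plus_opp_l, plus_zero_r; reflexivity. }
rewrite E at 1; eapply Rle_trans; [apply norm_triangle |]; unfold dist; lra.
Qed.

Lemma dist_eq x y : (forall eps, 0 < eps -> dist x y <= eps) -> x = y.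
Proof.
intros H; apply plus_reg_r with (opp y); rewrite plus_opp_r.
apply norm_eq_zero, Rle_antisym; [| apply norm_ge_0].
apply le_epsilon; intros eps He; rewrite Rplus_0_l; apply H, He.
Qed.

Lemma lim_dist (u : nat -> X) l : filterlim u eventually (locally l) <->
  forall eps, 0 < eps -> exists N, forall n, (N <= n)%nat -> dist (u n) l < eps.
Proof.
rewrite (filterlim_locally_ball_norm u l); split.
- intros H eps He; exact (H (mkposreal eps He)).
- intros H eps; exact (H eps (cond_pos eps)).
Qed.

Lemma cont_dist (f : R -> X) t : continuous f t <->
  forall eps, 0 < eps -> exists d, 0 < d /\
    forall x, Rabs (x - t) < d -> dist (f x) (f t) < eps.
Proof.
unfold continuous; rewrite (filterlim_locally_ball_norm f (f t)); split.
- intros H eps He; destruct (H (mkposreal eps He)) as [d Hd].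
  exists d; split; [apply cond_pos | exact Hd].
- intros H eps; destruct (H eps (cond_pos eps)) as [d [Hd Hd']].
  exists (mkposreal d Hd); exact Hd'.
Qed.

Lemma lim_sub (u : nat -> X) (s : nat -> nat) l : (forall n, (n <= s n)%nat) ->
  filterlim u eventually (locally l) ->
  filterlim (fun n => u (s n)) eventually (locally l).
Proof.
rewrite !lim_dist; intros Hs H eps He; destruct (H eps He) as [N HN].
exists N; intros n Hn; apply HN; specialize (Hs n); lia.
Qed.

Lemma lim_plus (u v : nat -> X) l m : filterlim u eventually (locally l) ->
  filterlim v eventually (locally m) ->
  filterlim (fun n => plus (u n) (v n)) eventually (locally (plus l m)).
Proof.
rewrite !lim_dist; intros Hu Hv eps He.
destruct (Hu (eps / 2)) as [N HN]; [lra |]; destruct (Hv (eps / 2)) as [N' HN']; [lra |].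
exists (N + N')%nat; intros n Hn; eapply Rle_lt_trans; [apply dist_plus |].
specialize (HN n ltac:(lia)); specialize (HN' n ltac:(lia)); lra.
Qed.

Lemma lim_dist_le (u v : nat -> X) l m e : filterlim u eventually (locally l) ->
  filterlim v eventually (locally m) -> (forall n, dist (u n) (v n) <= e) ->
  dist l m <= e.
Proof.
rewrite !lim_dist; intros Hu Hv H; apply le_epsilon; intros eps He.
destruct (Hu (eps / 2)) as [N HN]; [lra |]; destruct (Hv (eps / 2)) as [N' HN']; [lra |].
specialize (HN (N + N')%nat ltac:(lia)); specialize (HN' (N + N')%nat ltac:(lia)).
specialize (H (N + N')%nat).
pose proof (dist_tri l (u (N + N')%nat) m); pose proof (dist_tri (u (N + N')%nat) (v (N + N')%nat) m).
pose proof (dist_sym l (u (N + N')%nat)); lra.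
Qed.

End NormedModule.

Lemma cauchy_lim {K : AbsRing} {X : CompleteNormedModule K} (u : nat -> X) :
  (forall eps, 0 < eps -> exists N, forall n m, (N <= n)%nat -> (N <= m)%nat ->
     dist (u n) (u m) < eps) ->
  exists l, filterlim u eventually (locally l).
Proof.
intros H; apply (proj1 (filterlim_locally_cauchy (F := eventually) u)); intros eps.
destruct (H eps (cond_pos eps)) as [N HN]; exists (fun n => (N <= n)%nat); split.
- exists N; auto.
- intros n m Hn Hm; exact (norm_compat1 (V := X) (u n) (u m) eps (HN m n Hm Hn)).
Qed.

Lemma incr_ge (s : nat -> nat) : (forall n, (s n < s (S n))%nat) -> forall n, (n <= s n)%nat.
Proof. intros H; induction n; [lia | specialize (H n); lia]. Qed.

Lemma incr_lt (s : nat -> nat) : (forall n, (s n < s (S n))%nat) ->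
  forall n m, (n < m)%nat -> (s n < s m)%nat.
Proof. intros H n m; induction 1; [apply H | specialize (H m); lia]. Qed.

(** * Almost automorphic functions and their uniform limits *)

Lemma AA_zero (X : CompleteNormedModule C_AbsRing) : AA (fun _ : R => zero : X).
Proof.
split; [intros t; apply continuous_const |].
intros b; exists (fun n => n), (fun _ => zero); split; [intros; lia |].
intros t; split; apply filterlim_const.
Qed.

Lemma AA_plus (X : CompleteNormedModule C_AbsRing) (F G : R -> X) :
  AA F -> AA G -> AA (fun t => plus (F t) (G t)).
Proof.
intros [CF HF] [CG HG]; split.
- intros t; apply (continuous_plus F G); auto.
- intros b; destruct (HF b) as [s1 [g1 [S1 H1]]].
  destruct (HG (fun n => b (s1 n))) as [s2 [g2 [S2 H2]]].
  exists (fun n => s1 (s2 n)), (fun t => plus (g1 t) (g2 t)); split.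
  + intros n; apply incr_lt; [exact S1 | apply S2].
  + intros t; destruct (H1 t) as [A1 B1]; destruct (H2 t) as [A2 B2].
    split; apply (lim_plus (X := X)); auto.
    * apply (lim_sub (X := X) (fun n => F (t + b (s1 n))) s2); [apply incr_ge, S2 | exact A1].
    * apply (lim_sub (X := X) (fun n => g1 (t - b (s1 n))) s2); [apply incr_ge, S2 | exact B1].
Qed.

Section UniformLimit.

Variable X : CompleteNormedModule C_AbsRing.
Variables (Fk : nat -> R -> X) (F : R -> X).
Hypothesis HAA : forall k, AA (Fk k).
Hypothesis Hlim : forall eps, 0 < eps -> exists K, forall k, (K <= k)%nat ->
  forall x, dist (Fk k x) (F x) < eps.

Definition AA_along (f : R -> X) (b : nat -> R) (s : nat -> nat) : Prop :=
  (forall n, (s n < s (S n))%nat) /\ exists g : R -> X, forall t,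
    filterlim (fun n => f (t + b (s n))) eventually (locally (g t)) /\
    filterlim (fun n => g (t - b (s n))) eventually (locally (f t)).

Lemma AA_choose k b : { s | AA_along (Fk k) b s }.
Proof using HAA.
apply constructive_indefinite_description.
destruct (HAA k) as [_ H]; destruct (H b) as [s [g [Hs Hg]]].
exists s; split; [exact Hs | exists g; exact Hg].
Qed.

(** Successive extraction: the (k+1)-st index sequence is a subsequence of the k-th, chosen by
    almost automorphy of [Fk (S k)] along it. *)
Fixpoint nested (b : nat -> R) (k : nat) : nat -> nat :=
  match k with
  | O => proj1_sig (AA_choose 0 b)
  | S k' => fun n =>
      nested b k' (proj1_sig (AA_choose (S k') (fun n => b (nested b k' n))) n)
  end.

Lemma nested_incr b k n : (nested b k n < nested b k (S n))%nat.
Proof.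
revert n; induction k as [|k IH]; simpl; intros n.
- destruct (AA_choose 0 b) as [s [Hs Hs']]; apply Hs.
- destruct (AA_choose (S k) _) as [s [Hs Hs']]; simpl; apply incr_lt; auto.
Qed.

Lemma nested_sub b k m : exists r, (forall n, (n <= r n)%nat) /\
  forall n, nested b (m + k) n = nested b k (r n).
Proof.
induction m as [|m [r [Hr IH]]]; simpl.
- exists (fun n => n); split; auto.
- destruct (AA_choose (S (m + k)) _) as [s [Hs Hs']]; simpl.
  exists (fun n => r (s n)); split; [| auto].
  intros n; pose proof (incr_ge s Hs n); specialize (Hr (s n)); lia.
Qed.

Lemma nested_AA b k : AA_along (Fk k) b (nested b k).
Proof.
split; [apply nested_incr |].
destruct k as [|k]; simpl.
- destruct (AA_choose 0 b) as [s [Hs H]]; exact H.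
- destruct (AA_choose (S k) _) as [s [Hs H]]; exact H.
Qed.

(** The diagonal sequence is, from rank k on, extracted from the k-th nested one, so every [Fk k]
    has its limits [gk k] along it. Uniform closeness of [Fk k] to F makes the translates of F
    Cauchy at each point. *)
Lemma AA_uniform_limit : AA F.
Proof using HAA Hlim.
split.
- intros t; apply (cont_dist (X := X)); intros eps He.
  destruct (Hlim (eps / 3)) as [k Hk]; [lra |]; specialize (Hk k ltac:(lia)).
  destruct (proj1 (cont_dist (X := X) (Fk k) t) (proj1 (HAA k) t) (eps / 3)) as [d [Hd Hd']]; [lra |].
  exists d; split; [exact Hd |]; intros x Hx; specialize (Hd' x Hx).
  pose proof (dist_tri (F x) (Fk k x) (F t)); pose proof (dist_tri (Fk k x) (Fk k t) (F t)).
  pose proof (Hk x); pose proof (Hk t); pose proof (dist_sym (F x) (Fk k x)); lra.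
- intros b; set (s := fun n => nested b n n).
  assert (Hsub : forall k n, (k <= n)%nat -> exists m, (n <= m)%nat /\ s n = nested b k m).
  { intros k n Hkn; destruct (nested_sub b k (n - k)) as [r [Hr E]].
    exists (r n); split; [apply Hr |]; unfold s.
    replace n with (n - k + k)%nat at 1 by lia; apply E. }
  assert (Hs : forall n, (s n < s (S n))%nat).
  { intros n; destruct (Hsub n (S n) ltac:(lia)) as [m [Hm ->]].
    change (nested b n n < nested b n m)%nat; apply incr_lt; [apply nested_incr | lia]. }
  assert (Hg : exists g : nat -> R -> X, forall k t,
    filterlim (fun n => Fk k (t + b (s n))) eventually (locally (g k t)) /\
    filterlim (fun n => g k (t - b (s n))) eventually (locally (Fk k t))).
  { assert (H : forall k, { g : R -> X | forall t,
      filterlim (fun n => Fk k (t + b (s n))) eventually (locally (g t)) /\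
      filterlim (fun n => g (t - b (s n))) eventually (locally (Fk k t)) }).
    { intros k; apply constructive_indefinite_description.
      destruct (nested_AA b k) as [_ [g Hg]]; exists g; intros t.
      destruct (Hg t) as [A B]; split; apply (lim_dist (X := X)); intros eps He.
      - destruct (proj1 (lim_dist (X := X) _ _) A eps He) as [N HN]; exists (N + k)%nat; intros n Hn.
        destruct (Hsub k n ltac:(lia)) as [m [Hm ->]]; apply HN; lia.
      - destruct (proj1 (lim_dist (X := X) _ _) B eps He) as [N HN]; exists (N + k)%nat; intros n Hn.
        destruct (Hsub k n ltac:(lia)) as [m [Hm ->]]; apply HN; lia. }
    exists (fun k => proj1_sig (H k)); intros k t; exact (proj2_sig (H k) t). }
  destruct Hg as [gk Hgk].
  assert (Hg : forall t, { l : X | filterlim (fun n => F (t + b (s n))) eventually (locally l) }).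
  { intros t; apply constructive_indefinite_description, cauchy_lim; intros eps He.
    destruct (Hlim (eps / 4)) as [k Hk]; [lra |]; specialize (Hk k ltac:(lia)).
    destruct (proj1 (lim_dist (X := X) _ _) (proj1 (Hgk k t)) (eps / 4)) as [N HN]; [lra |].
    exists N; intros n m Hn Hm; specialize (HN n Hn) as Hn'; specialize (HN m Hm) as Hm'.
    set (x := t + b (s n)) in *; set (y := t + b (s m)) in *.
    pose proof (Hk x); pose proof (Hk y).
    pose proof (dist_tri (F x) (Fk k x) (F y)); pose proof (dist_tri (Fk k x) (gk k t) (F y)).
    pose proof (dist_tri (gk k t) (Fk k y) (F y)).
    pose proof (dist_sym (F x) (Fk k x)); pose proof (dist_sym (gk k t) (Fk k y)); lra. }
  exists s, (fun t => proj1_sig (Hg t)); split; [exact Hs |]; intros t; split.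
  + exact (proj2_sig (Hg t)).
  + apply (lim_dist (X := X)); intros eps He.
    destruct (Hlim (eps / 4)) as [k Hk]; [lra |]; specialize (Hk k ltac:(lia)).
    destruct (proj1 (lim_dist (X := X) _ _) (proj2 (Hgk k t)) (eps / 4)) as [N HN]; [lra |].
    exists N; intros n Hn; specialize (HN n Hn).
    (* The point t - b (s n) moves with n, so pointwise convergence of the limit functions would not
       do; their distance to the limit of F inherits the uniform bound. *)
    assert (Hd : dist (gk k (t - b (s n))) (proj1_sig (Hg (t - b (s n)))) <= eps / 4).
    { eapply (lim_dist_le (X := X));
        [exact (proj1 (Hgk k (t - b (s n)))) | exact (proj2_sig (Hg (t - b (s n)))) |].
      intros m; left; apply Hk. }
    set (G := proj1_sig (Hg (t - b (s n)))) in *.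
    pose proof (Hk t); pose proof (dist_tri G (gk k (t - b (s n))) (F t)).
    pose proof (dist_tri (gk k (t - b (s n))) (Fk k t) (F t)).
    pose proof (dist_sym G (gk k (t - b (s n)))); lra.
Qed.

End UniformLimit.

(** * Riemann sums and integrals of vector-valued functions *)

Section VectorIntegral.

Context {V : CompleteNormedModule R_AbsRing}.

(** Left Riemann sums with n steps of length d. A linear T passes through these finite sums, and the
    integral is reached by [riemann_err]. *)
Fixpoint riemann (f : R -> V) (a d : R) (n : nat) : V :=
  match n with
  | O => zero
  | S n => plus (riemann f a d n) (scal d (f (a + INR n * d)))
  end.

Lemma riemann_err (f : R -> V) a d B n : 0 < d -> 0 <= B ->
  (forall x, continuous f x) ->
  (forall x y, a <= x <= a + INR n * d -> a <= y <= a + INR n * d ->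
     dist (f x) (f y) <= B * Rabs (x - y)) ->
  dist (RInt f a (a + INR n * d)) (riemann f a d n) <= INR n * d * (B * d).
Proof.
intros Hd HB Cf HL.
assert (E : forall a b, ex_RInt f a b) by (intros; apply ex_RInt_continuous; auto).
assert (H : forall m, (m <= n)%nat ->
  dist (RInt f a (a + INR m * d)) (riemann f a d m) <= INR m * d * (B * d)).
{ induction m as [|m IH]; intros Hm.
  - simpl; rewrite Rmult_0_l, Rplus_0_r, RInt_point, dist_refl; lra.
  - specialize (IH ltac:(lia)); simpl riemann.
    set (c := a + INR m * d) in *.
    replace (a + INR (S m) * d) with (c + d) by (unfold c; rewrite S_INR; ring).
    rewrite <- (RInt_Chasles f a c (c + d)) by apply E.
    eapply Rle_trans; [apply (dist_plus (X := V)) |].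
    assert (Hc : dist (RInt f c (c + d)) (scal d (f c)) <= d * (B * d)).
    { assert (I : is_RInt (fun x => minus (f x) (f c)) c (c + d)
                    (minus (RInt f c (c + d)) (scal (c + d - c) (f c)))).
      { apply (is_RInt_minus f (fun _ => f c)); [apply (RInt_correct (V := V)), E | apply (is_RInt_const (V := V))]. }
      replace (c + d - c) with d in I by ring.
      replace d with (c + d - c) at 3 by ring.
      refine (norm_RInt_le_const _ c (c + d) _ (B * d) ltac:(lra) _ I).
      intros x Hx.
      assert (Hmn : INR (S m) <= INR n) by (apply le_INR; exact Hm).
      rewrite S_INR in Hmn; pose proof (pos_INR m).
      eapply Rle_trans; [apply HL; unfold c in *; nra |].
      apply Rmult_le_compat_l; [exact HB |]; rewrite Rabs_pos_eq; lra. }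
    rewrite S_INR; lra. }
apply H; lia.
Qed.

Lemma is_RInt_zero_fun (f : R -> V) a b :
  (forall x, Rmin a b < x < Rmax a b -> f x = zero) -> is_RInt f a b zero.
Proof.
intros H; apply is_RInt_ext with (fun _ => zero).
- intros x Hx; symmetry; auto.
- exact (eq_rect _ (fun z => is_RInt (fun _ => zero) a b z)
      (is_RInt_const (V := V) a b zero) _ (scal_zero_r (b - a))).
Qed.

Lemma is_RInt_gen_compact (f : R -> V) L : 0 < L -> (forall x, continuous f x) ->
  (forall x, L < Rabs x -> f x = zero) ->
  is_RInt_gen f (Rbar_locally m_infty) (Rbar_locally p_infty) (RInt f (- L) L).
Proof.
intros HL Cf Hz.
intros P HP; unfold filtermapi.
apply (Filter_prod _ _ _ (fun a => a < - L) (fun b => L < b)).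
- exists (- L); auto.
- exists L; auto.
- intros a b Ha Hb; exists (RInt f (- L) L); split; [| apply locally_singleton, HP].
  simpl.
  replace (RInt f (- L) L) with (plus (plus zero (RInt f (- L) L)) zero)
    by (rewrite plus_zero_r, plus_zero_l; reflexivity).
  apply (is_RInt_Chasles (V := V)) with L; [apply (is_RInt_Chasles (V := V)) with (- L) |].
  + apply is_RInt_zero_fun; intros x; rewrite Rmin_left, Rmax_right by lra; intros Hx.
    apply Hz; rewrite Rabs_left1; lra.
  + apply (RInt_correct (V := V)), ex_RInt_continuous; auto.
  + apply is_RInt_zero_fun; intros x; rewrite Rmin_left, Rmax_right by lra; intros Hx.
    apply Hz; rewrite Rabs_pos_eq; lra.
Qed.

Lemma integral_compact (f : R -> V) L : 0 < L -> (forall x, continuous f x) ->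
  (forall x, L < Rabs x -> f x = zero) -> integral f = RInt f (- L) L.
Proof. intros; apply is_RInt_gen_unique, is_RInt_gen_compact; assumption. Qed.

End VectorIntegral.

Lemma RInt_zeroR (f : R -> R) u v : u <= v -> (forall x, u < x < v -> f x = 0) -> RInt f u v = 0.
Proof.
intros Huv Hz; apply is_RInt_unique, (is_RInt_zero_fun (V := R_CompleteNormedModule)).
rewrite Rmin_left, Rmax_right by exact Huv; exact Hz.
Qed.

Lemma integral_C_compact (f g : R -> R) L : 0 < L ->
  (forall x, continuous f x) -> (forall x, continuous g x) ->
  (forall x, L < Rabs x -> f x = 0 /\ g x = 0) ->
  integral (V := C_R_CompleteNormedModule) (fun t => (f t, g t))
  = (RInt f (- L) L, RInt g (- L) L).
Proof.
intros HL Cf Cg Hz.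
assert (Hc : forall x, continuous (fun t => (f t, g t) : C_R_CompleteNormedModule) x).
{ intros x P [e He].
  destruct (Cf x (ball (f x) e) (locally_ball _ _)) as [d Hd].
  destruct (Cg x (ball (g x) e) (locally_ball _ _)) as [d' Hd'].
  assert (Hm : 0 < Rmin d d') by (apply Rmin_glb_lt; apply cond_pos).
  exists (mkposreal _ Hm); intros y Hy; apply He; split.
  - apply Hd; eapply Rlt_le_trans; [exact Hy | apply Rmin_l].
  - apply Hd'; eapply Rlt_le_trans; [exact Hy | apply Rmin_r]. }
etransitivity; [apply (integral_compact (V := C_R_CompleteNormedModule) _ L HL Hc) |].
- intros x Hx; destruct (Hz x Hx) as [-> ->]; reflexivity.
- apply (is_RInt_unique (V := C_R_CompleteNormedModule)).
  apply (is_RInt_fct_extend_pair (U := R_NormedModule) (V := R_NormedModule)).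
  + apply (@RInt_correct R_CompleteNormedModule), ex_RInt_cont; exact Cf.
  + apply (@RInt_correct R_CompleteNormedModule), ex_RInt_cont; exact Cg.
Qed.

(** * Finite products of resolvents *)

(* Coefficients of the polynomial with factors [1 + e_k X^2], k < n. *)
Fixpoint coef (e : nat -> R) (n q : nat) : R :=
  match n with
  | O => match q with O => 1 | _ => 0 end
  | S n => coef e n q + e n * match q with S (S r) => coef e n r | _ => 0 end
  end.

(* The same polynomial evaluated at the shift operator of sequences. *)
Fixpoint opw (e : nat -> R) (n : nat) (w : nat -> R) (p : nat) : R :=
  match n with
  | O => w p
  | S n => opw e n (fun p => w p + e n * w (S (S p))) p
  end.

Lemma opw_ext e n w w' p : (forall p, w p = w' p) -> opw e n w p = opw e n w' p.
Proof.
revert w w'; induction n as [|n IH]; simpl; intros w w' H; [apply H |].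
apply IH; intros q; rewrite !H; reflexivity.
Qed.

Lemma opw_lin e n c d w w' p :
  opw e n (fun p => c * w p + d * w' p) p = c * opw e n w p + d * opw e n w' p.
Proof.
revert w w'; induction n as [|n IH]; simpl; intros w w'; [reflexivity |].
rewrite <- IH; apply opw_ext; intros q; ring.
Qed.

Lemma opw_shift e n w k p : opw e n (fun p => w (p + k)%nat) p = opw e n w (p + k)%nat.
Proof.
revert w; induction n as [|n IH]; simpl; intros w; [reflexivity |].
rewrite <- (IH (fun p => w p + e n * w (S (S p)))); reflexivity.
Qed.

(** [opw] applies the factor of highest index first. By linearity and commutation with shifts it may
    also be applied last. *)
Lemma opw_S e n w p : opw e (S n) w p = opw e n w p + e n * opw e n w (S (S p)).
Proof.
simpl; replace (S (S p)) with (p + 2)%nat by lia; rewrite <- opw_shift.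
rewrite <- (Rmult_1_l (opw e n w p)), <- opw_lin.
apply opw_ext; intros q; replace (q + 2)%nat with (S (S q)) by lia; ring.
Qed.

Lemma is_series_head (a : nat -> R) : (forall k, a (S k) = 0) -> is_series a (a 0%nat).
Proof.
intros H; apply is_series_decr_1, is_series_ext with (fun _ => 0); [intros; symmetry; apply H |].
unfold plus, opp; simpl; rewrite Rplus_opp_r.
apply is_series_Reals; intros eps He; exists 0%nat; intros n _.
rewrite sum_eq_R0 by auto; unfold Rdist; rewrite Rminus_diag, Rabs_R0; exact He.
Qed.

(** A finite product is written as a full series so that it can be compared, term by term, with an
    operator of infinite order. *)
Lemma is_series_coef e n w p : is_series (fun q => coef e n q * w (q + p)%nat) (opw e n w p).
Proof.
revert w p; induction n as [|n IH]; intros w p.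
- simpl opw; replace (w p) with (coef e 0 0 * w (0 + p)%nat) by (simpl; ring).
  apply (is_series_head (fun q => coef e 0 q * w (q + p)%nat)); intros; simpl; ring.
- rewrite opw_S.
  apply is_series_ext with (fun q => coef e n q * w (q + p)%nat
    + e n * match q with S (S r) => coef e n r * w (r + S (S p))%nat | _ => 0 end).
  { intros q; change (@eq R (coef e n q * w (q + p)%nat
      + e n * match q with S (S r) => coef e n r * w (r + S (S p))%nat | _ => 0 end)
      (coef e (S n) q * w (q + p)%nat)).
    destruct q as [|[|q]]; cbn [coef]; [ring | ring |].
    replace (q + S (S p))%nat with (S (S q) + p)%nat by lia; ring. }
  apply (is_series_plus (fun q => coef e n q * w (q + p)%nat)); [apply IH |].
  apply (is_series_scal (K := R_AbsRing) (V := R_NormedModule) (e n)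
    (fun q => match q with S (S r) => coef e n r * w (r + S (S p))%nat | _ => 0 end)
    (opw e n w (S (S p)))).
  apply is_series_decr_1, is_series_decr_1; unfold plus, opp; simpl.
  rewrite Ropp_0, !Rplus_0_r; apply (IH w (S (S p))).
Qed.

Lemma coef_odd e n : forall k, coef e n (S (2 * k)) = 0.
Proof.
induction n as [|n IH]; intros k; [reflexivity |].
cbn [coef]; rewrite IH; destruct k as [|k]; [simpl; ring |].
replace (2 * S k)%nat with (S (S (2 * k))) by lia; rewrite IH; ring.
Qed.

Lemma coef_opp_even e n k : coef (fun j => - e j) n (2 * k) = (-1) ^ k * coef e n (2 * k).
Proof.
revert k; induction n as [|n IH]; intros k; [destruct k; simpl; ring |].
destruct k as [|k]; [cbn [coef]; specialize (IH 0%nat); simpl in *; lra |].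
pose proof (IH (S k)) as H1; specialize (IH k).
replace (2 * S k)%nat with (S (S (2 * k))) in * by lia.
cbn [coef]; rewrite H1, IH; simpl; ring.
Qed.

Lemma coef_abs_opp e n q : (forall k, 0 <= e k) ->
  Rabs (coef (fun j => - e j) n q) <= coef e n q.
Proof.
intros He; revert q; induction n as [|n IH]; intros q; cbn [coef].
- destruct q; [rewrite Rabs_R1; lra | rewrite Rabs_R0; lra].
- eapply Rle_trans; [apply Rabs_triang |]; apply Rplus_le_compat; [apply IH |].
  rewrite Rabs_mult, Rabs_Ropp, (Rabs_pos_eq (e n)) by apply He.
  apply Rmult_le_compat_l; [apply He |].
  destruct q as [|[|q]]; [rewrite Rabs_R0; lra | rewrite Rabs_R0; lra | apply IH].
Qed.

Fixpoint prd (e : nat -> R) (n : nat) (y : R) : R :=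
  match n with O => 1 | S n => prd e n y * (1 + e n * y) end.

Lemma opw_pow e n x p : opw e n (fun q => x ^ q) p = x ^ p * prd e n (x ^ 2).
Proof.
revert p; induction n as [|n IH]; intros p; [simpl; ring |].
rewrite opw_S, !IH; simpl; ring.
Qed.

Section Positive.

Variable e : nat -> R.
Hypothesis e_pos : forall k, 0 <= e k.

Lemma coef_pos n q : 0 <= coef e n q.
Proof using e_pos.
revert q; induction n as [|n IH]; intros q; cbn [coef]; [destruct q; lra |].
specialize (e_pos n); destruct q as [|[|q]].
- specialize (IH 0%nat); lra.
- specialize (IH 1%nat); lra.
- pose proof (IH q); specialize (IH (S (S q))); nra.
Qed.

Lemma coef_incr n q : coef e n q <= coef e (S n) q.
Proof using e_pos.
cbn [coef]; pose proof (e_pos n); destruct q as [|[|q]]; [lra | lra |].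
pose proof (coef_pos n q); nra.
Qed.

Lemma prd_ge_1 n y : 0 <= y -> 1 <= prd e n y.
Proof using e_pos.
intros Hy; induction n as [|n IH]; simpl; [lra |].
pose proof (e_pos n); assert (0 <= e n * y) by nra; nra.
Qed.

(** Cauchy's inequality without complex analysis: all coefficients being nonnegative, one term is at
    most the value of the polynomial at r. *)
Lemma coef_cauchy n q r : 0 <= r -> coef e n q * r ^ q <= prd e n (r ^ 2).
Proof using e_pos.
intros Hr; revert q; induction n as [|n IH]; intros q.
- cbn [coef prd]; destruct q; [simpl; lra | rewrite Rmult_0_l; lra].
- cbn [coef prd]; pose proof (e_pos n); pose proof (prd_ge_1 n (r ^ 2) ltac:(nra)).
  assert (0 <= e n * r ^ 2) by nra.
  rewrite Rmult_plus_distr_r, Rmult_plus_distr_l, Rmult_1_r.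
  apply Rplus_le_compat; [apply IH |].
  destruct q as [|[|q]]; [nra | nra |].
  specialize (IH q); rewrite <- !tech_pow_Rmult.
  replace (e n * coef e n q * (r * (r * r ^ q))) with (coef e n q * r ^ q * (e n * r ^ 2)) by ring.
  apply Rmult_le_compat_r; assumption.
Qed.

End Positive.

Lemma RInt_by_parts (f f' g g' : R -> R) a b : a <= b ->
  (forall x, is_derive f x (f' x)) -> (forall x, is_derive g x (g' x)) ->
  (forall x, continuous f' x) -> (forall x, continuous g' x) ->
  g a = 0 -> g b = 0 ->
  RInt (fun x => f' x * g x) a b = - RInt (fun x => f x * g' x) a b.
Proof.
intros Hab Df Dg Cf' Cg' Ha Hb.
assert (Cf : forall x, continuous f x) by (intros x; exact (is_derive_continuous _ _ _ (Df x))).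
assert (Cg : forall x, continuous g x) by (intros x; exact (is_derive_continuous _ _ _ (Dg x))).
assert (E : is_RInt (fun x => 1 * (f' x * g x) + 1 * (f x * g' x)) a b
              (minus (f b * g b) (f a * g a))).
{ apply (is_RInt_derive (fun x => f x * g x)).
  - intros x _; eapply is_derive_eq.
    + apply (is_derive_mult f g); [apply Df | apply Dg | intros; apply Rmult_comm].
    + unfold plus, mult; simpl; ring.
  - intros x _.
    apply (continuous_plus (fun x => 1 * (f' x * g x)) (fun x => 1 * (f x * g' x))).
    + apply (continuous_scal_r 1 (fun x => f' x * g x)), cont_mult; auto.
    + apply (continuous_scal_r 1 (fun x => f x * g' x)), cont_mult; auto. }
apply (is_RInt_unique (V := R_CompleteNormedModule)) in E.
destruct (RInt_linR (fun x => f' x * g x) (fun x => f x * g' x) 1 1 a b) as [_ E2];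
  try (apply ex_RInt_cont; intros; apply cont_mult; auto).
assert (E3 := eq_trans (eq_sym E2) E).
unfold minus, plus, opp in E3; simpl in E3; rewrite Ha, Hb in E3; lra.
Qed.

Lemma RInt_by_parts2 (f g : nat -> R -> R) p q a b : a <= b -> jet f -> jet g ->
  (forall k, g k a = 0) -> (forall k, g k b = 0) ->
  RInt (fun x => f (S (S p)) x * g q x) a b = RInt (fun x => f p x * g (S (S q)) x) a b.
Proof.
intros Hab Jf Jg Ha Hb.
rewrite (RInt_by_parts (f (S p)) (f (S (S p))) (g q) (g (S q))); auto using jet_cont.
rewrite (RInt_by_parts (f p) (f (S p)) (g (S q)) (g (S (S q)))); auto using jet_cont.
exact (Ropp_involutive _).
Qed.

Lemma jet_opw e n f : jet f -> jet (fun p x => opw e n (fun q => f q x) p).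
Proof.
revert f; induction n as [|n IH]; intros f Jf; [exact Jf |].
apply (IH (fun p x => f p x + e n * f (S (S p)) x)); intros p x.
apply (is_derive_plus (f p) (fun x => e n * f (S (S p)) x)); [apply Jf |].
apply is_derive_scal, Jf.
Qed.

(** Only even derivatives occur, so the operator is its own transpose; the boundary terms vanish
    with g and its derivatives. *)
Lemma RInt_opw e n f g a b : a <= b -> jet f -> jet g ->
  (forall k, g k a = 0) -> (forall k, g k b = 0) ->
  RInt (fun x => opw e n (fun p => f p x) 0 * g 0%nat x) a b
  = RInt (fun x => f 0%nat x * opw e n (fun p => g p x) 0) a b.
Proof.
intros Hab; revert f g; induction n as [|n IH]; intros f g Jf Jg Ha Hb; [reflexivity |].
assert (J2 : forall h, jet h -> jet (fun p x => h p x + e n * h (S (S p)) x)).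
{ intros h Jh p x; apply (is_derive_plus (h p) (fun x => e n * h (S (S p)) x)); [apply Jh |].
  apply is_derive_scal, Jh. }
cbn [opw].
rewrite (IH (fun p x => f p x + e n * f (S (S p)) x) g) by auto.
pose proof (jet_opw e n g Jg) as Jo.
set (o := fun p x => opw e n (fun q => g q x) p) in *.
assert (Hz : forall y, (forall k, g k y = 0) -> forall k, o k y = 0).
{ intros y Hy k; unfold o; rewrite (opw_ext e n _ (fun p => 0 * g p y + 0 * g p y)).
  - rewrite opw_lin; ring.
  - intros p; rewrite Hy; ring. }
assert (Eo : forall x, opw e n (fun p => g p x + e n * g (S (S p)) x) 0 = o 0%nat x + e n * o 2%nat x).
{ intros x; unfold o; rewrite <- (opw_S e n (fun q => g q x) 0); reflexivity. }
rewrite (RInt_extR (fun x => f 0%nat x * opw e n (fun p => g p x + e n * g (S (S p)) x) 0)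
           (fun x => 1 * (f 0%nat x * o 0%nat x) + e n * (f 0%nat x * o 2%nat x)))
  by (intros; rewrite Eo; ring).
rewrite (RInt_extR (fun x => (f 0%nat x + e n * f 2%nat x) * opw e n (fun p => g p x) 0)
           (fun x => 1 * (f 0%nat x * o 0%nat x) + e n * (f 2%nat x * o 0%nat x)))
  by (intros; unfold o; ring).
assert (Ex : forall i j, ex_RInt (fun x => f i x * o j x) a b)
  by (intros; apply ex_RInt_cont; intros; apply cont_mult; apply jet_cont; auto).
rewrite (proj2 (RInt_linR _ _ 1 (e n) a b (Ex 0%nat 0%nat) (Ex 2%nat 0%nat))).
rewrite (proj2 (RInt_linR _ _ 1 (e n) a b (Ex 0%nat 0%nat) (Ex 0%nat 2%nat))).
rewrite (RInt_by_parts2 f o 0 0 a b) by auto; reflexivity.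
Qed.

(** * The fundamental solution *)

Section Fundamental.

Variable a : nat -> R.
Hypothesis a_pos : forall n, 0 < a n.
Hypothesis a_0 : a 0%nat = 1.
Let e (n : nat) : R := / a n ^ 2.
Hypothesis e_sum : ex_series e.

(** The product of the first n resolvents applied to the heat kernel at a positive time tau, which
    keeps every stage smooth. *)
Fixpoint resol (n : nat) : nat -> R -> R -> R :=
  match n with O => heat | S n => avg (/ a n ^ 2) (resol n) end.

Lemma e_gt_0 n : 0 < e n.
Proof using a_pos. apply Rinv_0_lt_compat, pow_lt, a_pos. Qed.

Lemma hfam_resol n : hfam (resol n).
Proof using a_pos.
induction n as [|n IH]; simpl; [apply hfam_heat |].
apply (hfam_avg (/ a n ^ 2)); [apply e_gt_0 | exact IH].
Qed.

Lemma resol_S n p tau x : 0 < tau ->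
  resol (S n) p tau x - e n * resol (S n) (S (S p)) tau x = resol n p tau x.
Proof using a_pos.
intros Ht; apply (avg_resolvent (e n)); [apply e_gt_0 | apply hfam_resol | exact Ht].
Qed.

(** Each factor 1 - e_k d^2/dx^2 cancels one resolvent, by [resol_S]. *)
Lemma opw_resol n tau x p : 0 < tau ->
  opw (fun k => - e k) n (fun p => resol n p tau x) p = heat p tau x.
Proof using a_pos.
intros Ht; revert p; induction n as [|n IH]; intros p; [reflexivity |].
cbn [opw]; rewrite <- IH; apply opw_ext; intros q.
rewrite <- (resol_S n q tau x Ht); ring.
Qed.

(** The product a_1 ... a_p. For the zeros of P_l it equals l^p M_p, by [bd_zeros], which is how the
    weight sequence enters the estimates. *)
Fixpoint bd (p : nat) : R := match p with O => 1 | S p => a (S p) * bd p end.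

Lemma bd_pos p : 0 < bd p.
Proof using a_pos. induction p; simpl; [lra | apply Rmult_lt_0_compat; auto]. Qed.

(** A new resolvent does not increase the bounds already known, being an average over later times,
    and by [resolvent_gain] it allows one more derivative at the cost of the factor a_{n+1}. The
    bounds W and W', which depend on tau, only exclude exponential growth; the result is uniform in
    tau. *)
Lemma resol_bound n p tau x : 0 < tau -> (p <= n)%nat ->
  Rabs (resol (S n) p tau x) <= 5 * bd p.
Proof using a_pos a_0.
revert p tau x; induction n as [|n IH]; intros p tau x Ht Hp.
- replace p with 0%nat by lia; replace (5 * bd 0) with 5 by (cbn [bd]; ring).
  change (Rabs (avg (/ a 0%nat ^ 2) heat 0 tau x) <= 5).
  replace (/ a 0%nat ^ 2) with 1 by (rewrite a_0; field).
  apply heat_avg_bounded, Ht.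
- destruct (Nat.eq_dec p (S n)) as [-> | Hne].
  + cbn [bd].
    replace (5 * (a (S n) * bd n)) with (a (S n) * (5 * bd n)) by ring.
    pose proof (hfam_resol (S (S n))) as Hs.
    destruct (hf_b _ Hs n tau Ht) as [W HW]; destruct (hf_b _ Hs (S n) tau Ht) as [W' HW'].
    apply (resolvent_gain (resol (S (S n)) n tau) (resol (S (S n)) (S n) tau)
             (resol (S (S n)) (S (S n)) tau) (a (S n)) (5 * bd n) (Rmax W W')).
    * apply a_pos.
    * intros y; apply (hf_x _ Hs), Ht.
    * intros y; apply (hf_x _ Hs), Ht.
    * intros y; eapply Rle_trans; [apply HW; lra | apply Rmax_l].
    * intros y; eapply Rle_trans; [apply HW'; lra | apply Rmax_r].
    * intros y; change (/ a (S n) ^ 2) with (e (S n)); rewrite (resol_S (S n) n tau y Ht); apply IH; [exact Ht | lia].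
  + apply (avg_le (e (S n)) (resol (S n))); [apply e_gt_0 | apply hfam_resol | exact Ht |].
    intros tau' Ht'; apply IH; [lra | lia].
Qed.

Lemma resol_away n p tau x : 0 < tau -> 1 <= Rabs x ->
  Rabs (resol n p tau x) <= 11 * (INR (fact p) * 4 ^ p).
Proof using a_pos.
intros Ht Hx; revert tau Ht; induction n as [|n IH]; intros tau Ht.
- apply heat_away; assumption.
- apply (avg_le (e n) (resol n)); [apply e_gt_0 | apply hfam_resol | exact Ht |].
  intros tau' Ht'; apply IH; lra.
Qed.

(** Equal to 4^(-n), written as a square so that its square root is visibly (1/2)^n. *)
Definition time (n : nat) : R := ((/ 2) ^ n) ^ 2.

Lemma time_pos n : 0 < time n.
Proof. apply pow_lt, pow_lt; lra. Qed.

Lemma time_S n : time (S n) = time n / 4.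
Proof. unfold time; simpl; field; apply pow_nonzero; lra. Qed.

Lemma time_sum : ex_series time.
Proof.
apply ex_series_ext with (fun n => (/ 4) ^ n).
- intros n; induction n as [|n IH]; [unfold time; simpl; ring |].
  rewrite time_S, <- IH; simpl; field.
- apply ex_series_geom; rewrite Rabs_pos_eq; lra.
Qed.

Definition approx (n p : nat) (x : R) : R := resol (S n) p (time n) x.

Lemma jet_approx n : jet (approx n).
Proof using a_pos. intros p x; apply (hf_x _ (hfam_resol (S n))), time_pos. Qed.

(** Two changes, each governed by the derivative of order p + 2: the additional resolvent, through
    its equation, contributes [e (S n)], and the shorter time, through the heat equation,
    contributes at most [time n]. Hence the condition p + 2 <= n of [resol_bound]. *)
Lemma approx_step n p x : (S (S p) <= n)%nat ->
  Rabs (approx (S n) p x - approx n p x) <= 5 * bd (S (S p)) * (e (S n) + time n).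
Proof using a_pos a_0.
intros Hp; unfold approx.
pose proof (time_pos n) as Ht; pose proof (time_pos (S n)) as Ht'; pose proof (time_S n) as Et.
replace (resol (S (S n)) p (time (S n)) x - resol (S n) p (time n) x)
  with ((resol (S (S n)) p (time (S n)) x - resol (S n) p (time (S n)) x)
        + (resol (S n) p (time (S n)) x - resol (S n) p (time n) x)) by ring.
eapply Rle_trans; [apply Rabs_triang |].
rewrite Rmult_plus_distr_l; apply Rplus_le_compat.
- rewrite <- (resol_S (S n) p (time (S n)) x Ht').
  match goal with |- Rabs ?A <= _ =>
    replace A with (e (S n) * resol (S (S n)) (S (S p)) (time (S n)) x) by ring end.
  rewrite Rabs_mult, Rabs_pos_eq, Rmult_comm by (left; apply e_gt_0).
  apply Rmult_le_compat_r; [left; apply e_gt_0 |].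
  apply resol_bound; [exact Ht' | lia].
- eapply Rle_trans.
  + apply (mvt_le (fun u => resol (S n) p u x) (fun u => resol (S n) (S (S p)) u x)
             (time n) (time (S n)) (5 * bd (S (S p)))).
    * intros z Hz; apply (hf_t _ (hfam_resol (S n))).
      revert Hz; unfold Rabs; repeat destruct Rcase_abs; lra.
    * intros z Hz; apply resol_bound; [| lia].
      revert Hz; unfold Rabs; repeat destruct Rcase_abs; lra.
  + apply Rmult_le_compat_l; [pose proof (bd_pos (S (S p))); lra |].
    unfold Rabs; destruct Rcase_abs; lra.
Qed.

Lemma fundamental_limit : exists G : nat -> R -> R,
  (forall p, ucv (fun n => approx n p) (G p)) /\ jet G /\
  (forall p x, Rabs (G p x) <= 5 * bd p) /\
  (forall p x, 1 <= Rabs x -> Rabs (G p x) <= 11 * (INR (fact p) * 4 ^ p)).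
Proof using a_pos a_0 e_sum.
assert (H : forall p, { g : R -> R | ucv (fun n => approx n p) g }).
{ intros p; apply constructive_indefinite_description.
  apply (ucv_of_summable _ (fun n => 5 * bd (S (S p)) * (e (S n) + time n)) (S (S p))).
  - apply (ex_series_scal_l (5 * bd (S (S p))) (fun n => e (S n) + time n)).
    apply (ex_series_plus (fun n => e (S n)) time); [| apply time_sum].
    exact (proj1 (ex_series_incr_1 e) e_sum).
  - intros n x Hn; apply approx_step, Hn. }
exists (fun p => proj1_sig (H p)).
assert (Hc : forall p, ucv (fun n => approx n p) (proj1_sig (H p)))
  by (intros p; exact (proj2_sig (H p))).
split; [exact Hc |]; split; [| split].
- apply (jet_ucv approx); [apply jet_approx | exact Hc |].
  intros p; exists (5 * bd p), p; intros n Hn x; exact (resol_bound n p (time n) x (time_pos n) Hn).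
- intros p x; apply (is_lim_seq_le_loc (fun n => Rabs (approx n p x)) (fun _ => 5 * bd p)
    (Rabs (proj1_sig (H p) x)) (5 * bd p)).
  + exists p; intros n Hn; exact (resol_bound n p (time n) x (time_pos n) Hn).
  + apply (is_lim_seq_abs _ (proj1_sig (H p) x)), (ucv_lim (fun n => approx n p)), Hc.
  + apply is_lim_seq_const.
- intros p x Hx; apply (ucv_le (fun n => approx n p) (proj1_sig (H p)) x _ (Hc p)).
  intros n; exact (resol_away (S n) p (time n) x (time_pos n) Hx).
Qed.

End Fundamental.

(** * The heat kernel as an approximate identity *)

Definition gauss (y : R) : R := exp (- (y ^ 2 / 4)).

Lemma gauss_cont y : continuous gauss y.
Proof.
apply (ex_derive_continuous gauss); unfold gauss; auto_derive; exact I.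
Qed.

Lemma gauss_pos y : 0 < gauss y.
Proof. apply exp_pos. Qed.

(** The integrals over [-r, r] increase with r and are dominated by that of 1/(1 + (y/2)^2), a
    difference of arctangents. The constant c is their limit. *)
Lemma gauss_mass : exists c, 0 < c /\ forall eps, 0 < eps -> exists N, forall r, N <= r ->
  Rabs (RInt gauss (- r) r - c) < eps.
Proof.
set (E := fun r => RInt gauss (- r) r).
assert (Hx : forall u v, ex_RInt gauss u v) by (intros; apply ex_RInt_cont, gauss_cont).
assert (Hpos : forall u v, u <= v -> 0 <= RInt gauss u v).
{ intros u v Huv; apply RInt_ge_0; auto; intros; left; apply gauss_pos. }
assert (Hmono : forall r s, 0 <= r -> r <= s -> E r <= E s).
{ intros r s Hr Hs; unfold E.
  rewrite <- (RInt_ChaslesR gauss (- s) (- r) s), <- (RInt_ChaslesR gauss (- r) r s) by auto.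
  pose proof (Hpos (- s) (- r)); pose proof (Hpos r s); lra. }
assert (Hbd : forall r, 0 <= r -> E r <= 8).
{ intros r Hr.
  assert (I : is_RInt (fun y => / (1 + (y / 2) ^ 2)) (- r) r
                (minus (2 * atan (r / 2)) (2 * atan (- r / 2)))).
  { apply (is_RInt_derive (fun y => 2 * atan (y / 2))).
    - intros y _; auto_derive; [exact I |]; unfold Rsqr; field; nra.
    - intros y _; apply (ex_derive_continuous (fun y => / (1 + (y / 2) ^ 2))).
      auto_derive; nra. }
  apply Rle_trans with (minus (2 * atan (r / 2)) (2 * atan (- r / 2))).
  - apply (is_RInt_le gauss (fun y => / (1 + (y / 2) ^ 2)) (- r) r); [lra | | exact I |].
    + apply (@RInt_correct R_CompleteNormedModule); auto.
    + intros y _; unfold gauss; rewrite exp_Ropp; apply Rinv_le_contravar; [nra |].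
      replace ((y / 2) ^ 2) with (y ^ 2 / 4) by field; apply exp_ineq1_le.
  - unfold minus, plus, opp; simpl.
    pose proof (atan_bound (r / 2)); pose proof (atan_bound (- r / 2)); pose proof PI_4; lra. }
destruct (ex_finite_lim_seq_incr (fun n => E (INR n)) 8) as [c Hc].
- intros n; apply Hmono; [apply pos_INR | apply le_INR; lia].
- intros n; apply Hbd, pos_INR.
- assert (Hle : forall n, E (INR n) <= c).
  { intros n; apply (is_lim_seq_incr_compare (fun n => E (INR n)) c Hc).
    intros k; apply Hmono; [apply pos_INR | apply le_INR; lia]. }
  exists c; split.
  + eapply Rlt_le_trans; [| apply (Hle 1%nat)]; unfold E.
    apply RInt_gt_0; [simpl; lra | intros; apply gauss_pos | intros; apply gauss_cont].
  + intros eps He; apply is_lim_seq_spec in Hc; destruct (Hc (mkposreal eps He)) as [N HN].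
    simpl in HN; exists (INR N); intros r Hr; fold (E r).
    specialize (HN N (Nat.le_refl N)).
    assert (H1 : E (INR N) <= E r) by (apply Hmono; [apply pos_INR | exact Hr]).
    assert (H2 : E r <= c).
    { pose proof (pos_INR N); destruct (nfloor_ex r) as [m [_ Hm]]; [lra |].
      eapply Rle_trans; [| apply (Hle (S m))]; apply Hmono; rewrite ?S_INR; lra. }
    specialize (Hle N); apply Rabs_lt_between in HN; apply Rabs_lt_between; lra.
Qed.

(** The mass on [-L, L] is that of the Gaussian on an interval dilated by 2^n. For the rest, |f(x) -
    f(0)| <= B |x|, and |x| times the kernel is, on each half-line, the derivative of the kernel up
    to a factor 2 tau; it integrates exactly, which leaves at most 4 B 2^(-n). *)
Lemma heat_delta : exists c, 0 < c /\ forall (f f' : R -> R) B L, 0 < L ->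
  (forall x, is_derive f x (f' x)) -> (forall x, Rabs (f' x) <= B) ->
  is_lim_seq (fun n => RInt (fun x => heat 0 (time n) x * f x) (- L) L) (c * f 0).
Proof.
destruct gauss_mass as [c [Hc Hlim]]; exists c; split; [exact Hc |].
intros f f' B L HL Df HB.
assert (Cf : forall x, continuous f x) by (intros x; exact (is_derive_continuous _ _ _ (Df x))).
assert (Ch : forall n x, continuous (heat 0 (time n)) x).
{ intros n x; exact (is_derive_continuous _ _ _ (heat_x 0 (time n) x (time_pos n))). }
assert (Ch1 : forall n x, continuous (heat 1 (time n)) x).
{ intros n x; exact (is_derive_continuous _ _ _ (heat_x 1 (time n) x (time_pos n))). }
assert (HB0 : 0 <= B) by (eapply Rle_trans; [apply Rabs_pos | apply (HB 0)]).
assert (Hsq : forall n, sqrt (time n) = (/ 2) ^ n).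
{ intros n; unfold time; rewrite sqrt_pow2; [reflexivity | apply pow_le; lra]. }
assert (Hmass : forall n, RInt (heat 0 (time n)) (- L) L = RInt gauss (- (L * 2 ^ n)) (L * 2 ^ n)).
{ intros n; pose proof (pow_lt 2 n ltac:(lra)) as H2.
  assert (I : ex_RInt gauss (2 ^ n * - L + 0) (2 ^ n * L + 0))
    by (apply ex_RInt_cont, gauss_cont).
  pose proof (RInt_comp_lin (V := R_CompleteNormedModule) gauss (2 ^ n) 0 (- L) L I) as H.
  replace (- (L * 2 ^ n)) with (2 ^ n * - L + 0) by ring.
  replace (L * 2 ^ n) with (2 ^ n * L + 0) by ring.
  etransitivity; [| exact H].
  apply RInt_extR; intros x _; unfold heat; rewrite Hsq; unfold gauss, scal; simpl; unfold mult; simpl.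
  rewrite pow_inv; unfold Rdiv at 1; rewrite Rinv_inv, Rmult_comm; f_equal; f_equal; f_equal.
  unfold time; rewrite pow_inv; field; lra. }
assert (Hdev : forall n, Rabs (RInt (fun x => heat 0 (time n) x * (f x - f 0)) (- L) L)
                 <= 4 * B * (/ 2) ^ n).
{ intros n; set (t := time n); pose proof (time_pos n) as Ht; fold t in Ht.
  assert (Hx : forall u v, ex_RInt (fun x => heat 0 t x * (f x - f 0)) u v).
  { intros u v; apply ex_RInt_cont; intros x; apply cont_mult; [apply Ch |].
    apply (continuous_minus f (fun _ => f 0)); [apply Cf | apply continuous_const]. }
  assert (H0 : heat 0 t 0 = 2 ^ n).
  { unfold heat, t; rewrite Hsq, pow_i by lia; unfold Rdiv.
    rewrite Rmult_0_l, Ropp_0, exp_0, pow_inv, Rinv_inv; ring. }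
  assert (Et : 2 * t * 2 ^ n = 2 * (/ 2) ^ n).
  { unfold t, time; rewrite pow_inv; field; apply pow_nonzero; lra. }
  assert (E1 : forall x, - (2 * t) * heat 1 t x = x * heat 0 t x)
    by (intros x; rewrite heat_1; field; lra).
  assert (Hf : forall x, Rabs (f x - f 0) <= B * Rabs x).
  { intros x; pose proof (mvt_le f f' 0 x B (fun z _ => Df z) (fun z _ => HB z)) as H.
    rewrite Rminus_0_r in H; exact H. }
  assert (Hhalf : forall s u v, u <= v -> (forall x, u <= x <= v -> Rabs x = s * x) ->
    Rabs (RInt (fun x => heat 0 t x * (f x - f 0)) u v)
    <= (- (2 * t) * (s * B)) * heat 0 t v - (- (2 * t) * (s * B)) * heat 0 t u).
  { intros s u v Huv Hs.
    apply (@norm_RInt_le R_NormedModule (fun x => heat 0 t x * (f x - f 0))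
             (fun x => (- (2 * t) * (s * B)) * heat 1 t x) u v); [exact Huv | | |].
    - intros x Hxx; change (Rabs (heat 0 t x * (f x - f 0)) <= - (2 * t) * (s * B) * heat 1 t x).
      replace (- (2 * t) * (s * B) * heat 1 t x) with (s * B * (- (2 * t) * heat 1 t x)) by ring.
      rewrite E1; replace (s * B * (x * heat 0 t x)) with (heat 0 t x * (B * (s * x))) by ring.
      rewrite <- Hs by exact Hxx; pose proof (heat_pos t x Ht).
      rewrite Rabs_mult, (Rabs_pos_eq (heat 0 t x)) by lra.
      apply Rmult_le_compat_l; [lra | apply Hf].
    - apply (@RInt_correct R_CompleteNormedModule), Hx.
    - apply (is_RInt_derive (fun x => (- (2 * t) * (s * B)) * heat 0 t x)).
      + intros x _; apply is_derive_scal, heat_x, Ht.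
      + intros x _; apply (continuous_scal_r (- (2 * t) * (s * B)) (heat 1 t)), Ch1. }
  rewrite <- (RInt_ChaslesR _ (- L) 0 L) by apply Hx.
  eapply Rle_trans; [apply Rabs_triang |].
  pose proof (Hhalf (-1) (- L) 0 ltac:(lra)) as P1; pose proof (Hhalf 1 0 L ltac:(lra)) as P2.
  specialize (P1 ltac:(intros x Hxx; rewrite Rabs_left1; lra)).
  specialize (P2 ltac:(intros x Hxx; rewrite Rabs_pos_eq; lra)).
  rewrite H0 in P1, P2.
  pose proof (heat_pos t L Ht); pose proof (heat_pos t (- L) Ht).
  assert (0 <= 2 * t * B) by nra.
  assert (E2 : 2 * t * B * 2 ^ n = 2 * B * (/ 2) ^ n).
  { replace (2 * t * B * 2 ^ n) with (2 * t * 2 ^ n * B) by ring; rewrite Et; ring. }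
  assert (0 <= 2 * t * B * heat 0 t L) by (apply Rmult_le_pos; lra).
  assert (0 <= 2 * t * B * heat 0 t (- L)) by (apply Rmult_le_pos; lra).
  lra. }
apply is_lim_seq_ext with (fun n => RInt gauss (- (L * 2 ^ n)) (L * 2 ^ n) * f 0
   + RInt (fun x => heat 0 (time n) x * (f x - f 0)) (- L) L).
{ intros n; rewrite <- Hmass.
  assert (I1 : ex_RInt (heat 0 (time n)) (- L) L) by (apply ex_RInt_cont, Ch).
  assert (I2 : ex_RInt (fun x => heat 0 (time n) x * (f x - f 0)) (- L) L).
  { apply ex_RInt_cont; intros x; apply cont_mult; [apply Ch |].
    apply (continuous_minus f (fun _ => f 0)); [apply Cf | apply continuous_const]. }
  destruct (RInt_linR _ _ (f 0) 1 _ _ I1 I2) as [_ E].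
  rewrite (Rmult_comm _ (f 0)), <- (Rmult_1_l (RInt (fun x => heat 0 (time n) x * (f x - f 0)) _ _)).
  rewrite <- E; apply RInt_extR; intros; ring. }
replace (c * f 0) with (c * f 0 + 0) by ring.
apply (is_lim_seq_plus' _ _ (c * f 0) 0).
- apply (is_lim_seq_scal_r _ (f 0) c), is_lim_seq_spec; intros eps.
  destruct (Hlim eps (cond_pos eps)) as [N HN].
  destruct (nfloor_ex (Rabs N / L)) as [m [_ Hm]].
  { apply Rmult_le_pos; [apply Rabs_pos | left; apply Rinv_0_lt_compat, HL]. }
  exists (S m); intros n Hn; apply HN.
  assert (INR n <= 2 ^ n).
  { left; clear; induction n as [|n IH]; [simpl; lra |].
    rewrite S_INR; simpl; pose proof (pow_R1_Rle 2 n ltac:(lra)); lra. }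
  apply le_INR in Hn; rewrite S_INR in Hn.
  apply Rle_trans with (Rabs N); [apply Rle_abs |].
  replace (Rabs N) with (L * (Rabs N / L)) by (field; lra).
  apply Rmult_le_compat_l; lra.
- apply (is_lim_seq_le_le (fun n => - (4 * B * (/ 2) ^ n)) _ (fun n => 4 * B * (/ 2) ^ n)).
  + intros n; apply Rabs_le_between, Hdev.
  + replace (Finite 0) with (Rbar_opp (4 * B * 0)) by (simpl; f_equal; ring).
    apply (is_lim_seq_opp _ (4 * B * 0)), (is_lim_seq_scal_l _ (4 * B) 0), is_lim_seq_geom.
    rewrite Rabs_pos_eq; lra.
  + replace (Finite 0) with (Finite (4 * B * 0)) by (f_equal; ring).
    apply (is_lim_seq_scal_l _ (4 * B) 0), is_lim_seq_geom; rewrite Rabs_pos_eq; lra.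
Qed.

(** * Weight sequences and the classes of jets they define *)

Section WeightSequence.

Variable M : nat -> R.
Hypothesis M_pos : forall p, 0 < M p.
Hypothesis M_0 : M 0%nat = 1.
Hypothesis M_1 : cond_M1 M.

Lemma M1_S p : M (S p) * M (S p) <= M (S (S p)) * M p.
Proof.
pose proof (M_1 (S p) ltac:(lia)) as H.
replace (S p + 1)%nat with (S (S p)) in H by lia.
replace (S p - 1)%nat with p in H by lia. simpl in H; lra.
Qed.

(* This is m_{p+1}. *)
Definition ratio (p : nat) : R := M (S p) / M p.

Lemma ratio_pos p : 0 < ratio p.
Proof. apply Rdiv_lt_0_compat; apply M_pos. Qed.

Lemma M_S p : M (S p) = ratio p * M p.
Proof. unfold ratio; field; pose proof (M_pos p); lra. Qed.

Lemma ratio_S p : ratio p <= ratio (S p).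
Proof.
unfold ratio; pose proof (M_pos p); pose proof (M_pos (S p)).
apply Rmult_le_reg_r with (M p * M (S p)); [nra |].
replace (M (S p) / M p * (M p * M (S p))) with (M (S p) * M (S p)) by (field; lra).
replace (M (S (S p)) / M (S p) * (M p * M (S p))) with (M (S (S p)) * M p)
  by (field; lra).
apply M1_S.
Qed.

Lemma ratio_mono p q : (p <= q)%nat -> ratio p <= ratio q.
Proof.
induction 1 as [|q Hq IH]; [lra |]; pose proof (ratio_S q); lra.
Qed.

(** By (M.1) the ratios increase, so each factor of M_i is at most the corresponding one of M_{i+j}
    / M_j. *)
Lemma M_mult i j : M i * M j <= M (i + j)%nat.
Proof.
induction i as [|i IH]; simpl; [rewrite M_0; lra |].
rewrite !M_S.
pose proof (ratio_mono i (i + j) ltac:(lia)); pose proof (ratio_pos i).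
pose proof (M_pos i); pose proof (M_pos j); pose proof (M_pos (i + j)).
apply Rle_trans with (ratio i * M (i + j)%nat); [nra |].
apply Rmult_le_compat_r; lra.
Qed.

Lemma M_le_S p : M p <= / M 1%nat * M (S p).
Proof.
pose proof (M_pos 1) as H1.
apply Rmult_le_reg_l with (M 1%nat); [exact H1 |].
rewrite <- Rmult_assoc, Rinv_r, Rmult_1_l by lra.
exact (M_mult 1 p).
Qed.

(** The bound is localised at a point because the products with 1 - chi are estimated separately
    where that factor vanishes and where it does not. *)
Definition bnd_at (h C : R) (f : nat -> R -> R) (x : R) : Prop :=
  forall p, Rabs (f p x) <= C * (M p / h ^ p).

Definition bnd (h C : R) (f : nat -> R -> R) : Prop := forall x, bnd_at h C f x.

Lemma Mh_pos h p : 0 < h -> 0 < M p / h ^ p.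
Proof. intros; apply Rdiv_lt_0_compat; [apply M_pos | apply pow_lt; lra]. Qed.

Lemma Mh_anti h h' p : 0 < h -> h <= h' -> M p / h' ^ p <= M p / h ^ p.
Proof.
intros Hh Hhh; apply Rmult_le_compat_l; [pose proof (M_pos p); lra |].
apply Rinv_le_contravar; [apply pow_lt; lra | apply pow_incr; lra].
Qed.

Lemma bnd_at_C_pos h C f x : 0 < h -> bnd_at h C f x -> 0 <= C.
Proof.
intros Hh H; specialize (H 0%nat); simpl in H; rewrite M_0 in H.
pose proof (Rabs_pos (f 0%nat x)); lra.
Qed.

Lemma bnd_at_anti h h' C f x : 0 < h -> h <= h' -> bnd_at h' C f x -> bnd_at h C f x.
Proof.
intros Hh Hhh H p; eapply Rle_trans; [apply H |].
apply Rmult_le_compat_l; [apply (bnd_at_C_pos h' C f x); [lra | exact H] |].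
apply Mh_anti; assumption.
Qed.

Lemma bnd_at_mono h C C' f x : 0 < h -> C <= C' -> bnd_at h C f x -> bnd_at h C' f x.
Proof.
intros Hh HC H p; eapply Rle_trans; [apply H |].
apply Rmult_le_compat_r; [left; apply Mh_pos; lra | lra].
Qed.

Lemma bnd_at_lin h C D a b f g x :
  bnd_at h C f x -> bnd_at h D g x ->
  bnd_at h (Rabs a * C + Rabs b * D) (fun p x => a * f p x + b * g p x) x.
Proof.
intros Hf Hg p; eapply Rle_trans; [apply Rabs_triang |].
rewrite !Rabs_mult, Rmult_plus_distr_r, !Rmult_assoc.
apply Rplus_le_compat; (apply Rmult_le_compat_l; [apply Rabs_pos | auto]).
Qed.

(* Leibniz' formula is avoided by induction on the number of derivatives, for
   factors that have already been differentiated [i] and [j] times. *)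
Lemma bnd_at_mul_shift h C D x n : 0 < h -> forall i j f g,
  (forall p, Rabs (f p x) <= C * (M (p + i)%nat / h ^ (p + i))) ->
  (forall p, Rabs (g p x) <= D * (M (p + j)%nat / h ^ (p + j))) ->
  Rabs (jmul n f g x) <= C * D * (2 ^ n * (M (n + i + j)%nat / h ^ (n + i + j))).
Proof.
intros Hh; induction n as [|n IH]; intros i j f g Hf Hg.
- simpl; rewrite Rabs_mult.
  specialize (Hf 0%nat); specialize (Hg 0%nat); simpl in Hf, Hg.
  pose proof (Mh_pos h i Hh); pose proof (Mh_pos h j Hh).
  pose proof (Rabs_pos (f 0%nat x)); pose proof (Rabs_pos (g 0%nat x)).
  assert (HC : 0 <= C) by (apply Rmult_le_reg_r with (M i / h ^ i); lra).
  assert (HD : 0 <= D) by (apply Rmult_le_reg_r with (M j / h ^ j); lra).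
  apply Rle_trans with ((C * (M i / h ^ i)) * (D * (M j / h ^ j))).
  { apply Rmult_le_compat; assumption. }
  replace (C * (M i / h ^ i) * (D * (M j / h ^ j)))
    with (C * D * (M i * M j / h ^ (i + j))).
  2:{ rewrite pow_add; field; split; apply pow_nonzero; lra. }
  rewrite Rmult_1_l; apply Rmult_le_compat_l; [nra |].
  apply Rmult_le_compat_r; [left; apply Rinv_0_lt_compat, pow_lt, Hh |].
  apply M_mult.
- simpl; eapply Rle_trans; [apply Rabs_triang |].
  assert (H1 := IH (S i) j (fun p => f (S p)) g).
  assert (H2 := IH i (S j) f (fun p => g (S p))).
  replace (n + S i + j)%nat with (S (n + i + j)) in H1 by lia.
  replace (n + i + S j)%nat with (S (n + i + j)) in H2 by lia.
  simpl in H1, H2.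
  assert (E : forall k p, (p + S k = S p + k)%nat) by (intros; lia).
  eapply Rle_trans; [apply Rplus_le_compat; [apply H1 | apply H2] |]; auto.
  + intros p; rewrite E; apply Hf.
  + intros p; rewrite E; apply Hg.
  + right; ring.
Qed.

(** The 2^n terms of Leibniz' rule are absorbed by halving the index h. *)
Lemma bnd_at_mul h C D f g x : 0 < h ->
  bnd_at h C f x -> bnd_at h D g x ->
  bnd_at (h / 2) (C * D) (fun n => jmul n f g) x.
Proof.
intros Hh Hf Hg n.
pose proof (bnd_at_mul_shift h C D x n Hh 0 0 f g) as H.
eapply Rle_trans; [apply H |].
- intros p; rewrite Nat.add_0_r; apply Hf.
- intros p; rewrite Nat.add_0_r; apply Hg.
- rewrite !Nat.add_0_r; right; f_equal.
  unfold Rdiv; rewrite Rpow_mult_distr, Rinv_mult, pow_inv, Rinv_inv; ring.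
Qed.

Definition cls (star : ultra_class) (f : nat -> R -> R) : Prop :=
  match star with
  | Beurling => forall h, 0 < h -> exists C, bnd h C f
  | Roumieu => exists h C, 0 < h /\ bnd h C f
  end.

Definition supp_in (L : R) (f : nat -> R -> R) : Prop :=
  forall p x, L < Rabs x -> f p x = 0.

Definition test (star : ultra_class) (f : nat -> R -> R) : Prop :=
  jet f /\ cls star f /\ exists L, 0 < L /\ supp_in L f.

Lemma cls_bounded star f : cls star f -> forall p, exists B, forall x, Rabs (f p x) <= B.
Proof.
intros H p; assert (exists h C, 0 < h /\ bnd h C f) as [h [C [Hh HC]]].
{ destruct star; [destruct (H 1 Rlt_0_1) as [C HC]; exists 1, C; split; [lra | exact HC]
                 | exact H]. }
exists (C * (M p / h ^ p)); intros x; apply HC.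
Qed.

Lemma cls_lin star a b f g : cls star f -> cls star g ->
  cls star (fun p x => a * f p x + b * g p x).
Proof.
destruct star; simpl.
- intros Hf Hg h Hh; destruct (Hf h Hh) as [C HC]; destruct (Hg h Hh) as [D HD].
  eexists; intros x; apply bnd_at_lin; [apply HC | apply HD].
- intros [h [C [Hh HC]]] [k [D [Hk HD]]].
  exists (Rmin h k); eexists; split; [apply Rmin_glb_lt; lra |].
  intros x; apply bnd_at_lin.
  + apply bnd_at_anti with h; [apply Rmin_glb_lt; lra | apply Rmin_l | apply HC].
  + apply bnd_at_anti with k; [apply Rmin_glb_lt; lra | apply Rmin_r | apply HD].
Qed.

Lemma cls_mul star f g : cls star f -> cls star g -> cls star (fun n => jmul n f g).
Proof.
destruct star; simpl.
- intros Hf Hg h Hh; destruct (Hf (2 * h)) as [C HC]; [lra |].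
  destruct (Hg (2 * h)) as [D HD]; [lra |]; exists (C * D); intros x.
  replace h with (2 * h / 2) by field; apply bnd_at_mul; [lra | apply HC | apply HD].
- intros [h [C [Hh HC]]] [k [D [Hk HD]]].
  assert (Hm : 0 < Rmin h k) by (apply Rmin_glb_lt; lra).
  exists (Rmin h k / 2), (C * D); split; [lra |]; intros x; apply bnd_at_mul; auto.
  + apply bnd_at_anti with h; [lra | apply Rmin_l | apply HC].
  + apply bnd_at_anti with k; [lra | apply Rmin_r | apply HD].
Qed.

Lemma bnd_affine h C k c f : 0 < h -> k <> 0 -> bnd h C f ->
  bnd (h / Rabs k) C (fun p x => k ^ p * f p (k * x + c)).
Proof.
intros Hh Hk H x p; rewrite Rabs_mult, <- RPow_abs.
replace (C * (M p / (h / Rabs k) ^ p)) with (Rabs k ^ p * (C * (M p / h ^ p))).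
- apply Rmult_le_compat_l; [apply pow_le, Rabs_pos | apply H].
- pose proof (Rabs_no_R0 k Hk).
  unfold Rdiv; rewrite Rpow_mult_distr, Rinv_mult, pow_inv, Rinv_inv; ring.
Qed.

Lemma cls_affine star k c f : k <> 0 -> cls star f ->
  cls star (fun p x => k ^ p * f p (k * x + c)).
Proof.
intros Hk; pose proof (Rabs_pos_lt k Hk) as Hk'; destruct star; simpl.
- intros Hf h Hh; destruct (Hf (h * Rabs k)) as [C HC]; [nra |].
  exists C; replace h with (h * Rabs k / Rabs k) by (field; lra).
  apply bnd_affine; auto; nra.
- intros [h [C [Hh HC]]]; exists (h / Rabs k), C; split.
  + apply Rdiv_lt_0_compat; lra.
  + apply bnd_affine; auto.
Qed.

(** Many jets below are written with coefficients 1, -1 or 0, which look redundant, so as to have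
    exactly this shape. *)
Lemma test_lin star a b f g : test star f -> test star g ->
  test star (fun p x => a * f p x + b * g p x).
Proof.
intros [Jf [Cf [L [HL Sf]]]] [Jg [Cg [N [HN Sg]]]].
split; [apply jet_lin; assumption |]; split; [apply cls_lin; assumption |].
exists (L + N); split; [lra |]; intros p x Hx.
rewrite (Sf p x), (Sg p x) by lra; ring.
Qed.

Lemma test_mul star f g : test star f -> test star g ->
  test star (fun n => jmul n f g).
Proof.
intros [Jf [Cf [L [HL Sf]]]] [Jg [Cg _]].
split; [apply jet_mul; assumption |]; split; [apply cls_mul; assumption |].
exists L; split; [lra |]; intros p x Hx; apply jmul_0_l; intros q; apply Sf, Hx.
Qed.

Lemma test_affine star k c f : k <> 0 -> test star f ->
  test star (fun p x => k ^ p * f p (k * x + c)).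
Proof.
intros Hk [Jf [Cf [L [HL Sf]]]].
pose proof (Rabs_pos_lt k Hk) as Hk'.
split; [apply jet_affine; assumption |]; split; [apply cls_affine; assumption |].
exists ((L + Rabs c) / Rabs k); split.
{ apply Rdiv_lt_0_compat; pose proof (Rabs_pos c); lra. }
intros p x Hx; rewrite Sf; [ring |].
apply Rmult_lt_compat_l with (r := Rabs k) in Hx; [| exact Hk'].
replace (Rabs k * ((L + Rabs c) / Rabs k)) with (L + Rabs c) in Hx by (field; lra).
rewrite <- Rabs_mult in Hx.
pose proof (Rabs_triang_inv (k * x) (- c)) as H; rewrite Rabs_Ropp in H.
replace (k * x - - c) with (k * x + c) in H by ring; lra.
Qed.

Lemma test_bounded star f : test star f -> forall p, exists B, forall x, Rabs (f p x) <= B.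
Proof. intros [_ [H _]]; exact (cls_bounded star f H). Qed.

Lemma test_zero star : test star (fun _ _ => 0).
Proof.
split; [intros p x; apply (is_derive_const 0) |]; split.
- assert (H : bnd 1 0 (fun _ _ => 0)).
  { intros x p; rewrite Rabs_R0; lra. }
  assert (H' : forall h, bnd h 0 (fun _ _ => 0)).
  { intros h x p; rewrite Rabs_R0; lra. }
  destruct star; [intros h _; exists 0; apply H' | exists 1, 0; split; [lra | exact H]].
- exists 1; split; [lra | intros p x _; reflexivity].
Qed.

(** * Complex test functions as pairs of real jets *)

Definition cpair (f g : nat -> R -> R) (x : R) : C := (f 0%nat x, g 0%nat x).

Lemma deriv_pair f g p x : jet f -> jet g -> deriv (cpair f g) p x = (f p x, g p x).
Proof.
intros Hf Hg; unfold deriv, cpair; simpl; f_equal.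
- exact (jet_Derive_n f Hf p x).
- exact (jet_Derive_n g Hg p x).
Qed.

Lemma smooth_pair f g : jet f -> jet g -> smooth (cpair f g).
Proof.
intros Hf Hg p x; split; [exact (jet_ex_derive_n f Hf p x) | exact (jet_ex_derive_n g Hg p x)].
Qed.

Lemma adherence_interval (D : R -> Prop) L :
  (forall x, D x -> Rabs x <= L) -> included (adherence D) (fun x => - L <= x <= L).
Proof.
intros H x Hx.
destruct (Rle_dec (Rabs x) L) as [Hl | Hl].
- apply Rabs_le_between; exact Hl.
- exfalso; assert (He : 0 < Rabs x - L) by lra.
  destruct (Hx (disc x (mkposreal _ He))) as [y [Hy1 Hy2]].
  + exists (mkposreal _ He); intros y Hy; exact Hy.
  + unfold disc in Hy1; simpl in Hy1; specialize (H y Hy2).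
    pose proof (Rabs_triang_inv x y); rewrite (Rabs_minus_sym y x) in Hy1; lra.
Qed.

Lemma adherence_self (D : R -> Prop) x : D x -> adherence D x.
Proof.
intros H V [d Hd]; exists x; split; [| exact H].
apply Hd; unfold disc; rewrite Rminus_diag, Rabs_R0; apply cond_pos.
Qed.

Lemma norm_MhK_le h (K : R -> Prop) f g C : 0 < h -> jet f -> jet g ->
  bnd h C f -> bnd h C g -> Rbar_le (norm_MhK M h K (cpair f g)) (2 * C).
Proof.
intros Hh Jf Jg Hf Hg; unfold norm_MhK.
apply Lub_Rbar_correct; intros y [t [p [_ ->]]].
rewrite (deriv_pair f g p t Jf Jg); simpl.
pose proof (M_pos p); pose proof (pow_lt h p Hh).
pose proof (Cmod_pair_le (f p t) (g p t)) as Hc.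
specialize (Hf t p); specialize (Hg t p).
apply Rmult_le_reg_r with (M p / h ^ p); [apply Mh_pos, Hh |].
replace (h ^ p * Cmod (f p t, g p t) / M p * (M p / h ^ p))
  with (Cmod (f p t, g p t)) by (field; lra).
lra.
Qed.

Lemma D_MhK_pair h L f g C : 0 < h -> jet f -> jet g ->
  bnd h C f -> bnd h C g -> supp_in L f -> supp_in L g ->
  D_MhK M h (fun x => - L <= x <= L) (cpair f g).
Proof.
intros Hh Jf Jg Hf Hg Sf Sg; split; [apply smooth_pair; assumption |]; split.
- apply adherence_interval; intros x Hx.
  destruct (Rle_dec (Rabs x) L) as [Hl | Hl]; [exact Hl | exfalso; apply Hx].
  unfold cpair; rewrite Sf, Sg by lra; reflexivity.
- eapply Rbar_le_lt_trans; [apply (norm_MhK_le h _ f g C); assumption | exact I].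
Qed.

Lemma D_MhK_elim h (K : R -> Prop) phi : 0 < h -> compact K -> D_MhK M h K phi ->
  exists f g L C, phi = cpair f g /\ jet f /\ jet g /\ 0 < L /\
    supp_in L f /\ supp_in L g /\ bnd h C f /\ bnd h C g.
Proof.
intros Hh HK [Hs [HK' Hn]].
set (f := Derive_n (fun t => Re (phi t))); set (g := Derive_n (fun t => Im (phi t))).
assert (Jf : jet f) by (apply jet_of_smooth; intros p x; apply Hs).
assert (Jg : jet g) by (apply jet_of_smooth; intros p x; apply Hs).
destruct (compact_P1 K HK) as [m [N HmN]].
set (L := Rabs m + Rabs N + 1).
assert (HL : 0 < L) by (unfold L; pose proof (Rabs_pos m); pose proof (Rabs_pos N); lra).
assert (Hout : forall x, ~ K x -> phi x = 0%C).
{ intros x Hx; apply NNPP; intros H; apply Hx, HK', adherence_self, H. }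
assert (HKL : forall x, L < Rabs x -> ~ K x).
{ intros x Hx HKx; specialize (HmN x HKx); unfold L in Hx.
  revert Hx; unfold Rabs; repeat destruct Rcase_abs; lra. }
assert (Hlub := Lub_Rbar_correct (fun y => exists t p, K t /\ y = h ^ p * Cmod (deriv phi p t) / M p)).
destruct Hlub as [Hub _]; fold (norm_MhK M h K phi) in Hub.
assert (exists C, 0 <= C /\ forall p x, K x -> Cmod (deriv phi p x) <= C * (M p / h ^ p))
  as [C [HC0 HC]].
(* For empty K the norm is [m_infty], whose real value is 0 by convention; the maximum makes the
   constant nonnegative in every case. *)
{ exists (Rmax 0 (real (norm_MhK M h K phi))); split; [apply Rmax_l |].
  intros p x Hx.
  assert (H := Hub _ (ex_intro _ x (ex_intro _ p (conj Hx eq_refl)))).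
  destruct (norm_MhK M h K phi) as [r | |]; simpl in *; [| contradiction | contradiction].
  pose proof (M_pos p); pose proof (pow_lt h p Hh).
  pose proof (Rmax_r 0 r); pose proof (Mh_pos h p Hh).
  apply Rle_trans with (r * (M p / h ^ p)); [| apply Rmult_le_compat_r; lra].
  apply Rmult_le_reg_r with (h ^ p / M p); [apply Rdiv_lt_0_compat; lra |].
  replace (r * (M p / h ^ p) * (h ^ p / M p)) with r by (field; lra).
  eapply Rle_trans; [| exact H]; right; field; lra. }
(* A derivative at a point outside K vanishes since the support is closed. *)
assert (Hz : forall p x, ~ K x -> f p x = 0 /\ g p x = 0).
{ intros p x Hx.
  assert (Hna : ~ support phi x) by (intros H; apply Hx, HK', H).
  assert (exists d : posreal, forall y, Rabs (y - x) < d -> phi y = 0%C) as [d Hd].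
  { apply NNPP; intros Hn'; apply Hna; intros V [d Hd].
    apply NNPP; intros Hv; apply Hn'; exists d; intros y Hy.
    apply NNPP; intros Hy'; apply Hv; exists y; split; [apply Hd, Hy | exact Hy']. }
  unfold f, g; split; rewrite (Derive_n_ext_loc _ (fun _ => 0));
    try (destruct p; [reflexivity | apply Derive_n_const]);
    (exists d; intros y Hy; rewrite (Hd y Hy); reflexivity). }
assert (HB : forall p x, Rabs (f p x) <= C * (M p / h ^ p) /\ Rabs (g p x) <= C * (M p / h ^ p)).
{ intros p x; destruct (classic (K x)) as [Hx | Hx].
  - specialize (HC p x Hx).
    split; (eapply Rle_trans; [| exact HC]).
    + apply (Rle_trans _ (Rmax (Rabs (f p x)) (Rabs (g p x)))); [apply Rmax_l |].
      apply (Rmax_Cmod (deriv phi p x)).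
    + apply (Rle_trans _ (Rmax (Rabs (f p x)) (Rabs (g p x)))); [apply Rmax_r |].
      apply (Rmax_Cmod (deriv phi p x)).
  - destruct (Hz p x Hx) as [-> ->]; rewrite Rabs_R0.
    pose proof (Mh_pos h p Hh); split; apply Rmult_le_pos; lra. }
exists f, g, L, C; split; [| split; [exact Jf | split; [exact Jg | split; [exact HL |]]]].
- apply functional_extensionality; intros x; unfold cpair, f, g; simpl.
  destruct (phi x); reflexivity.
- split; [intros p x Hx; apply (Hz p x), HKL, Hx |].
  split; [intros p x Hx; apply (Hz p x), HKL, Hx |].
  split; intros x p; apply HB.
Qed.

Lemma D_star_pair star f g : test star f -> test star g -> D_star star M (cpair f g).
Proof.
intros [Jf [Cf [L [HL Sf]]]] [Jg [Cg [N [HN Sg]]]].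
assert (Sf' : supp_in (L + N) f) by (intros p x Hx; apply Sf; lra).
assert (Sg' : supp_in (L + N) g) by (intros p x Hx; apply Sg; lra).
exists (fun x => - (L + N) <= x <= L + N); split; [apply compact_P3 |].
assert (H : forall h C D, 0 < h -> bnd h C f -> bnd h D g ->
          D_MhK M h (fun x => - (L + N) <= x <= L + N) (cpair f g)).
{ intros h C D Hh Hf Hg; apply D_MhK_pair with (Rmax C D); auto; intros x.
  - apply bnd_at_mono with C; [lra | apply Rmax_l | apply Hf].
  - apply bnd_at_mono with D; [lra | apply Rmax_r | apply Hg]. }
destruct star; simpl.
- intros h Hh; destruct (Cf h Hh) as [C HC]; destruct (Cg h Hh) as [D HD].
  apply H with C D; auto.
- destruct Cf as [h [C [Hh HC]]]; destruct Cg as [k [D [Hk HD]]].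
  assert (Hm : 0 < Rmin h k) by (apply Rmin_glb_lt; lra).
  exists (Rmin h k); split; [exact Hm |]; apply H with C D; auto.
  + intros x; apply bnd_at_anti with h; [lra | apply Rmin_l | apply HC].
  + intros x; apply bnd_at_anti with k; [lra | apply Rmin_r | apply HD].
Qed.

Lemma pair_inj f g f' g' : jet f -> jet g -> jet f' -> jet g' ->
  cpair f g = cpair f' g' -> forall p x, f p x = f' p x /\ g p x = g' p x.
Proof.
intros Jf Jg Jf' Jg' E p x.
assert (E' : forall x, cpair f g x = cpair f' g' x) by (intros y; rewrite E; reflexivity).
split; apply jet_unique; auto; intros y; specialize (E' y); unfold cpair in E';
  congruence.
Qed.

(** In the Beurling case each index h yields its own pair of jets with its own constant; these pairs
    agree by [pair_inj], so a single pair satisfies all bounds. *)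
Lemma D_star_elim star phi : D_star star M phi ->
  exists f g, phi = cpair f g /\ test star f /\ test star g.
Proof.
intros [K [HK H]]; destruct star; simpl in H.
- destruct (D_MhK_elim 1 K phi Rlt_0_1 HK (H 1 Rlt_0_1))
    as [f [g [L [C [E [Jf [Jg [HL [Sf [Sg _]]]]]]]]]].
  assert (Hc : forall h, 0 < h -> exists C, bnd h C f /\ bnd h C g).
  { intros h Hh; destruct (D_MhK_elim h K phi Hh HK (H h Hh))
      as [f' [g' [L' [C' [E' [Jf' [Jg' [_ [_ [_ [Hf Hg]]]]]]]]]]].
    rewrite E in E'; assert (I := pair_inj f g f' g' Jf Jg Jf' Jg' E').
    exists C'; split; intros x p; destruct (I p x) as [If Ig]; [rewrite If; apply Hf | rewrite Ig; apply Hg]. }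
  exists f, g; split; [exact E |]; split; (split; [assumption |]); split;
    try (exists L; split; assumption);
    intros h Hh; destruct (Hc h Hh) as [D [H1 H2]]; exists D; assumption.
- destruct H as [h [Hh H]].
  destruct (D_MhK_elim h K phi Hh HK H)
    as [f [g [L [C [E [Jf [Jg [HL [Sf [Sg [Hf Hg]]]]]]]]]]].
  exists f, g; split; [exact E |]; split; (split; [assumption |]); split;
    try (exists L; split; assumption); exists h, C; split; assumption.
Qed.

Lemma test_jet star f : test star f -> jet f.
Proof. intros [H _]; exact H. Qed.

Lemma test_supp star f : test star f -> exists L, 0 < L /\ supp_in L f.
Proof. intros [_ [_ H]]; exact H. Qed.

(** * Consequences of (M.2) and (M.3') *)

Hypothesis M_2 : cond_M2 M.
Hypothesis M_3' : cond_M3' M.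

Lemma M2_add : exists A H, 1 < A /\ 1 < H /\
  forall p q, M (p + q)%nat <= A * H ^ (p + q) * (M p * M q).
Proof.
destruct M_2 as [A [H [HA [HH H2]]]]; exists A, H; split; [exact HA |].
split; [exact HH |]; intros p q.
destruct (Nat.eq_dec (p + q) 0) as [E | E].
- replace p with 0%nat by lia; replace q with 0%nat by lia; simpl; rewrite M_0; lra.
- specialize (H2 (p + q)%nat p ltac:(lia) ltac:(lia)).
  replace (p + q - p)%nat with q in H2 by lia; exact H2.
Qed.

(** The terms M_k / M_{k+1} decrease and are summable, so n times the n-th one tends to 0: the terms
    between N and n, at least half of them all when n >= 2N, are no smaller than the n-th and have a
    small sum. *)
Lemma ratio_ge L : exists N, forall n, (N <= n)%nat -> INR (S n) * L <= ratio n.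
Proof.
destruct (Rle_dec L 0) as [HL | HL].
{ exists 0%nat; intros n _; pose proof (ratio_pos n); pose proof (pos_INR (S n)); nra. }
assert (HL' : 0 < L) by lra.
set (u := fun k => M k / M (S k)).
assert (Hu : forall k, 0 < u k) by (intros k; apply Rdiv_lt_0_compat; apply M_pos).
assert (Eu : forall k, u k = / ratio k).
{ intros k; unfold u, ratio; rewrite Rinv_div; reflexivity. }
assert (Hdec : forall j k, (j <= k)%nat -> u k <= u j).
{ intros j k Hjk; rewrite !Eu; apply Rinv_le_contravar; [apply ratio_pos | apply ratio_mono, Hjk]. }
destruct (tail_lim u M_3' (/ (2 * L))) as [N HN]; [apply Rinv_0_lt_compat; lra |].
exists (2 * N)%nat; intros n Hn; specialize (HN N (Nat.le_refl N)).
assert (HS : ex_series (fun k => u (N + k)%nat)) by exact (proj1 (ex_series_incr_n u N) M_3').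
assert (Hsum : forall m, INR (S m) * u (N + m)%nat <= sum_f_R0 (fun k => u (N + k)%nat) m).
{ induction m as [|m IH]; [simpl; lra |].
  simpl sum_f_R0; rewrite (S_INR (S m)).
  pose proof (Hdec (N + m)%nat (N + S m)%nat ltac:(lia)).
  pose proof (pos_INR (S m)); nra. }
assert (H1 : sum_f_R0 (fun k => u (N + k)%nat) (n - N) <= Series (fun k => u (N + k)%nat)).
{ rewrite (Series_incr_n _ (S (n - N))) by (lia || exact HS); simpl pred.
  enough (0 <= Series (fun k => u (N + (S (n - N) + k))%nat)) by lra.
  rewrite <- (Rmult_0_l (Series (fun k => u (N + (S (n - N) + k))%nat))), <- Series_scal_l.
  apply Series_le; [intros k; pose proof (Hu (N + (S (n - N) + k))%nat); lra |].
  apply ex_series_ext with (fun k => u ((N + S (n - N)) + k)%nat).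
  - intros k; f_equal; lia.
  - exact (proj1 (ex_series_incr_n u (N + S (n - N))) M_3'). }
specialize (Hsum (n - N)%nat); replace (N + (n - N))%nat with n in Hsum by lia.
pose proof (Rle_abs (Series (fun k => u (N + k)%nat))).
assert (H2 : INR (S n) <= 2 * INR (S (n - N))).
{ replace 2 with (INR 2) by reflexivity; rewrite <- mult_INR; apply le_INR; lia. }
assert (H3 : INR (S n) * u n < / L).
{ replace (/ L) with (2 * / (2 * L)) by (field; lra).
  pose proof (Hu n); nra. }
rewrite Eu in H3; pose proof (ratio_pos n).
apply Rmult_lt_compat_r with (r := ratio n * L) in H3; [| nra].
replace (INR (S n) * / ratio n * (ratio n * L)) with (INR (S n) * L) in H3 by (field; lra).
replace (/ L * (ratio n * L)) with (ratio n) in H3 by (field; lra); lra.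
Qed.

(** The growth of the ratios, multiplied up. Thus the bounds of analytic functions imply those of
    the Beurling class for every index. *)
Lemma fact_le L : 0 < L -> exists C, 0 < C /\ forall p, INR (fact p) * L ^ p <= C * M p.
Proof.
intros HL; destruct (ratio_ge L) as [N HN].
assert (H : exists C, 0 < C /\ forall p, (p <= N)%nat -> INR (fact p) * L ^ p <= C * M p).
{ clear HN; induction N as [|N [C [HC IH]]].
  - exists 1; split; [lra |]; intros p Hp; replace p with 0%nat by lia.
    simpl; rewrite M_0; lra.
  - exists (C + INR (fact (S N)) * L ^ S N / M (S N)).
    assert (0 < INR (fact (S N)) * L ^ S N / M (S N)).
    { apply Rdiv_lt_0_compat; [| apply M_pos].
      apply Rmult_lt_0_compat; [apply INR_fact_lt_0 | apply pow_lt, HL]. }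
    split; [lra |]; intros p Hp; pose proof (M_pos p).
    destruct (Nat.eq_dec p (S N)) as [-> | Hne].
    + rewrite Rmult_plus_distr_r.
      replace (INR (fact (S N)) * L ^ S N / M (S N) * M (S N))
        with (INR (fact (S N)) * L ^ S N) by (field; lra).
      nra.
    + specialize (IH p ltac:(lia)); nra. }
destruct H as [C [HC H]]; exists C; split; [exact HC |].
induction p as [|p IH]; [apply H; lia |].
destruct (Nat.le_gt_cases (S p) N) as [Hp | Hp]; [apply H, Hp |].
specialize (HN p ltac:(lia)); rewrite M_S, fact_simpl, mult_INR.
replace (INR (S p) * INR (fact p) * L ^ S p) with ((INR (S p) * L) * (INR (fact p) * L ^ p))
  by (simpl; ring).
replace (C * (ratio p * M p)) with (ratio p * (C * M p)) by ring.
apply Rmult_le_compat; [| | exact HN | exact IH].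
- apply Rmult_le_pos; [apply pos_INR | lra].
- apply Rmult_le_pos; [apply pos_INR | apply pow_le; lra].
Qed.

Lemma pow_over_M t : 0 < t -> exists C, 0 < C /\ forall q, t ^ q / M q <= C * (/ 2) ^ q.
Proof.
intros Ht; destruct (fact_le (2 * t)) as [C [HC H]]; [lra |]; exists C; split; [exact HC |].
intros q; specialize (H q); pose proof (M_pos q); pose proof (pow_lt t q Ht).
assert (Hf : 1 <= INR (fact q)) by exact (le_INR 1 (fact q) (lt_O_fact q)).
rewrite Rpow_mult_distr in H; pose proof (pow_lt 2 q ltac:(lra)); rewrite pow_inv.
apply Rmult_le_reg_r with (M q * 2 ^ q); [nra |].
replace (t ^ q / M q * (M q * 2 ^ q)) with (t ^ q * 2 ^ q) by (field; lra).
replace (C * / 2 ^ q * (M q * 2 ^ q)) with (C * M q) by (field; lra).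
assert (0 < 2 ^ q * t ^ q) by nra; nra.
Qed.

Lemma half_sum (C : R) : ex_series (fun q => C * (/ 2) ^ q) /\
  Series (fun q => C * (/ 2) ^ q) = 2 * C.
Proof.
assert (H : Rabs (/ 2) < 1) by (rewrite Rabs_pos_eq; lra).
split; [apply (ex_series_scal_l C (fun q => (/ 2) ^ q)), ex_series_geom, H |].
rewrite Series_scal_l, Series_geom by exact H; field.
Qed.

(** * Ultradifferential operators on test functions *)

Definition coef_bnd (K l : R) (b : nat -> R) : Prop :=
  forall q, Rabs (b q) <= K * (l ^ q / M q).

Definition coef_cls (star : ultra_class) (b : nat -> R) : Prop :=
  match star with
  | Beurling => exists l K, 0 < l /\ 0 < K /\ coef_bnd K l b
  | Roumieu => forall l, 0 < l -> exists K, 0 < K /\ coef_bnd K l b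
  end.

(** (M.2) splits M_{q+n} into M_q, which cancels against the coefficient, and M_n. What remains is
    (H l / h)^q, at most 2^(-q) when h >= 2 H l, and the factor H^n, which turns the index h into h
    / H. *)
Lemma ser_term A H K l h C b (f : nat -> R -> R) x n q :
  (forall p q, M (p + q)%nat <= A * H ^ (p + q) * (M p * M q)) ->
  0 < A -> 0 < H -> 0 < K -> 0 < l -> 2 * H * l <= h ->
  coef_bnd K l b -> bnd_at h C f x ->
  Rabs (b q * f (q + n)%nat x) <= K * C * A * (M n / (h / H) ^ n) * (/ 2) ^ q.
Proof.
intros HM HA HH HK Hl Hh Hb Hf; assert (Hh0 : 0 < h) by nra.
pose proof (bnd_at_C_pos h C f x Hh0 Hf) as HC.
rewrite Rabs_mult.
pose proof (M_pos q) as Mq; pose proof (M_pos n) as Mn; pose proof (pow_lt h (q + n) Hh0) as Hp.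
apply Rle_trans with (K * (l ^ q / M q) * (C * (M (q + n)%nat / h ^ (q + n)))).
{ apply Rmult_le_compat; auto using Rabs_pos. }
pose proof (pow_lt l q Hl) as Hlq.
apply Rle_trans with (K * (l ^ q / M q) * (C * (A * H ^ (q + n) * (M q * M n) / h ^ (q + n)))).
{ apply Rmult_le_compat_l.
  - apply Rmult_le_pos; [lra | left; apply Rdiv_lt_0_compat; lra].
  - apply Rmult_le_compat_l; [exact HC |]; apply Rmult_le_compat_r; [| apply HM].
    left; apply Rinv_0_lt_compat, Hp. }
assert (E : K * (l ^ q / M q) * (C * (A * H ^ (q + n) * (M q * M n) / h ^ (q + n)))
            = K * C * A * (M n / (h / H) ^ n) * (H * l / h) ^ q).
{ unfold Rdiv; rewrite !Rpow_mult_distr, !Rinv_mult, !pow_add, !pow_inv, !Rinv_inv, Rinv_mult.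
  field; split; [apply pow_nonzero; lra |]; split; [apply pow_nonzero; lra | lra]. }
rewrite E; apply Rmult_le_compat_l.
- apply Rmult_le_pos; [apply Rmult_le_pos; [nra | lra] |].
  left; apply Mh_pos; apply Rdiv_lt_0_compat; lra.
- apply pow_incr; split; [apply Rmult_le_pos; [nra | left; apply Rinv_0_lt_compat; lra] |].
  apply Rmult_le_reg_r with h; [lra |]; unfold Rdiv; rewrite Rmult_assoc, Rinv_l by lra; lra.
Qed.

Lemma ser_bnd A H K l h C b f :
  (forall p q, M (p + q)%nat <= A * H ^ (p + q) * (M p * M q)) ->
  0 < A -> 0 < H -> 0 < K -> 0 < l -> 2 * H * l <= h ->
  coef_bnd K l b -> bnd h C f -> bnd (h / H) (2 * (K * C * A)) (ser b f).
Proof.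
intros HM HA HH HK Hl Hh Hb Hf x n.
destruct (half_sum (K * C * A * (M n / (h / H) ^ n))) as [E1 E2].
eapply Rle_trans;
  [apply (Series_dom _ (fun q => K * C * A * (M n / (h / H) ^ n) * (/ 2) ^ q)); [| exact E1] |].
- intros q; apply ser_term with l; auto.
- rewrite E2; right; ring.
Qed.

Lemma ser_cls star b f : coef_cls star b -> jet f -> cls star f ->
  jet (ser b f) /\ cls star (ser b f) /\
  forall n x, ex_series (fun q => b q * f (q + n)%nat x).
Proof.
intros Hb Jf Hf; destruct M2_add as [A [H [HA [HH HM]]]].
assert (Hex : exists K l h C, 0 < K /\ 0 < l /\ 2 * H * l <= h /\ coef_bnd K l b /\ bnd h C f).
{ destruct star; simpl in *.
  - destruct Hb as [l [K [Hl [HK Hb]]]]; destruct (Hf (2 * H * l)) as [C HC]; [nra |].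
    exists K, l, (2 * H * l), C; split; [lra | split; [lra | split; [lra | split; assumption]]].
  - destruct Hf as [h [C [Hh HC]]]; destruct (Hb (h / (2 * H))) as [K [HK Hb']].
    { apply Rdiv_lt_0_compat; lra. }
    exists K, (h / (2 * H)), h, C; split; [exact HK |].
    split; [apply Rdiv_lt_0_compat; lra |]; split; [right; field; lra | split; assumption]. }
destruct Hex as [K [l [h [C [HK [Hl [Hh [Hb' Hf']]]]]]]].
assert (Ht : forall n q x, Rabs (b q * f (q + n)%nat x)
               <= K * C * A * (M n / (h / H) ^ n) * (/ 2) ^ q).
{ intros n q x; apply ser_term with l; auto; lra. }
split; [| split].
- apply jet_ser; [exact Jf |]; intros n; eexists; split; [| intros q x; apply Ht].
  apply half_sum.
- destruct star; simpl in *.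
  + intros h' Hh'; clear K l Hb' HK Hl Hh Ht.
    destruct Hb as [l [K [Hl [HK Hb]]]].
    (* Large enough for the series to converge, k >= 2 H l, and to keep the index h' after division
       by H. *)
    set (k := 2 * H * l + H * h').
    assert (Hk : 0 < k) by (unfold k; nra).
    destruct (Hf k Hk) as [D HD]; exists (2 * (K * D * A)); intros x.
    apply bnd_at_anti with (k / H); [lra | |].
    * apply Rmult_le_reg_r with H; [lra |].
      unfold Rdiv; rewrite Rmult_assoc, Rinv_l by lra; unfold k; nra.
    * apply (ser_bnd A H K l k D b f); auto; try lra; unfold k; nra.
  + exists (h / H), (2 * (K * C * A)); split; [apply Rdiv_lt_0_compat; nra |].
    apply ser_bnd with l; auto; lra.
- intros n x; apply ex_series_dom with (fun q => K * C * A * (M n / (h / H) ^ n) * (/ 2) ^ q).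
  + intros q; apply Ht.
  + apply half_sum.
Qed.

Lemma ser_zero b f n x : (forall q, f q x = 0) -> ser b f n x = 0.
Proof.
intros H; unfold ser; rewrite (Series_ext _ (fun q => 0 * 0)).
- rewrite Series_scal_l; ring.
- intros q; rewrite H; ring.
Qed.

Lemma test_ser star b f : coef_cls star b -> test star f -> test star (ser b f).
Proof.
intros Hb [Jf [Cf [L [HL Sf]]]]; destruct (ser_cls star b f Hb Jf Cf) as [H1 [H2 _]].
split; [exact H1 |]; split; [exact H2 |]; exists L; split; [exact HL |].
intros p x Hx; apply ser_zero; intros q; apply Sf, Hx.
Qed.

(** The coefficient of phi^(p) in the transposed operator: (-1)^p comes from transposition and
    (-i)^p from D = -i d/dx. *)
Definition udo_coef (a : nat -> C) (p : nat) : C :=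
  ((- RtoC 1) ^ p * a p * (- Ci) ^ p)%C.

Lemma Cmod_pow_1 (z : C) p : Cmod z = 1 -> Cmod (z ^ p)%C = 1.
Proof.
intros Hz; induction p as [|p IH]; simpl; [apply Cmod_1 |].
rewrite Cmod_mult, Hz, IH; ring.
Qed.

Lemma Cmod_udo_coef a p : Cmod (udo_coef a p) = Cmod (a p).
Proof.
unfold udo_coef; rewrite !Cmod_mult, !Cmod_pow_1; [ring | |].
- rewrite Cmod_opp; unfold Cmod, Ci; simpl.
  replace (0 * (0 * 1) + 1 * (1 * 1)) with 1 by ring; apply sqrt_1.
- rewrite Cmod_opp; apply Cmod_1.
Qed.

Lemma udo_coef_cls star a : udo_class star M a ->
  coef_cls star (fun p => Re (udo_coef a p)) /\ coef_cls star (fun p => Im (udo_coef a p)).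
Proof.
intros H.
assert (HRI : forall K l, 0 < K -> 0 < l ->
  (forall p, (1 <= p)%nat -> Cmod (a p) <= K * l ^ p / M p) ->
  coef_bnd (K + Cmod (a 0%nat)) l (fun p => Re (udo_coef a p)) /\
  coef_bnd (K + Cmod (a 0%nat)) l (fun p => Im (udo_coef a p))).
{ intros K l HK Hl Ha.
  assert (Hc : forall p, Cmod (udo_coef a p) <= (K + Cmod (a 0%nat)) * (l ^ p / M p)).
  { intros p; rewrite Cmod_udo_coef; pose proof (Cmod_ge_0 (a 0%nat)).
    destruct p as [|p]; [simpl; rewrite M_0; lra |].
    eapply Rle_trans; [apply Ha; lia |].
    assert (0 < l ^ S p / M (S p)) by (apply Rdiv_lt_0_compat; [apply pow_lt, Hl | apply M_pos]).
    unfold Rdiv in *; rewrite Rmult_assoc; nra. }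
  split; intros p; (eapply Rle_trans; [| apply Hc]);
    (eapply Rle_trans; [| apply Rmax_Cmod]); [apply Rmax_l | apply Rmax_r]. }
destruct star; simpl in *.
- destruct H as [l [K [Hl [HK Ha]]]]; destruct (HRI K l HK Hl Ha) as [H1 H2].
  pose proof (Cmod_ge_0 (a 0%nat)).
  split; exists l, (K + Cmod (a 0%nat)); (split; [lra | split; [lra | assumption]]).
- split; intros l Hl; destruct (H l Hl) as [K [HK Ha]];
    destruct (HRI K l HK Hl Ha) as [H1 H2]; pose proof (Cmod_ge_0 (a 0%nat));
    exists (K + Cmod (a 0%nat)); split; auto; lra.
Qed.

Definition udo_re (c : nat -> C) (f g : nat -> R -> R) (p : nat) (x : R) : R :=
  1 * ser (fun q => Re (c q)) f p x + -1 * ser (fun q => Im (c q)) g p x.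

Definition udo_im (c : nat -> C) (f g : nat -> R -> R) (p : nat) (x : R) : R :=
  1 * ser (fun q => Re (c q)) g p x + 1 * ser (fun q => Im (c q)) f p x.

Lemma test_udo star c f g :
  coef_cls star (fun p => Re (c p)) -> coef_cls star (fun p => Im (c p)) ->
  test star f -> test star g -> test star (udo_re c f g) /\ test star (udo_im c f g).
Proof. intros; split; apply test_lin; apply test_ser; assumption. Qed.

Lemma udo_pair star a f g : udo_class star M a -> test star f -> test star g ->
  (fun x => CSeries (fun p =>
     (- RtoC 1) ^ p * a p * ((- Ci) ^ p * deriv (cpair f g) p x))%C)
  = cpair (udo_re (udo_coef a) f g) (udo_im (udo_coef a) f g).
Proof.
intros Ha Tf Tg; destruct (udo_coef_cls star a Ha) as [Hr Hi].
destruct Tf as [Jf [Cf _]]; destruct Tg as [Jg [Cg _]].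
apply functional_extensionality; intros x; unfold CSeries, cpair.
destruct (ser_cls star _ f Hr Jf Cf) as [_ [_ E1]].
destruct (ser_cls star _ g Hi Jg Cg) as [_ [_ E2]].
destruct (ser_cls star _ g Hr Jg Cg) as [_ [_ E3]].
destruct (ser_cls star _ f Hi Jf Cf) as [_ [_ E4]].
specialize (E1 0%nat x); specialize (E2 0%nat x); specialize (E3 0%nat x); specialize (E4 0%nat x).
assert (Et : forall p, ((- RtoC 1) ^ p * a p * ((- Ci) ^ p * deriv (cpair f g) p x))%C
  = (Re (udo_coef a p) * f (p + 0)%nat x - Im (udo_coef a p) * g (p + 0)%nat x,
     Re (udo_coef a p) * g (p + 0)%nat x + Im (udo_coef a p) * f (p + 0)%nat x)).
{ intros p; rewrite Cmult_assoc, (deriv_pair f g p x Jf Jg), Nat.add_0_r; reflexivity. }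
f_equal.
- rewrite (Series_ext _ (fun p => Re (udo_coef a p) * f (p + 0)%nat x
                                  - Im (udo_coef a p) * g (p + 0)%nat x))
    by (intros p; rewrite Et; reflexivity).
  rewrite Series_minus by assumption; unfold udo_re, ser; ring.
- rewrite (Series_ext _ (fun p => Re (udo_coef a p) * g (p + 0)%nat x
                                  + Im (udo_coef a p) * f (p + 0)%nat x))
    by (intros p; rewrite Et; reflexivity).
  rewrite Series_plus by assumption; unfold udo_im, ser; ring.
Qed.

(** * Reflected translates and stability under P(D) *)

Definition refl (x : R) (f : nat -> R -> R) (p : nat) (t : R) : R :=
  (-1) ^ p * f p (-1 * t + x).

Lemma test_refl star x f : test star f -> test star (refl x f).
Proof. apply test_affine; lra. Qed.

Lemma pair_refl f g x : (fun t => cpair f g (x - t)) = cpair (refl x f) (refl x g).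
Proof.
apply functional_extensionality; intros t; unfold cpair, refl; simpl.
rewrite !Rmult_1_l; replace (-1 * t + x) with (x - t) by ring; reflexivity.
Qed.

Lemma ser_refl b f x t :
  ser b (refl x f) 0 t = ser (fun q => (-1) ^ q * b q) f 0 (-1 * t + x).
Proof.
unfold ser, refl; apply Series_ext; intros q; rewrite Nat.add_0_r; ring.
Qed.

Variable X : CompleteNormedModule C_AbsRing.

Lemma AA_udo star (T f g : (R -> C) -> X) a :
  ultradistribution star M T -> udo_class star M a ->
  D'_AA star M f -> D'_AA star M g ->
  ud_eq star M T (ud_plus (udo_apply a f) g) -> D'_AA star M T.
Proof.
intros HT Ha [_ Hf] [_ Hg] HE; split; [exact HT |]; intros phi Hphi.
destruct (D_star_elim star phi Hphi) as [u [v [-> [Tu Tv]]]].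
assert (Hc := udo_coef_cls star a Ha).
(* Each derivative of t -> phi (x - t) brings a sign, which cancels the sign of transposition: the
   operator with coefficients c is P(D) itself, acting on phi. *)
set (c := fun p => (RtoC ((-1) ^ p) * udo_coef a p)%C).
assert (Hsgn : forall p, Rabs ((-1) ^ p) = 1) by (intros p; apply pow_1_abs).
assert (Hcls : forall b, coef_cls star b -> coef_cls star (fun p => (-1) ^ p * b p)).
{ intros b Hb; assert (E : forall K l, coef_bnd K l b -> coef_bnd K l (fun p => (-1) ^ p * b p)).
  { intros K l H q; rewrite Rabs_mult, Hsgn, Rmult_1_l; apply H. }
  destruct star; simpl in *.
  - destruct Hb as [l [K [Hl [HK Hb]]]]; exists l, K; auto.
  - intros l Hl; destruct (Hb l Hl) as [K [HK H]]; exists K; auto. }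
assert (Er : forall p, Re (c p) = (-1) ^ p * Re (udo_coef a p))
  by (intros p; unfold c, Re, RtoC, Cmult; simpl; ring).
assert (Ei : forall p, Im (c p) = (-1) ^ p * Im (udo_coef a p))
  by (intros p; unfold c, Im, RtoC, Cmult; simpl; ring).
assert (Hcr : coef_cls star (fun p => Re (c p))).
{ rewrite (functional_extensionality _ _ Er); apply Hcls, Hc. }
assert (Hci : coef_cls star (fun p => Im (c p))).
{ rewrite (functional_extensionality _ _ Ei); apply Hcls, Hc. }
destruct (test_udo star c u v Hcr Hci Tu Tv) as [TU TV].
set (U := udo_re c u v) in *; set (V := udo_im c u v) in *.
assert (E : conv T (cpair u v)
            = fun x => plus (conv f (cpair U V) x) (conv g (cpair u v) x)).
{ apply functional_extensionality; intros x; unfold conv.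
  rewrite !pair_refl, HE by (apply D_star_pair; apply test_refl; assumption).
  unfold ud_plus; f_equal; unfold udo_apply.
  rewrite (udo_pair star) by (auto using test_refl).
  f_equal; apply functional_extensionality; intros t; unfold cpair; f_equal.
  - unfold U, udo_re at 1; rewrite !ser_refl; unfold refl, udo_re; simpl pow.
    rewrite (functional_extensionality _ _ Er), (functional_extensionality _ _ Ei); ring.
  - unfold V, udo_im at 1; rewrite !ser_refl; unfold refl, udo_im; simpl pow.
    rewrite (functional_extensionality _ _ Er), (functional_extensionality _ _ Ei); ring. }
rewrite E; apply AA_plus; [apply Hf, D_star_pair; assumption | apply Hg, Hphi].
Qed.

(** * Bumps, cutoffs and convolutions *)

Lemma bump_of_nonzero f x0 : test Beurling f -> f 0%nat x0 <> 0 ->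
  exists rho r, test Beurling rho /\ 0 < r /\ supp_in r rho /\
    (forall x, 0 <= rho 0%nat x) /\ RInt (rho 0%nat) (- r) r = 1.
Proof.
intros Tf Hx0; pose proof (test_mul _ f f Tf Tf) as Tff.
destruct (test_supp _ f Tf) as [L [HL Sf]].
set (g := fun n => jmul n f f) in *.
assert (Sg : supp_in (L + 1) g).
{ intros p x Hx; apply jmul_0_l; intros q; apply Sf; lra. }
assert (Hg : forall x, 0 <= g 0%nat x) by (intros x; unfold g; simpl; nra).
assert (Cg : forall x, continuous (g 0%nat) x) by (apply jet_cont, (test_jet _ _ Tff)).
assert (Hg0 : 0 < g 0%nat x0) by (unfold g; simpl; nra).
assert (Hx0L : Rabs x0 <= L).
{ apply Rnot_lt_le; intros H; apply Hx0, Sf, H. }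
apply Rabs_le_between in Hx0L.
destruct (proj1 (cont_dist (X := R_NormedModule) (g 0%nat) x0) (Cg x0) (g 0%nat x0) Hg0)
  as [d [Hd Hd']].
(* Small enough for g to be positive around x0 and for the interval to stay inside [-(L+1), L+1]. *)
set (d' := Rmin d 1 / 2).
assert (Hd1 : 0 < d' /\ d' < d /\ d' < 1).
{ unfold d'; pose proof (Rmin_l d 1); pose proof (Rmin_r d 1).
  assert (0 < Rmin d 1) by (apply Rmin_glb_lt; lra); lra. }
assert (Ex : forall u v, ex_RInt (g 0%nat) u v) by (intros; apply ex_RInt_cont, Cg).
set (I := RInt (g 0%nat) (- (L + 1)) (L + 1)).
assert (HI : 0 < I).
{ unfold I; rewrite <- (RInt_ChaslesR _ _ (x0 - d') _), <- (RInt_ChaslesR _ (x0 - d') (x0 + d') _)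
    by apply Ex.
  assert (0 <= RInt (g 0%nat) (- (L + 1)) (x0 - d')) by (apply RInt_ge_0; auto; lra).
  assert (0 <= RInt (g 0%nat) (x0 + d') (L + 1)) by (apply RInt_ge_0; auto; lra).
  assert (0 < RInt (g 0%nat) (x0 - d') (x0 + d')); [| lra].
  apply RInt_gt_0; [lra | | intros; apply Cg].
  intros x Hx; assert (Hxd : Rabs (x - x0) < d) by (apply Rabs_lt_between; lra).
  specialize (Hd' x Hxd); change (Rabs (g 0%nat x - g 0%nat x0) < g 0%nat x0) in Hd'.
  apply Rabs_lt_between in Hd'; lra. }
exists (fun p x => / I * g p x + 0 * g p x), (L + 1).
assert (HI' : 0 < / I) by (apply Rinv_0_lt_compat, HI).
split; [apply test_lin; exact Tff |]; split; [lra |]; split; [| split].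
- intros p x Hx; rewrite Sg by exact Hx; ring.
- intros x; specialize (Hg x); nra.
- rewrite (proj2 (RInt_linR _ _ (/ I) 0 _ _ (Ex _ _) (Ex _ _))).
  fold I; rewrite Rmult_0_l, Rplus_0_r; apply Rinv_l; lra.
Qed.

Lemma nonzero_bump : (exists phi x, D_star Beurling M phi /\ phi x <> 0%C) ->
  exists rho r, test Beurling rho /\ 0 < r /\ supp_in r rho /\
    (forall x, 0 <= rho 0%nat x) /\ RInt (rho 0%nat) (- r) r = 1.
Proof.
intros [phi [x0 [Hphi Hx0]]].
destruct (D_star_elim Beurling phi Hphi) as [f [g [-> [Tf Tg]]]].
destruct (Req_dec (f 0%nat x0) 0) as [E | E].
- apply (bump_of_nonzero g x0 Tg); intros E'; apply Hx0; unfold cpair; rewrite E, E'; reflexivity.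
- apply (bump_of_nonzero f x0 Tf E).
Qed.

Lemma RInt_supp (f : R -> R) r u v : 0 < r -> (forall x, continuous f x) ->
  (forall x, r < Rabs x -> f x = 0) ->
  (u <= - r /\ r <= v -> RInt f u v = RInt f (- r) r) /\
  (v <= - r \/ r <= u -> u <= v -> RInt f u v = 0).
Proof.
intros Hr Cf Hz.
assert (Ex : forall u v, ex_RInt f u v) by (intros; apply ex_RInt_cont, Cf).
assert (H0 : forall s t, s <= t -> t <= - r \/ r <= s -> RInt f s t = 0).
{ intros s t Hst Hor; apply RInt_zeroR; [lra |]; intros x Hx; apply Hz.
  destruct Hor; [rewrite Rabs_left1; lra | rewrite Rabs_pos_eq; lra]. }
split; intros H; [| intros; apply H0; tauto].
rewrite <- (RInt_ChaslesR f u (- r) v), <- (RInt_ChaslesR f (- r) r v) by apply Ex.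
rewrite (H0 u (- r)), (H0 r v) by lra; rewrite Rplus_0_l, Rplus_0_r; reflexivity.
Qed.

Definition one_jet (p : nat) (x : R) : R := match p with O => 1 | _ => 0 end.

Lemma jet_one : jet one_jet.
Proof. intros [|p] x; [apply (is_derive_const 1) | apply (is_derive_const 0)]. Qed.

Lemma cls_one : cls Beurling one_jet.
Proof.
intros h Hh; exists 1; intros x [|p]; simpl.
- rewrite M_0, Rabs_R1; lra.
- rewrite Rabs_R0; pose proof (Mh_pos h (S p) Hh) as H; simpl in H; lra.
Qed.

(** chi (x) is the integral of rho over [x - L, x + L]. As L = r + 3, this window contains [-r, r]
    when |x| <= 2, and it misses it when |x| > L + r. The derivative of order p + 1 is a difference
    of translates of rho^(p), whose bound is shifted by M_p <= M_{p+1} / M_1. *)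
Lemma cutoff_of_bump rho r : test Beurling rho -> 0 < r -> supp_in r rho ->
  RInt (rho 0%nat) (- r) r = 1 ->
  exists chi, test Beurling chi /\
    forall x, Rabs x <= 2 -> chi 0%nat x = 1 /\ forall p, chi (S p) x = 0.
Proof.
intros [Jr [Cr _]] Hr Sr Hint; set (L := r + 3).
pose proof (jet_cont rho Jr 0) as C0.
set (Psi := fun x => RInt (rho 0%nat) 0 x).
assert (DPsi : forall x, is_derive Psi x (rho 0%nat x)).
{ intros x; apply (is_derive_RInt (V := R_NormedModule) (rho 0%nat) Psi 0 x).
  - exists (mkposreal 1 Rlt_0_1); intros y _.
    apply (@RInt_correct R_CompleteNormedModule), ex_RInt_cont, C0.
  - apply C0. }
set (chi := fun p x => match p with
                       | O => Psi (x + L) - Psi (x - L)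
                       | S q => rho q (x + L) - rho q (x - L) end).
assert (Dsh : forall (f f' : R -> R) c x, (forall x, is_derive f x (f' x)) ->
          is_derive (fun x => f (x + c)) x (f' (x + c))).
{ intros f f' c x Hf; eapply is_derive_eq.
  - apply (is_derive_comp f (fun x => x + c)); [apply Hf |].
    apply (is_derive_plus (fun x : R => x) (fun _ => c)); [apply is_derive_id | apply is_derive_const].
  - unfold scal, plus, zero, one; simpl; unfold mult; simpl; ring. }
assert (Jchi : jet chi).
{ intros p x; destruct p as [|p]; simpl.
  - apply (is_derive_minus (fun x => Psi (x + L)) (fun x => Psi (x + - L)));
      apply Dsh, DPsi.
  - apply (is_derive_minus (fun x => rho p (x + L)) (fun x => rho p (x + - L)));
      apply Dsh; intros; apply Jr. }
assert (Echi : forall x, chi 0%nat x = RInt (rho 0%nat) (x - L) (x + L)).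
{ intros x; unfold chi, Psi.
  rewrite <- (RInt_ChaslesR _ 0 (x - L) (x + L)) by (apply ex_RInt_cont, C0).
  assert (E : forall a b : R, a + b - a = b) by (intros; ring); apply E. }
pose proof (fun u v => RInt_supp (rho 0%nat) r u v Hr C0 (Sr 0%nat)) as HS.
exists chi; split; [split; [exact Jchi |]; split |].
- intros h Hh; destruct (Cr h Hh) as [C HC].
  pose proof (bnd_at_C_pos h C rho 0 Hh (HC 0)) as HCp.
  pose proof (M_pos 1) as M1; pose proof (Rinv_0_lt_compat _ M1) as M1'.
  exists (2 * L * C + 2 * C * (h * / M 1%nat)); intros x [|p].
  + rewrite Echi; simpl pow; rewrite M_0.
    eapply Rle_trans; [apply (abs_RInt_le_const _ (x - L) (x + L) C) |].
    * unfold L; lra.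
    * apply ex_RInt_cont, C0.
    * intros t _; specialize (HC t 0%nat); simpl in HC; rewrite M_0 in HC; lra.
    * assert (0 <= 2 * C * (h * / M 1%nat)) by (apply Rmult_le_pos; nra).
      unfold L; lra.
  + simpl chi; unfold Rminus; eapply Rle_trans; [apply Rabs_triang |]; rewrite Rabs_Ropp.
    pose proof (HC (x + L) p); pose proof (HC (x + - L) p).
    pose proof (M_le_S p) as HM.
    assert (Hp : M p / h ^ p <= h * / M 1%nat * (M (S p) / h ^ S p)).
    { replace (h * / M 1%nat * (M (S p) / h ^ S p)) with (/ M 1%nat * M (S p) / h ^ p).
      - apply Rmult_le_compat_r; [left; apply Rinv_0_lt_compat, pow_lt, Hh | exact HM].
      - simpl; field; repeat split; try lra; apply pow_nonzero; lra. }
    pose proof (Mh_pos h (S p) Hh).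
    apply Rle_trans with (2 * C * (h * / M 1%nat * (M (S p) / h ^ S p))); [nra |].
    assert (0 <= 2 * L * C * (M (S p) / h ^ S p)).
    { apply Rmult_le_pos; [unfold L; nra | lra]. }
    lra.
- exists (L + r); split; [unfold L; lra |].
  refine (jet_vanish chi (L + r) Jchi _); intros x Hx; rewrite Echi.
  apply (proj2 (HS (x - L) (x + L))); [| unfold L; lra].
  revert Hx; unfold L, Rabs; destruct Rcase_abs; lra.
- intros x Hx; apply Rabs_le_between in Hx; split.
  + rewrite Echi, (proj1 (HS (x - L) (x + L))); [exact Hint | unfold L; lra].
  + intros p; simpl; rewrite !Sr; [ring | |]; unfold L.
    * rewrite Rabs_left; lra.
    * rewrite Rabs_pos_eq; lra.
Qed.

(** All derivatives fall on f, whose class is inherited; u is merely bounded and continuous, as the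
    parametrix is. *)
Lemma test_cnv star u k L U f : 0 < L -> (forall x : R, continuous u x) ->
  (forall x, Rabs (u x) <= U) -> test star f -> test star (cnv u k (- L) L f).
Proof.
intros HL Cu HU Tf; pose proof Tf as [Jf [Cf [N [HN Sf]]]].
pose proof (jet_cont f Jf) as Cfc.
assert (HU0 : 0 <= U) by (eapply Rle_trans; [apply Rabs_pos | apply (HU 0)]).
split; [apply jet_cnv with U; auto; [lra | apply (test_bounded star f Tf)] |]; split.
- assert (Hb : forall h C, bnd h C f -> bnd h (2 * L * U * C) (cnv u k (- L) L f)).
  { intros h C H x p.
    eapply Rle_trans; [apply (cnv_le u k (- L) L f p x U (C * (M p / h ^ p))); auto; [lra |] |].
    - intros y; apply H.
    - right; ring. }
  destruct star; simpl in *.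
  + intros h Hh; destruct (Cf h Hh) as [C HC]; eexists; apply Hb, HC.
  + destruct Cf as [h [C [Hh HC]]]; exists h; eexists; split; [exact Hh | apply Hb, HC].
- exists (N + Rabs k * L); split; [pose proof (Rabs_pos k); nra |].
  intros p x Hx; unfold cnv; apply RInt_zeroR; [lra |]; intros s Hs; rewrite Sf; [apply Rmult_0_r |].
  pose proof (Rabs_triang_inv x (- (k * s))) as H; rewrite Rabs_Ropp, Rabs_mult in H.
  replace (x - - (k * s)) with (k * s + x) in H by ring.
  assert (Rabs s <= L) by (apply Rabs_le; lra).
  pose proof (Rabs_pos k); nra.
Qed.

Lemma ud_conv_pair (T : (R -> C) -> X) L (u v f g : nat -> R -> R) : 0 < L ->
  jet u -> jet v -> supp_in L u -> supp_in L v -> jet f -> jet g ->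
  ud_conv T (cpair u v) (cpair f g)
  = T (cpair (fun p t => 1 * cnv (u 0%nat) 1 (- L) L f p t + -1 * cnv (v 0%nat) 1 (- L) L g p t)
            (fun p t => 1 * cnv (u 0%nat) 1 (- L) L g p t + 1 * cnv (v 0%nat) 1 (- L) L f p t)).
Proof.
intros HL Ju Jv Su Sv Jf Jg; unfold ud_conv; f_equal.
apply functional_extensionality; intros t.
pose proof (jet_cont _ Ju 0) as Cu; pose proof (jet_cont _ Jv 0) as Cv.
pose proof (jet_cont _ Jf 0) as Cf; pose proof (jet_cont _ Jg 0) as Cg.
assert (Cc : forall (a b : R -> R) y, (forall x, continuous a x) -> (forall x, continuous b x) ->
          continuous (fun s => a s * b (1 * s + t)) y).
{ intros a b y Ha Hb; apply cont_mult; [apply Ha | apply cont_affine, Hb]. }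
assert (Ex : forall (a b : R -> R), (forall x, continuous a x) -> (forall x, continuous b x) ->
          ex_RInt (fun s => a s * b (1 * s + t)) (- L) L).
{ intros a b Ha Hb; apply ex_RInt_cont; intros; apply Cc; assumption. }
transitivity (integral (V := C_R_CompleteNormedModule)
  (fun s => (1 * (u 0%nat s * f 0%nat (1 * s + t)) + -1 * (v 0%nat s * g 0%nat (1 * s + t)),
             1 * (u 0%nat s * g 0%nat (1 * s + t)) + 1 * (v 0%nat s * f 0%nat (1 * s + t))))).
{ f_equal; apply functional_extensionality; intros s; unfold cpair, Cmult; simpl.
  replace (1 * s + t) with (t + s) by ring; f_equal; ring. }
assert (Cl : forall c d (a b : R -> R) y, (forall x, continuous a x) -> (forall x, continuous b x) ->
          continuous (fun s => c * a s + d * b s) y).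
{ intros c d a b y Ha Hb; apply (continuous_plus (fun s => c * a s) (fun s => d * b s)).
  - apply (continuous_scal_r c a), Ha.
  - apply (continuous_scal_r d b), Hb. }
rewrite (integral_C_compact _ _ L HL).
- unfold cpair, cnv; f_equal; apply RInt_linR; auto.
- intros; apply (Cl 1 (-1) (fun s => u 0%nat s * f 0%nat (1 * s + t))
    (fun s => v 0%nat s * g 0%nat (1 * s + t))); auto.
- intros; apply (Cl 1 1 (fun s => u 0%nat s * g 0%nat (1 * s + t))
    (fun s => v 0%nat s * f 0%nat (1 * s + t))); auto.
- intros x Hx; rewrite Su, Sv by exact Hx; split; ring.
Qed.

(** * The operator P_l(D) *)

Section Symbol.

Variable l : R.
Hypothesis l_pos : 0 < l.

(** P_l vanishes at plus or minus i times these numbers; index 0 stands for the factor 1 + x^2. *)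
Definition zeros (n : nat) : R := match n with O => 1 | S k => l * m_ M (S k) end.

Lemma m_ratio k : m_ M (S k) = ratio k.
Proof. unfold m_, ratio; replace (S k - 1)%nat with k by lia; reflexivity. Qed.

Lemma zeros_pos n : 0 < zeros n.
Proof.
destruct n as [|n]; simpl; [lra |].
rewrite m_ratio; apply Rmult_lt_0_compat; [exact l_pos | apply ratio_pos].
Qed.

Lemma bd_zeros p : bd zeros p = l ^ p * M p.
Proof.
induction p as [|p IH]; [simpl; rewrite M_0; ring |].
cbn [bd]; rewrite IH, M_S; simpl; rewrite m_ratio; ring.
Qed.

Definition ez (n : nat) : R := / zeros n ^ 2.

Lemma ez_pos n : 0 < ez n.
Proof. apply Rinv_0_lt_compat, pow_lt, zeros_pos. Qed.

Lemma ez_S k : ez (S k) = / l ^ 2 * / ratio k ^ 2.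
Proof. unfold ez; simpl zeros; rewrite m_ratio, Rpow_mult_distr, Rinv_mult; reflexivity. Qed.

Lemma inv_ratio k : / ratio k = M k / M (S k).
Proof. unfold ratio; apply Rinv_div. Qed.

Lemma ez_sum : ex_series ez.
Proof.
apply ex_series_incr_1.
apply ex_series_dom with (fun k => / l ^ 2 * / ratio 0 * (M k / M (S k))).
- intros k; rewrite Rabs_pos_eq by (left; apply ez_pos); rewrite ez_S, <- inv_ratio.
  pose proof (ratio_pos 0); pose proof (ratio_pos k); pose proof (ratio_mono 0 k ltac:(lia)).
  replace (/ ratio k ^ 2) with (/ ratio k * / ratio k) by (field; lra).
  rewrite Rmult_assoc; apply Rmult_le_compat_l; [left; apply Rinv_0_lt_compat, pow_lt, l_pos |].
  apply Rmult_le_compat_r; [left; apply Rinv_0_lt_compat; lra | apply Rinv_le_contravar; lra].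
- apply (ex_series_scal_l (/ l ^ 2 * / ratio 0) (fun k => M k / M (S k))), M_3'.
Qed.

Hypothesis M_3 : cond_M3 M.

(** The quotient is k times the i-th term of (M.3); the terms being positive, a partial sum is at
    most the series. *)
Lemma ratio_tail : exists B, 0 <= B /\ forall k n, (1 <= k)%nat ->
  sum_f_R0 (fun i => ratio k / ratio (k + i)) n <= INR k * B.
Proof.
destruct M_3 as [B HB]; exists (Rmax 0 B); split; [apply Rmax_l |]; intros k n Hk.
destruct (HB k Hk) as [Hex Hle].
set (u := fun i => M (k + i)%nat * M (k + 1)%nat / (INR k * M k * M (k + 1 + i)%nat)) in *.
assert (Hk0 : 0 < INR k) by (apply lt_0_INR; lia).
assert (Eu : forall i, ratio k / ratio (k + i) = INR k * u i).
{ intros i; unfold u, ratio.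
  replace (k + 1)%nat with (S k) by lia; replace (S k + i)%nat with (S (k + i)) by lia.
  pose proof (M_pos k); pose proof (M_pos (S k)); pose proof (M_pos (k + i));
    pose proof (M_pos (S (k + i))); field; repeat split; lra. }
assert (Hu : forall i, 0 <= u i).
{ intros i; apply Rmult_le_reg_l with (INR k); [exact Hk0 |]; rewrite Rmult_0_r, <- Eu.
  left; apply Rdiv_lt_0_compat; apply ratio_pos. }
apply Rle_trans with (INR k * Series u).
- rewrite (sum_eq _ (fun i => u i * INR k)) by (intros; rewrite Eu; ring).
  rewrite <- scal_sum; apply Rmult_le_compat_l; [lra |].
  rewrite (Series_incr_n u (S n)) by (lia || exact Hex); simpl pred.
  enough (0 <= Series (fun i => u (S n + i)%nat)) by lra.
  rewrite <- (Rmult_0_l (Series (fun i => u (S n + i)%nat))), <- Series_scal_l.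
  apply Series_le; [intros i; pose proof (Hu (S n + i)%nat); lra |].
  exact (proj1 (ex_series_incr_n u (S n)) Hex).
- apply Rmult_le_compat_l; [lra |]; eapply Rle_trans; [exact Hle | apply Rmax_r].
Qed.

Lemma prd_step_le e n m y : (forall k, 0 <= e k) -> 0 <= y -> (n <= m)%nat -> prd e n y <= prd e m y.
Proof.
intros He Hy; induction 1 as [|m Hm IH]; [lra |]; simpl.
pose proof (He m); pose proof (prd_ge_1 e He m y Hy); assert (0 <= e m * y) by nra; nra.
Qed.

(* The coefficients of [P_l] are estimated by Cauchy's inequality at [l m_{k+1}]:
   the factors with [i < k] are at most twice their leading term, and (M.3) bounds
   the product of the others by a geometric sequence. *)
Lemma prd_ratio B k n : (1 <= k)%nat ->
  (forall k n, (1 <= k)%nat -> sum_f_R0 (fun i => ratio k / ratio (k + i)) n <= INR k * B) ->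
  prd ez n ((l * ratio k) ^ 2)
  <= (1 + (l * ratio k) ^ 2) * (2 ^ k * (ratio k ^ (2 * k) / M k ^ 2) * exp (INR k * B)).
Proof.
intros Hk HB; set (y := (l * ratio k) ^ 2).
assert (Hy : 0 <= y) by apply pow2_ge_0.
pose proof (ratio_pos k) as Hrk.
assert (Ey : forall i, ez (S i) * y = (ratio k / ratio i) ^ 2).
{ intros i; rewrite ez_S; unfold y; pose proof (ratio_pos i); field; lra. }
assert (H1 : forall j, (j <= k)%nat ->
  prd ez (S j) y <= (1 + y) * (2 ^ j * (ratio k ^ (2 * j) / M j ^ 2))).
{ induction j as [|j IH]; intros Hj.
  - simpl; unfold ez; simpl; rewrite M_0; right; field.
  - change (prd ez (S (S j)) y) with (prd ez (S j) y * (1 + ez (S j) * y)).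
    rewrite Ey; specialize (IH ltac:(lia)).
    pose proof (ratio_pos j) as Hrj; pose proof (ratio_mono j k ltac:(lia)) as Hm.
    pose proof (M_pos j).
    assert (Hq : 1 <= (ratio k / ratio j)).
    { apply Rmult_le_reg_r with (ratio j); [lra |].
      unfold Rdiv; rewrite Rmult_assoc, Rinv_l; lra. }
    apply Rle_trans with ((1 + y) * (2 ^ j * (ratio k ^ (2 * j) / M j ^ 2))
                          * (2 * (ratio k / ratio j) ^ 2)).
    + apply Rmult_le_compat; [| nra | exact IH | nra].
      pose proof (prd_ge_1 ez (fun k => Rlt_le _ _ (ez_pos k)) (S j) y Hy); lra.
    + right; rewrite M_S; replace (2 * S j)%nat with (S (S (2 * j))) by lia; simpl pow.
      field; lra. }
assert (H2 : forall j, prd ez (S (k + j)) y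
  <= (1 + y) * (2 ^ k * (ratio k ^ (2 * k) / M k ^ 2))
     * exp (match j with O => 0 | S j => sum_f_R0 (fun i => ratio k / ratio (k + i)) j end)).
{ induction j as [|j IH].
  - rewrite exp_0, Rmult_1_r, Nat.add_0_r; apply H1; lia.
  - replace (S (k + S j)) with (S (S (k + j))) by lia.
    change (prd ez (S (S (k + j))) y) with (prd ez (S (k + j)) y * (1 + ez (S (k + j)) * y)).
    rewrite Ey.
    set (q := ratio k / ratio (k + j)).
    assert (Hq : 0 < q <= 1).
    { unfold q; pose proof (ratio_pos (k + j)); pose proof (ratio_mono k (k + j) ltac:(lia)).
      split; [apply Rdiv_lt_0_compat; lra |].
      apply Rmult_le_reg_r with (ratio (k + j)); [lra |].
      unfold Rdiv; rewrite Rmult_assoc, Rinv_l; lra. }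
    (* Since q <= 1, the square is at most q. The product of the later factors is thereby bounded by
       the exponential of a sum of the kind in (M.3). *)
    assert (Hexp : 1 + q ^ 2 <= exp q).
    { pose proof (exp_ineq1_le q); nra. }
    assert (Es : forall s, exp (match j with O => 0 | S j => s j end + q)
                 = exp (match j with O => 0 | S j => s j end) * exp q)
      by (intros; apply exp_plus).
    replace (sum_f_R0 (fun i => ratio k / ratio (k + i)) j)
      with (match j with O => 0 | S j => sum_f_R0 (fun i => ratio k / ratio (k + i)) j end + q)
      by (unfold q; destruct j; simpl; ring).
    rewrite (Es (fun j => sum_f_R0 (fun i => ratio k / ratio (k + i)) j)), <- Rmult_assoc.
    apply Rmult_le_compat; [| nra | exact IH | exact Hexp].
    pose proof (prd_ge_1 ez (fun k => Rlt_le _ _ (ez_pos k)) (S (k + j)) y Hy); lra. }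
eapply Rle_trans; [apply (prd_step_le ez n (S (k + S n)));
  [intros; left; apply ez_pos | exact Hy | lia] |].
eapply Rle_trans; [apply H2 |].
rewrite <- (Rmult_assoc (1 + y) (2 ^ k * (ratio k ^ (2 * k) / M k ^ 2))).
apply Rmult_le_compat_l.
- pose proof (M_pos k); apply Rmult_le_pos; [lra |]; apply Rmult_le_pos.
  + apply pow_le; lra.
  + left; apply Rdiv_lt_0_compat; apply pow_lt; lra.
- apply exp_le, HB, Hk.
Qed.

(** Dividing [prd_ratio] by (l m_{k+1})^(2k) cancels the powers of the ratio and leaves 1 / M_k^2,
    which (M.2) replaces by A H^(2k) / M_{2k}. Again by (M.2), 1 + (l m_{k+1})^2 <= K0 H^(2k). The
    constant Q gathers the geometric factors. *)
Lemma coef_ez_bound : exists K L, 0 < K /\ 0 < L /\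
  forall n q, coef ez n q <= K * (L ^ q / M q).
Proof.
destruct ratio_tail as [B [HB0 HB]]; destruct M2_add as [A [H [HA [HH HM]]]].
set (K0 := 1 + (l * (A * H * M 1%nat)) ^ 2).
set (Q := 2 * exp B * H ^ 4 / l ^ 2).
pose proof (M_pos 1) as HM1.
assert (HQ : 0 < Q).
{ unfold Q; apply Rdiv_lt_0_compat; [| apply pow_lt, l_pos].
  pose proof (exp_pos B); pose proof (pow_lt H 4 ltac:(lra)).
  apply Rmult_lt_0_compat; lra. }
assert (HK0 : 1 <= K0) by (unfold K0; pose proof (pow2_ge_0 (l * (A * H * M 1%nat))); lra).
exists (K0 * A), (Q + 1); split; [nra |]; split; [lra |]; intros n q.
assert (Hpos : forall q, 0 < K0 * A * ((Q + 1) ^ q / M q)).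
{ intros j; apply Rmult_lt_0_compat; [nra |].
  apply Rdiv_lt_0_compat; [apply pow_lt; lra | apply M_pos]. }
destruct (Nat.Even_or_Odd q) as [[k ->] | [k ->]].
2:{ rewrite Nat.add_1_r, coef_odd; left; apply Hpos. }
destruct (Nat.eq_dec k 0) as [-> | Hk].
{ simpl; rewrite M_0; replace (coef ez n 0) with 1.
  - nra.
  - clear; induction n as [|n IH]; simpl; [reflexivity | rewrite <- IH; ring]. }
pose proof (ratio_pos k) as Hr; set (y := l * ratio k).
assert (Hy : 0 < y) by (unfold y; nra).
pose proof (coef_cauchy ez (fun k => Rlt_le _ _ (ez_pos k)) n (2 * k) y (Rlt_le _ _ Hy)) as Hc.
pose proof (prd_ratio B k n ltac:(lia) HB) as Hp; fold y in Hp.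
assert (Hy1 : 1 + y ^ 2 <= K0 * (H ^ k) ^ 2).
{ assert (Hrat : ratio k <= A * H * M 1%nat * H ^ k).
  { pose proof (HM k 1%nat) as H1; rewrite Nat.add_1_r in H1.
    unfold ratio; pose proof (M_pos k).
    apply Rmult_le_reg_r with (M k); [lra |]; unfold Rdiv; rewrite Rmult_assoc, Rinv_l by lra.
    rewrite Rmult_1_r; eapply Rle_trans; [exact H1 |]; right; simpl; ring. }
  assert (HHk : 1 <= H ^ k) by (apply pow_R1_Rle; lra).
  assert (Hyy : y <= l * (A * H * M 1%nat) * H ^ k).
  { unfold y; rewrite Rmult_assoc; apply Rmult_le_compat_l; lra. }
  unfold K0.
  assert (y ^ 2 <= (l * (A * H * M 1%nat) * H ^ k) ^ 2) by (apply pow_incr; lra).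
  rewrite Rpow_mult_distr in H0; nra. }
pose proof (M_pos k) as Mk; pose proof (M_pos (2 * k)) as M2k.
assert (HM2 : / M k ^ 2 <= A * (H ^ k) ^ 2 / M (2 * k)%nat).
{ pose proof (HM k k) as H1; replace (k + k)%nat with (2 * k)%nat in H1 by lia.
  apply Rmult_le_reg_r with (M k ^ 2 * M (2 * k)%nat); [apply Rmult_lt_0_compat; [apply pow_lt |]; lra |].
  replace (/ M k ^ 2 * (M k ^ 2 * M (2 * k)%nat)) with (M (2 * k)%nat) by (field; lra).
  replace (A * (H ^ k) ^ 2 / M (2 * k)%nat * (M k ^ 2 * M (2 * k)%nat))
    with (A * (H ^ k) ^ 2 * M k ^ 2) by (field; lra).
  rewrite <- pow_mult; replace (k * 2)%nat with (2 * k)%nat by lia; lra. }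
assert (Hy2k : 0 < y ^ (2 * k)) by (apply pow_lt, Hy).
apply Rmult_le_reg_r with (y ^ (2 * k)); [exact Hy2k |].
eapply Rle_trans; [exact Hc |]; eapply Rle_trans; [exact Hp |].
pose proof (exp_pos (INR k * B)) as HeB.
assert (EeB : exp (INR k * B) = exp B ^ k).
{ clear; induction k as [|k IH]; [simpl; rewrite Rmult_0_l; apply exp_0 |].
  rewrite S_INR, Rmult_plus_distr_r, exp_plus, IH, Rmult_1_l; simpl; ring. }
apply Rle_trans with (K0 * (H ^ k) ^ 2 *
  (2 ^ k * (ratio k ^ (2 * k) * (A * (H ^ k) ^ 2 / M (2 * k)%nat)) * exp (INR k * B))).
{ pose proof (pow_lt 2 k ltac:(lra)); pose proof (pow_lt (ratio k) (2 * k) Hr).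
  apply Rmult_le_compat; [pose proof (pow2_ge_0 y); lra | | exact Hy1 |].
  - apply Rmult_le_pos; [| lra]; apply Rmult_le_pos; [lra |].
    left; apply Rdiv_lt_0_compat; [lra | apply pow_lt, Mk].
  - apply Rmult_le_compat_r; [lra |]; apply Rmult_le_compat_l; [lra |].
    apply Rmult_le_compat_l; [lra | exact HM2]. }
assert (EQ : K0 * (H ^ k) ^ 2 *
  (2 ^ k * (ratio k ^ (2 * k) * (A * (H ^ k) ^ 2 / M (2 * k)%nat)) * exp (INR k * B))
  = K0 * A * (Q ^ k / M (2 * k)%nat) * y ^ (2 * k)).
{ unfold Q, y; rewrite EeB; unfold Rdiv.
  rewrite !Rpow_mult_distr, pow_inv, <- !pow_mult.
  replace (4 * k)%nat with (k * 2 + k * 2)%nat by lia; rewrite pow_add.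
  field; split; [lra | apply pow_nonzero; lra]. }
rewrite EQ; apply Rmult_le_compat_r; [lra |]; apply Rmult_le_compat_l; [nra |].
apply Rmult_le_compat_r; [left; apply Rinv_0_lt_compat, M2k |].
rewrite pow_mult; apply pow_incr; nra.
Qed.

(** The Taylor coefficients of P_l at 0, identified in [P_coef_csym], obtained as increasing limits
    of those of the partial products. *)
Definition csym (q : nat) : R := real (Lim_seq (fun n => coef ez n q)).

Lemma csym_lim q : is_lim_seq (fun n => coef ez n q) (csym q).
Proof.
destruct coef_ez_bound as [K [L [_ [_ H]]]].
destruct (ex_finite_lim_seq_incr (fun n => coef ez n q) (K * (L ^ q / M q))) as [c Hc].
- intros n; apply coef_incr; intros k; left; apply ez_pos.
- intros n; apply H.
- unfold csym; rewrite (is_lim_seq_unique _ _ Hc); exact Hc.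
Qed.

Lemma csym_bound : exists K L, 0 < K /\ 0 < L /\
  (forall n, coef_bnd K L (coef ez n)) /\ coef_bnd K L csym.
Proof.
destruct coef_ez_bound as [K [L [HK [HL H]]]]; exists K, L; split; [exact HK |].
split; [exact HL |].
assert (Hn : forall n, coef_bnd K L (coef ez n)).
{ intros n q; rewrite Rabs_pos_eq; [apply H |].
  apply coef_pos; intros k; left; apply ez_pos. }
split; [exact Hn |]; intros q.
apply (is_lim_seq_le (fun n => Rabs (coef ez n q)) (fun _ => K * (L ^ q / M q))
         (Rabs (csym q)) (K * (L ^ q / M q))).
- intros n; apply Hn.
- apply (is_lim_seq_abs _ (csym q)), csym_lim.
- apply is_lim_seq_const.
Qed.

Lemma prd_lim x : is_lim_seq (fun n => prd ez n (x ^ 2)) (PSeries csym x).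
Proof.
destruct csym_bound as [K [L [HK [HL [Hn Hc]]]]].
set (t := L * (Rabs x + 1)).
assert (Ht : 0 < t) by (unfold t; pose proof (Rabs_pos x); nra).
destruct (pow_over_M t Ht) as [D [HD Hq]].
assert (Hdom : forall b, coef_bnd K L b -> forall q, Rabs (b q * x ^ q) <= K * D * (/ 2) ^ q).
{ intros b Hb q; rewrite Rabs_mult, <- RPow_abs.
  apply Rle_trans with (K * (L ^ q / M q) * (Rabs x + 1) ^ q).
  - apply Rmult_le_compat; [apply Rabs_pos | apply pow_le, Rabs_pos | apply Hb |].
    apply pow_incr; pose proof (Rabs_pos x); lra.
  - replace (K * (L ^ q / M q) * (Rabs x + 1) ^ q) with (K * (t ^ q / M q))
      by (unfold t; rewrite Rpow_mult_distr; unfold Rdiv; ring).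
    rewrite Rmult_assoc; apply Rmult_le_compat_l; [lra | apply Hq]. }
apply is_lim_seq_ext with (fun n => Series (fun q => coef ez n q * x ^ q)).
{ intros n; pose proof (is_series_coef ez n (fun q => x ^ q) 0) as H.
  rewrite opw_pow in H; apply is_series_unique in H; simpl pow at 2 in H; rewrite Rmult_1_l in H.
  rewrite <- H; apply Series_ext; intros q; rewrite Nat.add_0_r; reflexivity. }
apply (ucv_lim (I := unit) (fun n _ => Series (fun q => coef ez n q * x ^ q))
         (fun _ => PSeries csym x) tt).
apply (tannery (I := unit) (fun n _ q => coef ez n q * x ^ q) (fun _ q => csym q * x ^ q)
         (fun q => K * D * (/ 2) ^ q)).
- apply half_sum.
- intros n _; apply Hdom, Hn.
- intros _; apply Hdom, Hc.
- intros q eps He; pose proof (csym_lim q) as Hl.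
  apply (is_lim_seq_scal_r _ (x ^ q)) in Hl.
  apply is_lim_seq_spec in Hl; destruct (Hl (mkposreal eps He)) as [N HN].
  exists N; intros n Hn' _; exact (HN n Hn').
Qed.

Lemma P_PSeries x : P_ M l x = PSeries csym x.
Proof.
unfold P_.
(* [prod_f_R0] up to n has n + 1 factors, and 1 + x^2 is one more. *)
assert (E : forall n, prd ez (S (S n)) (x ^ 2)
  = (1 + x ^ 2) * prod_f_R0 (fun k => 1 + x ^ 2 / (l ^ 2 * m_ M (S k) ^ 2)) n).
{ assert (Es : forall k, 1 + ez (S k) * x ^ 2 = 1 + x ^ 2 / (l ^ 2 * m_ M (S k) ^ 2)).
  { intros k; rewrite ez_S, m_ratio; pose proof (ratio_pos k); field; lra. }
  induction n as [|n IH].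
  - cbn [prd prod_f_R0]; rewrite Es; unfold ez; simpl zeros; field.
    rewrite m_ratio; pose proof (ratio_pos 0); lra.
  - change (prd ez (S (S (S n))) (x ^ 2))
      with (prd ez (S (S n)) (x ^ 2) * (1 + ez (S (S n)) * x ^ 2)).
    rewrite IH, Es; cbn [prod_f_R0]; ring. }
assert (Hx : 0 < 1 + x ^ 2) by (pose proof (pow2_ge_0 x); lra).
assert (Hl : is_lim_seq (fun n => prod_f_R0 (fun k => 1 + x ^ 2 / (l ^ 2 * m_ M (S k) ^ 2)) n)
               (/ (1 + x ^ 2) * PSeries csym x)).
{ apply is_lim_seq_ext with (fun n => / (1 + x ^ 2) * prd ez (S (S n)) (x ^ 2)).
  - intros n; rewrite E, <- Rmult_assoc, Rinv_l, Rmult_1_l by lra; reflexivity.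
  - apply (is_lim_seq_scal_l _ (/ (1 + x ^ 2)) (PSeries csym x)).
    apply (is_lim_seq_incr_1 (fun n => prd ez (S n) (x ^ 2))).
    apply (is_lim_seq_incr_1 (fun n => prd ez n (x ^ 2))), prd_lim. }
rewrite (is_lim_seq_unique _ _ Hl); simpl real; field; lra.
Qed.

Lemma P_coef_csym q : P_coef M l q = RtoC (csym q).
Proof.
unfold P_coef; f_equal; rewrite (Derive_n_ext _ _ q 0 P_PSeries), Derive_n_coef.
- field; apply INR_fact_neq_0.
- destruct csym_bound as [K [L [HK [HL [_ Hc]]]]].
  destruct (pow_over_M L HL) as [D [HD Hq]].
  apply Rbar_lt_le_trans with 1; [simpl; lra |].
  apply (proj1 (CV_radius_bounded csym)); exists (K * D); intros n.
  rewrite pow1, Rmult_1_r; eapply Rle_trans; [apply Hc |].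
  apply Rmult_le_compat_l; [lra |]; eapply Rle_trans; [apply Hq |].
  assert ((/ 2) ^ n <= 1); [| nra].
  rewrite <- (pow1 n); apply pow_incr; lra.
Qed.

Lemma P_udo_class : udo_class Beurling M (P_coef M l).
Proof.
destruct csym_bound as [K [L [HK [HL [_ Hc]]]]]; exists L, K; split; [exact HL |].
split; [exact HK |]; intros p _; rewrite P_coef_csym, Cmod_R.
eapply Rle_trans; [apply Hc |]; right; unfold Rdiv; ring.
Qed.

(* Signed coefficients: [P_l(D)] acts as the sum of the [dsym q * f^(q)]. *)
Definition dsym (q : nat) : R := real (Lim_seq (fun n => coef (fun j => - ez j) n q)).

Lemma dsym_even_odd : (forall k, is_lim_seq (fun n => coef (fun j => - ez j) n (2 * k))
                                   ((-1) ^ k * csym (2 * k))) /\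
  (forall k, is_lim_seq (fun n => coef (fun j => - ez j) n (S (2 * k))) 0) /\
  (forall k, csym (S (2 * k)) = 0).
Proof.
split; [| split].
- intros k; apply is_lim_seq_ext with (fun n => (-1) ^ k * coef ez n (2 * k)).
  + intros n; rewrite coef_opp_even; reflexivity.
  + apply (is_lim_seq_scal_l _ ((-1) ^ k) (csym (2 * k))), csym_lim.
- intros k; apply is_lim_seq_ext with (fun _ => 0).
  + intros n; rewrite coef_odd; reflexivity.
  + apply is_lim_seq_const.
- intros k; unfold csym; rewrite (Lim_seq_ext _ (fun _ => 0)), Lim_seq_const; [reflexivity |].
  intros n; apply coef_odd.
Qed.

Lemma dsym_lim q : is_lim_seq (fun n => coef (fun j => - ez j) n q) (dsym q).
Proof.
destruct dsym_even_odd as [H1 [H2 _]].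
assert (exists d : R, is_lim_seq (fun n => coef (fun j => - ez j) n q) d) as [d Hd].
{ destruct (Nat.Even_or_Odd q) as [[k ->] | [k ->]].
  - eexists; apply H1.
  - eexists; rewrite Nat.add_1_r; apply H2. }
unfold dsym; rewrite (is_lim_seq_unique _ _ Hd); exact Hd.
Qed.

Lemma udo_coef_P q : udo_coef (P_coef M l) q = RtoC (dsym q).
Proof.
destruct dsym_even_odd as [H1 [H2 H3]]; unfold udo_coef; rewrite P_coef_csym.
destruct (Nat.Even_or_Odd q) as [[k ->] | [k ->]].
- unfold dsym; rewrite (is_lim_seq_unique _ _ (H1 k)); simpl real.
  assert (E1 : ((- RtoC 1) ^ (2 * k))%C = RtoC 1).
  { clear; induction k as [|k IH]; [reflexivity |].
    replace (2 * S k)%nat with (S (S (2 * k))) by lia.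
    change ((- RtoC 1 * (- RtoC 1 * (- RtoC 1) ^ (2 * k)))%C = RtoC 1); rewrite IH.
    unfold RtoC, Cmult, Copp; simpl; f_equal; ring. }
  assert (E2 : ((- Ci) ^ (2 * k))%C = RtoC ((-1) ^ k)).
  { clear; induction k as [|k IH]; [reflexivity |].
    replace (2 * S k)%nat with (S (S (2 * k))) by lia.
    change ((- Ci * (- Ci * (- Ci) ^ (2 * k)))%C = RtoC ((-1) ^ S k)); rewrite IH.
    unfold RtoC, Cmult, Copp, Ci; simpl; f_equal; ring. }
  rewrite E1, E2; unfold RtoC, Cmult; simpl; f_equal; ring.
- rewrite Nat.add_1_r, H3; unfold dsym; rewrite (is_lim_seq_unique _ _ (H2 k)); simpl real.
  unfold RtoC, Cmult; simpl; f_equal; ring.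
Qed.

Lemma dsym_bound : exists K L, 0 < K /\ 0 < L /\
  (forall n, coef_bnd K L (coef (fun j => - ez j) n)) /\ coef_bnd K L dsym.
Proof.
destruct csym_bound as [K [L [HK [HL [Hn _]]]]]; exists K, L; split; [exact HK |].
split; [exact HL |].
assert (H : forall n, coef_bnd K L (coef (fun j => - ez j) n)).
{ intros n q; eapply Rle_trans; [apply coef_abs_opp; intros k; left; apply ez_pos |].
  eapply Rle_trans; [apply Rle_abs | apply Hn]. }
split; [exact H |]; intros q.
apply (is_lim_seq_le (fun n => Rabs (coef (fun j => - ez j) n q)) (fun _ => K * (L ^ q / M q))
         (Rabs (dsym q)) (K * (L ^ q / M q))).
- intros n; apply H.
- apply (is_lim_seq_abs _ (dsym q)), dsym_lim.
- apply is_lim_seq_const.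
Qed.

(** * The parametrix *)

Lemma jmul_lin_l n a b f f' g x :
  jmul n (fun p x => a * f p x + b * f' p x) g x = a * jmul n f g x + b * jmul n f' g x.
Proof.
revert f f' g; induction n as [|n IH]; intros f f' g; simpl; [ring |].
rewrite (IH (fun p => f (S p)) (fun p => f' (S p)) g), (IH f f' (fun p => g (S p))); ring.
Qed.

Lemma ucv_jmul n : forall (e : nat -> R -> R) f F,
  (forall p, exists B, forall x, Rabs (e p x) <= B) ->
  (forall p, exists B, forall x, Rabs (F p x) <= B) ->
  (forall p, ucv (fun k => f k p) (F p)) ->
  ucv (fun k x => jmul n e (f k) x) (fun x => jmul n e F x).
Proof.
induction n as [|n IH]; intros e f F He HF Hf; simpl.
- destruct (He 0%nat) as [B HB]; destruct (HF 0%nat) as [B' HB'].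
  apply (ucv_mult (fun _ => e 0%nat) (fun k => f k 0%nat) (e 0%nat) (F 0%nat) B B'); auto.
  apply ucv_const.
- apply (ucv_plus (fun k x => jmul n (fun p => e (S p)) (f k) x)
           (fun k x => jmul n e (fun p => f k (S p)) x)).
  + apply (IH (fun p => e (S p)) f F); auto.
  + apply (IH e (fun k p => f k (S p)) (fun p => F (S p))); auto.
Qed.

(** The coefficients of all finite products obey one bound with index L. Against functions bounded
    uniformly with index 2 L, the q-th term is at most K C 2^(-q), and [tannery] applies. *)
Lemma ucv_op (f : nat -> nat -> R -> R) (F : nat -> R -> R) :
  (forall h, 0 < h -> exists C, forall n, bnd h C (f n)) ->
  (forall p, ucv (fun n => f n p) (F p)) ->
  ucv (fun n x => opw (fun j => - ez j) (S n) (fun p => f n p x) 0) (ser dsym F 0).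
Proof.
intros Hb Hc; destruct dsym_bound as [K [L [HK [HL [Hn Hd]]]]].
destruct (Hb (2 * L)) as [C HC]; [lra |].
assert (HC0 : 0 <= C) by (apply (bnd_at_C_pos (2 * L) C (f 0%nat) 0); [lra | apply HC]).
assert (HF : bnd (2 * L) C F).
{ intros x p; apply (ucv_le (fun n => f n p) (F p) x _ (Hc p)); intros n; apply HC. }
assert (Hdom : forall b g, coef_bnd K L b -> bnd (2 * L) C g ->
          forall x q, Rabs (b q * g (q + 0)%nat x) <= K * C * (/ 2) ^ q).
{ intros b g Hb' Hg x q; rewrite Nat.add_0_r, Rabs_mult.
  apply Rle_trans with (K * (L ^ q / M q) * (C * (M q / (2 * L) ^ q))).
  - apply Rmult_le_compat; auto using Rabs_pos; apply Hg.
  - right; pose proof (M_pos q); pose proof (pow_lt L q HL); pose proof (pow_lt 2 q ltac:(lra)).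
    rewrite Rpow_mult_distr, pow_inv; field; repeat split; lra. }
assert (E : forall n x, opw (fun j => - ez j) (S n) (fun p => f n p x) 0
              = Series (fun q => coef (fun j => - ez j) (S n) q * f n (q + 0)%nat x)).
{ intros n x; symmetry; apply is_series_unique.
  exact (is_series_coef (fun j => - ez j) (S n) (fun p => f n p x) 0). }
replace (fun n x => opw (fun j => - ez j) (S n) (fun p => f n p x) 0)
  with (fun n x => Series (fun q => coef (fun j => - ez j) (S n) q * f n (q + 0)%nat x))
  by (apply functional_extensionality; intros n; apply functional_extensionality; intros x; auto).
apply (tannery (fun n x q => coef (fun j => - ez j) (S n) q * f n (q + 0)%nat x)
         (fun x q => dsym q * F (q + 0)%nat x) (fun q => K * C * (/ 2) ^ q)).
- apply half_sum.
- intros n x; apply Hdom; [apply Hn | apply HC].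
- intros x; apply Hdom; [apply Hd | exact HF].
- intros q; apply (ucv_mult (fun n (_ : R) => coef (fun j => - ez j) (S n) q)
    (fun n => f n (q + 0)%nat) (fun _ => dsym q) (F (q + 0)%nat)
    (K * (L ^ q / M q)) (C * (M (q + 0)%nat / (2 * L) ^ (q + 0)))).
  + intros eps He; pose proof (dsym_lim q) as Hl; apply is_lim_seq_incr_1 in Hl.
    apply is_lim_seq_spec in Hl; destruct (Hl (mkposreal eps He)) as [N HN].
    exists N; intros n Hn' _; exact (HN n Hn').
  + apply Hc.
  + intros n _; apply Hn.
  + intros x; apply HF.
Qed.

(** With eta = 1 - chi, the finite operator sends chi times the n-th approximation to the heat
    kernel minus its image of eta times the approximation. Testing against phi, with the operator
    moved onto phi, and letting n grow gives the identity: the heat kernel tends to c times a point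
    mass at 0, and the other term converges uniformly to a smooth function. *)
Lemma parametrix chi : test Beurling chi ->
  (forall x, Rabs x <= 2 -> chi 0%nat x = 1 /\ forall p, chi (S p) x = 0) ->
  exists u psi N C, 0 < N /\ jet u /\ supp_in N u /\ bnd (/ (2 * l)) C u /\
    test Beurling psi /\ supp_in N psi /\
    forall phi, jet phi -> cls Beurling phi ->
      RInt (fun s => u 0%nat s * ser dsym phi 0 s) (- N) N
      + RInt (fun s => psi 0%nat s * phi 0%nat s) (- N) N = phi 0%nat 0.
Proof.
intros Tchi Hchi.
destruct (fundamental_limit zeros zeros_pos eq_refl ez_sum) as [G [HG [JG [BG AG]]]].
destruct heat_delta as [c [Hc Hdelta]].
destruct (test_supp _ chi Tchi) as [N0 [HN0 Schi]].
set (N := N0 + 2).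
set (sg := approx zeros) in *.
assert (Jsg : forall n, jet (sg n)) by (intros n; apply jet_approx, zeros_pos).
set (eta := fun p x => 1 * one_jet p x + -1 * chi p x).
assert (Jeta : jet eta) by (apply jet_lin; [apply jet_one | exact (test_jet _ _ Tchi)]).
assert (Ceta : cls Beurling eta) by (apply (cls_lin Beurling); [apply cls_one | apply Tchi]).
assert (Heta0 : forall x, Rabs x <= 2 -> forall p, eta p x = 0).
{ intros x Hx [|p]; unfold eta; simpl; destruct (Hchi x Hx) as [H0 HS];
    [rewrite H0 | rewrite HS]; ring. }
assert (Bsg : forall n p x, 1 <= Rabs x -> Rabs (sg n p x) <= 11 * (INR (fact p) * 4 ^ p)).
{ intros n p x Hx; exact (resol_away zeros zeros_pos (S n) p (time n) x (time_pos n) Hx). }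
(* The constant is common to all n: eta vanishes near 0, and elsewhere the analytic bound of the
   approximations is turned by (M.3') into one with index 2h; the product then has index h. *)
assert (Hb : forall h, 0 < h -> exists C, forall n, bnd h C (fun p => jmul p eta (sg n))).
{ intros h Hh; destruct (Ceta (2 * h)) as [D HD]; [lra |].
  destruct (fact_le (4 * (2 * h))) as [F [HF HFM]]; [lra |].
  assert (HD0 : 0 <= D) by (apply (bnd_at_C_pos (2 * h) D eta 0); [lra | apply HD]).
  exists (D * (11 * F)); intros n x.
  destruct (Rle_dec (Rabs x) 2) as [Hx | Hx].
  - intros p; rewrite jmul_0_l by (apply Heta0, Hx); rewrite Rabs_R0.
    apply Rmult_le_pos; [apply Rmult_le_pos; lra | left; apply Mh_pos, Hh].
  - replace h with (2 * h / 2) by field; apply bnd_at_mul; [lra | apply HD |].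
    intros p; eapply Rle_trans; [apply Bsg; lra |].
    specialize (HFM p); rewrite Rpow_mult_distr in HFM.
    pose proof (pow_lt (2 * h) p ltac:(lra)) as Hp.
    apply Rmult_le_reg_r with ((2 * h) ^ p); [exact Hp |].
    replace (11 * F * (M p / (2 * h) ^ p) * (2 * h) ^ p) with (11 * (F * M p)) by (field; lra).
    rewrite Rmult_assoc; apply Rmult_le_compat_l; lra. }
set (E := fun p => jmul p eta G).
assert (JE : jet E) by (apply jet_mul; assumption).
assert (BG' : forall p, exists B, forall x, Rabs (G p x) <= B)
  by (intros p; eexists; apply BG).
assert (HE : forall p, ucv (fun n => jmul p eta (sg n)) (E p)).
{ intros p; apply (ucv_jmul p eta sg G); auto; apply (cls_bounded Beurling), Ceta. }
assert (CE : cls Beurling E).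
{ intros h Hh; destruct (Hb h Hh) as [C HC]; exists C; intros x p.
  apply (ucv_le (fun n => jmul p eta (sg n)) (E p) x _ (HE p)); intros n; apply HC. }
assert (Cd : coef_cls Beurling dsym).
{ destruct dsym_bound as [K [L [HK [HL [_ H]]]]]; exists L, K; auto. }
destruct (ser_cls Beurling dsym E Cd JE CE) as [JP [CP _]].
pose proof (ucv_op (fun n p => jmul p eta (sg n)) E Hb HE) as HopE.
set (P := ser dsym E) in *.
(* Outside the support of chi, eta is 1 and the finite operator restores the heat kernel, which
   tends to 0 there. Hence the limit has compact support. *)
assert (SP : supp_in N P).
{ intros p x Hx; refine (jet_vanish P N JP _ p x Hx); clear p x Hx; intros x Hx.
  assert (Hz : is_lim_seq (fun n => heat 0 (time n) x) (P 0%nat x)).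
  { apply is_lim_seq_ext with
      (fun n => opw (fun j => - ez j) (S n) (fun p => jmul p eta (sg n) x) 0).
    - intros n; rewrite <- (opw_resol zeros zeros_pos (S n) (time n) x 0 (time_pos n)).
      apply opw_ext; intros p; apply jmul_1_l.
      + unfold eta; simpl; rewrite Schi by (unfold N in Hx; lra); ring.
      + intros q; unfold eta; simpl; rewrite Schi by (unfold N in Hx; lra); ring.
    - exact (ucv_lim _ _ x HopE). }
  assert (Hz0 : is_lim_seq (fun n => heat 0 (time n) x) 0).
  { apply (is_lim_seq_le_le (fun _ => 0) _ (fun n => 4 * (/ 2) ^ n)).
    - intros n; split; [left; apply heat_pos, time_pos |].
      replace ((/ 2) ^ n) with (sqrt (time n))
        by (unfold time; rewrite sqrt_pow2; [reflexivity | apply pow_le; lra]).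
      apply heat_small; [apply time_pos | unfold N in Hx; lra].
    - apply is_lim_seq_const.
    - replace (Finite 0) with (Finite (4 * 0)) by (f_equal; ring).
      apply (is_lim_seq_scal_l _ 4 0), is_lim_seq_geom; rewrite Rabs_pos_eq; lra. }
  apply is_lim_seq_unique in Hz; apply is_lim_seq_unique in Hz0; congruence. }
set (W := fun p => jmul p chi G).
assert (JW : jet W) by (apply jet_mul; [exact (test_jet _ _ Tchi) | exact JG]).
destruct (proj1 (proj2 Tchi) (/ l)) as [D HD]; [apply Rinv_0_lt_compat, l_pos |].
assert (Hil : 0 < / l) by (apply Rinv_0_lt_compat, l_pos).
(* The division by c compensates the missing normalisation of the heat kernel. *)
exists (fun p x => / c * W p x + 0 * W p x), (fun p x => / c * P p x + 0 * P p x), N,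
  (Rabs (/ c) * (D * 5) + Rabs 0 * (D * 5)).
split; [unfold N; lra |]; split; [apply jet_lin; exact JW |]; split; [| split; [| split; [| split]]].
- intros p x Hx; replace (W p x) with 0; [ring |].
  unfold W; rewrite jmul_0_l; [reflexivity | intros q; apply Schi; unfold N in Hx; lra].
- assert (HW : forall x, bnd_at (/ (2 * l)) (D * 5) W x).
  { intros x; replace (/ (2 * l)) with (/ l / 2) by (field; lra).
    apply bnd_at_mul; [exact Hil | apply HD |].
    intros p; eapply Rle_trans; [apply BG |]; rewrite bd_zeros, pow_inv; right.
    field; apply pow_nonzero; lra. }
  intros x; apply bnd_at_lin; apply HW.
- apply (test_lin Beurling); (split; [exact JP | split; [exact CP | exists N; split; [unfold N; lra | exact SP]]]).
- intros p x Hx; rewrite SP by exact Hx; ring.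
- intros phi Jphi Cphi.
  destruct (ser_cls Beurling dsym phi Cd Jphi Cphi) as [JPp [CPp _]].
  assert (HN : - N <= N) by (unfold N; lra).
  set (w := fun n p x => jmul p chi (sg n) x).
  assert (Jw : forall n, jet (w n)) by (intros n; apply jet_mul; [exact (test_jet _ _ Tchi) | apply Jsg]).
  assert (Hw0 : forall n k x, N0 < Rabs x -> w n k x = 0).
  { intros n k x Hx; apply jmul_0_l; intros q; apply Schi, Hx. }
  assert (Hop : forall n x, opw (fun j => - ez j) (S n) (fun p => w n p x) 0
            = heat 0 (time n) x - opw (fun j => - ez j) (S n) (fun p => jmul p eta (sg n) x) 0).
  { intros n x; rewrite <- (opw_resol zeros zeros_pos (S n) (time n) x 0 (time_pos n)).
    change (resol zeros (S n)) with (fun p (t : R) y => resol zeros (S n) p t y).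
    transitivity (1 * opw (fun j => - ez j) (S n) (fun p => sg n p x) 0
      + -1 * opw (fun j => - ez j) (S n) (fun p => jmul p eta (sg n) x) 0); [| unfold sg, approx, ez; ring].
    rewrite <- opw_lin; apply opw_ext; intros p; unfold w, eta.
    rewrite jmul_lin_l, (jmul_1_l p one_jet) by (intros; reflexivity); ring. }
  destruct (cls_bounded Beurling phi Cphi 0) as [Bp HBp].
  destruct (cls_bounded Beurling phi Cphi 1) as [Bp' HBp'].
  destruct (cls_bounded Beurling _ CPp 0) as [BPp HBPp].
  destruct (cls_bounded Beurling P CP 0) as [BP HBP].
  destruct (test_bounded Beurling chi Tchi 0) as [Bc HBc].
  assert (Hl : is_lim_seq (fun n => RInt (fun x => w n 0%nat x
                 * opw (fun j => - ez j) (S n) (fun p => phi p x) 0) (- N) N)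
               (RInt (fun x => W 0%nat x * ser dsym phi 0 x) (- N) N)).
  { apply (ucv_RInt (fun n x => w n 0%nat x * opw (fun j => - ez j) (S n) (fun p => phi p x) 0)
             (fun x => W 0%nat x * ser dsym phi 0 x)); [exact HN | | |].
    - intros n x; apply cont_mult; [apply (jet_cont _ (Jw n) 0) |].
      exact (jet_cont _ (jet_opw (fun j => - ez j) (S n) phi Jphi) 0 x).
    - intros x; apply cont_mult; [apply (jet_cont _ JW 0) | apply (jet_cont _ JPp 0)].
    - apply (ucv_mult (fun n => w n 0%nat) (fun n x => opw (fun j => - ez j) (S n) (fun p => phi p x) 0)
               (W 0%nat) (ser dsym phi 0) (Bc * 5) BPp).
      + apply (ucv_jmul 0 chi sg G); auto; apply (test_bounded Beurling), Tchi.
      + apply (ucv_op (fun _ => phi) phi).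
        * intros h Hh; destruct (Cphi h Hh) as [C HC]; exists C; auto.
        * intros p; apply ucv_const.
      + intros n x; unfold w; simpl; rewrite Rabs_mult; apply Rmult_le_compat; auto using Rabs_pos.
        pose proof (resol_bound zeros zeros_pos eq_refl n 0 (time n) x (time_pos n) ltac:(lia)) as H.
        cbn [bd] in H; rewrite Rmult_1_r in H; exact H.
      + exact HBPp. }
  (* The same integrals as in [Hl], computed with the operator on the cut-off approximation;
     comparing the two limits gives the identity. *)
  assert (Hr : is_lim_seq (fun n => RInt (fun x => w n 0%nat x
                 * opw (fun j => - ez j) (S n) (fun p => phi p x) 0) (- N) N)
               (c * phi 0%nat 0 - RInt (fun x => P 0%nat x * phi 0%nat x) (- N) N)).
  { apply is_lim_seq_ext with (fun n => RInt (fun x => heat 0 (time n) x * phi 0%nat x) (- N) N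
      - RInt (fun x => opw (fun j => - ez j) (S n) (fun p => jmul p eta (sg n) x) 0 * phi 0%nat x) (- N) N).
    - intros n.
      assert (I1 : ex_RInt (fun x => heat 0 (time n) x * phi 0%nat x) (- N) N).
      { apply ex_RInt_cont; intros x; apply cont_mult; [| apply (jet_cont _ Jphi 0)].
        exact (is_derive_continuous _ _ _ (heat_x 0 (time n) x (time_pos n))). }
      assert (I2 : ex_RInt (fun x => opw (fun j => - ez j) (S n) (fun p => jmul p eta (sg n) x) 0
                                     * phi 0%nat x) (- N) N).
      { apply ex_RInt_cont; intros x; apply cont_mult; [| apply (jet_cont _ Jphi 0)].
        exact (jet_cont _ (jet_opw (fun j => - ez j) (S n) (fun p => jmul p eta (sg n))
                             (jet_mul eta (sg n) Jeta (Jsg n))) 0 x). }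
      destruct (RInt_linR _ _ 1 (-1) _ _ I1 I2) as [_ E2].
      transitivity (RInt (fun x => phi 0%nat x * opw (fun j => - ez j) (S n) (fun p => w n p x) 0) (- N) N).
      + match goal with |- ?A = _ => match type of E2 with _ = ?B =>
          transitivity B; [ring |] end end.
        rewrite <- E2; apply RInt_extR; intros x _; rewrite Hop; ring.
      + rewrite <- (RInt_opw (fun j => - ez j) (S n) phi (w n) (- N) N); auto.
        * apply RInt_extR; intros; ring.
        * intros k; apply Hw0; unfold N; rewrite Rabs_left; lra.
        * intros k; apply Hw0; unfold N; rewrite Rabs_pos_eq; lra.
    - apply (is_lim_seq_minus' _ _ (c * phi 0%nat 0)
               (RInt (fun x => P 0%nat x * phi 0%nat x) (- N) N)).
      + apply (Hdelta (phi 0%nat) (phi 1%nat) Bp' N); [unfold N; lra | apply Jphi | exact HBp'].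
      + apply (ucv_RInt (fun n x => opw (fun j => - ez j) (S n) (fun p => jmul p eta (sg n) x) 0 * phi 0%nat x)
                 (fun x => P 0%nat x * phi 0%nat x)); [exact HN | | |].
        * intros n x; apply cont_mult; [| apply (jet_cont _ Jphi 0)].
          exact (jet_cont _ (jet_opw (fun j => - ez j) (S n) (fun p => jmul p eta (sg n))
                             (jet_mul eta (sg n) Jeta (Jsg n))) 0 x).
        * intros x; apply cont_mult; [apply (jet_cont _ JP 0) | apply (jet_cont _ Jphi 0)].
        * assert (Hu : ucv (fun n x => phi 0%nat x
                 * opw (fun j => - ez j) (S n) (fun p => jmul p eta (sg n) x) 0)
              (fun x => phi 0%nat x * P 0%nat x)).
          { apply (ucv_mult (fun _ => phi 0%nat)
              (fun n x => opw (fun j => - ez j) (S n) (fun p => jmul p eta (sg n) x) 0)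
              (phi 0%nat) (P 0%nat) Bp BP); auto using ucv_const. }
          intros eps He; destruct (Hu eps He) as [n0 Hn0]; exists n0; intros n Hn x.
          specialize (Hn0 n Hn x); rewrite (Rmult_comm _ (phi 0%nat x)), (Rmult_comm (P 0%nat x)).
          exact Hn0. }
  apply is_lim_seq_unique in Hl; apply is_lim_seq_unique in Hr; rewrite Hl in Hr.
  assert (Hr' : RInt (fun x => W 0%nat x * ser dsym phi 0 x) (- N) N
                = c * phi 0%nat 0 - RInt (fun x => P 0%nat x * phi 0%nat x) (- N) N)
    by congruence.
  assert (I1 : ex_RInt (fun x => W 0%nat x * ser dsym phi 0 x) (- N) N).
  { apply ex_RInt_cont; intros x; apply cont_mult; [apply (jet_cont _ JW 0) | apply (jet_cont _ JPp 0)]. }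
  assert (I2 : ex_RInt (fun x => P 0%nat x * phi 0%nat x) (- N) N).
  { apply ex_RInt_cont; intros x; apply cont_mult; [apply (jet_cont _ JP 0) | apply (jet_cont _ Jphi 0)]. }
  destruct (RInt_linR _ _ (/ c) 0 _ _ I1 I1) as [_ E1].
  destruct (RInt_linR _ _ (/ c) 0 _ _ I2 I2) as [_ E2].
  rewrite (RInt_extR (fun s => (/ c * W 0%nat s + 0 * W 0%nat s) * ser dsym phi 0 s)
             (fun x => / c * (W 0%nat x * ser dsym phi 0 x) + 0 * (W 0%nat x * ser dsym phi 0 x)))
    by (intros; ring).
  rewrite (RInt_extR (fun s => (/ c * P 0%nat s + 0 * P 0%nat s) * phi 0%nat s)
             (fun x => / c * (P 0%nat x * phi 0%nat x) + 0 * (P 0%nat x * phi 0%nat x)))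
    by (intros; ring).
  rewrite E1, E2, Hr'; field; lra.
Qed.

End Symbol.

(** * The decomposition given by the parametrix *)

Lemma T_lin (T : (R -> C) -> X) star a b f g f' g' : ultradistribution star M T ->
  test star f -> test star g -> test star f' -> test star g' ->
  T (cpair (fun p x => a * f p x + b * f' p x) (fun p x => a * g p x + b * g' p x))
  = plus (scal (RtoC a) (T (cpair f g))) (scal (RtoC b) (T (cpair f' g'))).
Proof.
intros [HT _] Tf Tg Tf' Tg'.
rewrite <- (HT (RtoC a) (RtoC b)) by (apply D_star_pair; assumption).
f_equal; apply functional_extensionality; intros x.
unfold cpair, RtoC, Cmult, Cplus; simpl; f_equal; ring.
Qed.

Lemma T_zero (T : (R -> C) -> X) star : ultradistribution star M T ->
  T (fun _ => 0%C) = zero.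
Proof.
intros HT.
assert (E := T_lin T star 0 0 _ _ _ _ HT (test_zero star) (test_zero star)
               (test_zero star) (test_zero star)).
assert (E0 : cpair (fun p x => 0 * 0 + 0 * 0) (fun p x => 0 * 0 + 0 * 0) = fun _ => 0%C).
{ apply functional_extensionality; intros x; unfold cpair, RtoC; f_equal; ring. }
cbv beta in E; rewrite E0 in E; rewrite E.
transitivity (plus (zero : X) zero); [| apply plus_zero_l].
f_equal; exact (scal_zero_l (V := X) _).
Qed.

Lemma ud_of_zero phi : ud_of_fun (fun _ => zero : X) phi = zero.
Proof.
unfold ud_of_fun.
assert (E : (fun t : R => scal (phi t) (zero : X)) = fun _ => zero).
{ apply functional_extensionality; intros t; exact (scal_zero_r (V := X) (phi t)). }
rewrite E.
etransitivity.
{ apply (integral_compact (V := restrict_scalars X) (fun _ => zero) 1 Rlt_0_1);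
    [intros x; apply continuous_const | reflexivity]. }
apply (is_RInt_unique (V := restrict_scalars X)).
apply (is_RInt_zero_fun (V := restrict_scalars X)); reflexivity.
Qed.

Lemma parametrix_AA (T : (R -> C) -> X) : ultradistribution Beurling M T ->
  (exists phi x, D_star Beurling M phi /\ phi x <> 0%C) ->
  (exists h, 0 < h /\ forall K, compact K -> forall phi, D_MhK M h K phi ->
     ud_in_AA Beurling M (ud_conv T phi)) ->
  cond_M3 M ->
  exists (l : R) (f g : R -> X), 0 < l /\ AA f /\ AA g /\
    ud_eq Beurling M T (ud_plus (udo_apply (P_coef M l) (ud_of_fun f)) (ud_of_fun g)).
Proof.
intros HT Hnz [h [Hh HAA]] M_3.
destruct (nonzero_bump Hnz) as [rho [r [Trho [Hr [Sr [_ Hint]]]]]].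
destruct (cutoff_of_bump rho r Trho Hr Sr Hint) as [chi [Tchi Hchi]].
(* With this l the parametrix u has index 1/(2l) = h, so that the hypothesis applies to T * u. *)
set (l := / (2 * h)); assert (Hl : 0 < l) by (apply Rinv_0_lt_compat; lra).
destruct (parametrix l Hl M_3 chi Tchi Hchi)
  as [u [psi [N [C [HN [Ju [Su [Bu [Tpsi [Spsi Hpar]]]]]]]]]].
replace (/ (2 * l)) with h in Bu by (unfold l; field; lra).
destruct (test_zero Beurling) as [J0 _].
assert (S0 : supp_in N (fun _ _ => 0)) by (intros p x _; reflexivity).
destruct (proj1 (proj2 Tpsi) h Hh) as [D HD].
assert (HC0 : 0 <= C) by (apply (bnd_at_C_pos h C u 0 Hh), Bu).
assert (HD0 : 0 <= D) by (apply (bnd_at_C_pos h D psi 0 Hh), HD).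
assert (B0 : forall C, 0 <= C -> bnd h C (fun _ _ => 0)).
{ intros C' HC' x p; rewrite Rabs_R0; apply Rmult_le_pos; [exact HC' | left; apply Mh_pos, Hh]. }
destruct (HAA (fun x => - N <= x <= N) (compact_P3 _ _) (cpair u (fun _ _ => 0)))
  as [F [HF EF]].
{ apply D_MhK_pair with C; auto. }
destruct (HAA (fun x => - N <= x <= N) (compact_P3 _ _) (cpair psi (fun _ _ => 0)))
  as [G [HG EG]].
{ apply D_MhK_pair with D; auto; exact (test_jet _ _ Tpsi). }
exists l, F, G; split; [exact Hl |]; split; [exact HF |]; split; [exact HG |].
intros phi Hphi; destruct (D_star_elim Beurling phi Hphi) as [f [g [-> [Tf Tg]]]].
unfold ud_plus, udo_apply.
pose proof (P_udo_class l Hl M_3) as Hcl.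
rewrite (udo_pair Beurling) by assumption.
destruct (udo_coef_cls Beurling _ Hcl) as [Hcr Hci].
destruct (test_udo Beurling _ f g Hcr Hci Tf Tg) as [TU TV].
set (U := udo_re (udo_coef (P_coef M l)) f g) in *.
set (V := udo_im (udo_coef (P_coef M l)) f g) in *.
rewrite <- EF by (apply D_star_pair; assumption).
rewrite <- EG by exact Hphi.
pose proof (test_jet _ _ Tf) as Jf; pose proof (test_jet _ _ Tg) as Jg.
pose proof (test_jet _ _ TU) as JU; pose proof (test_jet _ _ TV) as JV.
rewrite (ud_conv_pair T N) by (auto; exact (test_jet _ _ Tpsi)).
rewrite (ud_conv_pair T N) by (auto; exact (test_jet _ _ Tpsi)).
assert (Hbu : forall x, Rabs (u 0%nat x) <= C).
{ intros x; specialize (Bu x 0%nat); simpl in Bu; rewrite M_0 in Bu; lra. }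
assert (Hbp : forall x, Rabs (psi 0%nat x) <= D).
{ intros x; specialize (HD x 0%nat); simpl in HD; rewrite M_0 in HD; lra. }
assert (Tc : forall (v : R -> R) B w, (forall x : R, continuous v x) -> (forall x, Rabs (v x) <= B) ->
          test Beurling w -> test Beurling (cnv v 1 (- N) N w)).
{ intros v B w Cv Bv Tw; apply test_cnv with B; assumption. }
assert (Cu : forall x, continuous (u 0%nat) x) by apply (jet_cont _ Ju 0).
assert (Cp : forall x, continuous (psi 0%nat) x) by apply (jet_cont _ (test_jet _ _ Tpsi) 0).
assert (Cz : forall x : R, continuous (fun _ : R => 0) x) by (intros; apply continuous_const).
assert (Bz : forall x : R, Rabs ((fun _ : R => 0) x) <= 0) by (intros; rewrite Rabs_R0; lra).
match goal with |- _ = plus (T (cpair ?a ?b)) (T (cpair ?a' ?b')) =>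
  assert (E : T (cpair (fun p x => 1 * a p x + 1 * a' p x) (fun p x => 1 * b p x + 1 * b' p x))
              = plus (T (cpair a b)) (T (cpair a' b'))) end.
{ rewrite (T_lin T Beurling 1 1 _ _ _ _ HT);
    try (apply test_lin; eapply Tc; eassumption).
  rewrite !(scal_one (V := X)); reflexivity. }
rewrite <- E; f_equal; unfold cpair.
apply functional_extensionality; intros t.
assert (Hz : forall w, cnv (fun _ : R => 0) 1 (- N) N w 0 t = 0).
{ intros w; unfold cnv; apply is_RInt_unique.
  apply (is_RInt_zero_fun (V := R_CompleteNormedModule)); intros; apply Rmult_0_l. }
(* The identity of [parametrix] applied to the translate s -> w (s + t): the test function is
   recovered before T is applied. *)
assert (Hone : forall w, test Beurling w ->
  cnv (u 0%nat) 1 (- N) N (ser (dsym l) w) 0 t + cnv (psi 0%nat) 1 (- N) N w 0 t = w 0%nat t).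
{ intros w Tw.
  pose proof (Hpar (fun p s => 1 ^ p * w p (1 * s + t))
    (jet_affine 1 t w (test_jet _ _ Tw)) (cls_affine Beurling 1 t w R1_neq_R0 (proj1 (proj2 Tw)))) as H.
  cbv beta in H; simpl (1 ^ 0) in H; rewrite Rmult_1_l, Rmult_0_r, Rplus_0_l in H.
  rewrite <- H; unfold cnv; f_equal; apply RInt_extR; intros s _; [| ring].
  f_equal; unfold ser; apply Series_ext; intros q; rewrite pow1, Nat.add_0_r; ring. }
assert (EU : forall w x, ser (fun q => Re (udo_coef (P_coef M l) q)) w 0 x = ser (dsym l) w 0 x).
{ intros w x; unfold ser; apply Series_ext; intros q; rewrite (udo_coef_P l Hl M_3); reflexivity. }
assert (EI : forall w x, ser (fun q => Im (udo_coef (P_coef M l) q)) w 0 x = 0).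
{ intros w x; unfold ser; rewrite (Series_ext _ (fun _ => 0 * 0)).
  - rewrite Series_scal_l; ring.
  - intros q; rewrite (udo_coef_P l Hl M_3); simpl; ring. }
assert (EcU : cnv (u 0%nat) 1 (- N) N U 0 t = cnv (u 0%nat) 1 (- N) N (ser (dsym l) f) 0 t).
{ unfold cnv, U, udo_re; apply RInt_extR; intros s _; rewrite EU, EI; ring. }
assert (EcV : cnv (u 0%nat) 1 (- N) N V 0 t = cnv (u 0%nat) 1 (- N) N (ser (dsym l) g) 0 t).
{ unfold cnv, V, udo_im; apply RInt_extR; intros s _; rewrite EU, EI; ring. }
rewrite !Hz, EcU, EcV; f_equal.
- rewrite <- (Hone f Tf) at 1; ring.
- rewrite <- (Hone g Tg) at 1; ring.
Qed.

(** * Bounded ultradistributions *)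

Definition supp_at (z L : R) (f : nat -> R -> R) : Prop :=
  forall p x, L < Rabs (x - z) -> f p x = 0.

(** Interval of length 2 L, times 2 c for real and imaginary parts. The centre z does not enter the
    bound; from this comes the uniformity in x of the estimates for T * phi. *)
Lemma L1_norm h f g z L c : 0 < h -> 0 < L -> test Beurling f -> test Beurling g ->
  supp_at z L f -> supp_at z L g -> bnd h c f -> bnd h c g ->
  D_L1_h M h (cpair f g) /\ Rbar_le (norm_1h M h (cpair f g)) (4 * L * c).
Proof.
intros Hh HL Tf Tg Sf Sg Hf Hg.
pose proof (test_jet _ _ Tf) as Jf; pose proof (test_jet _ _ Tg) as Jg.
set (N := Rabs z + L + 1).
assert (HN : 0 < N) by (unfold N; pose proof (Rabs_pos z); lra).
set (m := fun p x => Cmod (deriv (cpair f g) p x)).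
assert (Em : forall p x, m p x = Cmod (f p x, g p x)).
{ intros p x; unfold m; rewrite deriv_pair by assumption; reflexivity. }
assert (Cm : forall p x, continuous (m p) x).
{ intros p x; apply continuous_ext with (fun x => sqrt (f p x * f p x + g p x * g p x)).
  - intros y; rewrite Em; unfold Cmod; simpl; f_equal; ring.
  - apply (continuous_comp (fun x => f p x * f p x + g p x * g p x) sqrt);
      [| apply continuous_sqrt].
    apply (continuous_plus (fun x => f p x * f p x) (fun x => g p x * g p x));
      apply cont_mult; apply jet_cont; assumption. }
assert (Hm0 : forall p x, L < Rabs (x - z) -> m p x = 0).
{ intros p x Hx; rewrite Em, Sf, Sg by exact Hx; apply Cmod_0. }
assert (HmN : forall p x, N < Rabs x -> m p x = 0).
{ intros p x Hx; apply Hm0; pose proof (Rabs_triang_inv x z); unfold N in Hx; lra. }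
assert (HI : forall p, integral (V := R_CompleteNormedModule) (m p) <= 4 * L * (c * (M p / h ^ p))).
{ intros p; rewrite (integral_compact (V := R_CompleteNormedModule) (m p) N HN (Cm p) (HmN p)).
  assert (Ex : forall u v, ex_RInt (m p) u v) by (intros; apply ex_RInt_cont, Cm).
  pose proof (Rle_abs z); pose proof (Rle_abs (- z)) as Hz; rewrite Rabs_Ropp in Hz.
  assert (Z : forall u v, u <= v -> (forall x, u < x < v -> L < Rabs (x - z)) -> RInt (m p) u v = 0).
  { intros u v Huv H0; apply RInt_zeroR; [lra |]; intros x Hx; apply Hm0, H0, Hx. }
  rewrite <- (RInt_ChaslesR _ (- N) (z - L) N), <- (RInt_ChaslesR _ (z - L) (z + L) N) by apply Ex.
  rewrite (Z (- N) (z - L)), (Z (z + L) N).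
  - rewrite Rplus_0_l, Rplus_0_r.
    eapply Rle_trans; [apply Rle_abs |].
    eapply Rle_trans; [apply (abs_RInt_le_const _ _ _ (2 * (c * (M p / h ^ p)))); [lra | apply Ex |] | right; ring].
    intros t _; rewrite Em, Rabs_pos_eq by apply Cmod_ge_0.
    eapply Rle_trans; [apply Cmod_pair_le |].
    specialize (Hf t p); specialize (Hg t p); lra.
  - unfold N; lra.
  - intros x Hx; rewrite Rabs_pos_eq; lra.
  - unfold N; lra.
  - intros x Hx; rewrite Rabs_left; lra. }
assert (Hn : Rbar_le (norm_1h M h (cpair f g)) (4 * L * c)).
{ apply Lub_Rbar_correct; intros y [p ->]; simpl.
  specialize (HI p); fold (m p).
  pose proof (M_pos p); pose proof (pow_lt h p Hh).
  apply Rmult_le_reg_r with (M p / h ^ p); [apply Mh_pos, Hh |].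
  assert (E : forall I : R, h ^ p * I / M p * (M p / h ^ p) = I) by (intros; field; lra).
  rewrite E; eapply Rle_trans; [exact HI |]; right; ring. }
split; [| exact Hn]; split; [apply smooth_pair; assumption |]; split.
- intros p; exists (RInt (m p) (- N) N).
  exact (is_RInt_gen_compact (V := R_CompleteNormedModule) (m p) N HN (Cm p) (HmN p)).
- eapply Rbar_le_lt_trans; [exact Hn | exact I].
Qed.

Lemma T_minus (T : (R -> C) -> X) star f g f' g' : ultradistribution star M T ->
  test star f -> test star g -> test star f' -> test star g' ->
  T (cpair (fun p x => 1 * f p x + -1 * f' p x) (fun p x => 1 * g p x + -1 * g' p x))
  = minus (T (cpair f g)) (T (cpair f' g')).
Proof.
intros; rewrite (T_lin T star) by assumption.
transitivity (plus (scal one (T (cpair f g))) (scal (opp one) (T (cpair f' g')))).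
- f_equal; f_equal; unfold RtoC, opp, one; simpl; unfold Copp; simpl; f_equal; ring.
- etransitivity; [apply f_equal; exact (scal_opp_one (V := X) _) |].
  unfold minus; f_equal; exact (scal_one (V := X) _).
Qed.

Lemma T_cscal (T : (R -> C) -> X) star v w f g : ultradistribution star M T ->
  test star f -> test star g ->
  T (cpair (fun p x => v * f p x + - w * g p x) (fun p x => v * g p x + w * f p x))
  = scal ((v, w) : C) (T (cpair f g)).
Proof.
intros [HT HT'] Tf Tg.
pose proof (HT ((v, w) : C) (RtoC 0) (cpair f g) (cpair f g)
              (D_star_pair star _ _ Tf Tg) (D_star_pair star _ _ Tf Tg)) as E.
transitivity (plus (scal ((v, w) : C) (T (cpair f g))) (zero : X)).
- etransitivity; [| etransitivity; [exact E |]].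
  + f_equal; apply functional_extensionality; intros x.
    unfold cpair, RtoC, Cmult, Cplus; simpl; f_equal; ring.
  + f_equal; exact (scal_zero_l (V := X) _).
- apply plus_zero_r.
Qed.

(** Continuity on the projective limit involves a single index h; homogeneity turns the
    neighbourhood into an inequality. *)
Lemma L1_bounded (T S : (R -> C) -> X) : ultradistribution Beurling M T ->
  D'_L1 M S -> ud_eq Beurling M T S ->
  exists h C0, 0 < h /\ 0 < C0 /\ forall f g z L c, 0 < L -> 0 < c ->
    test Beurling f -> test Beurling g -> supp_at z L f -> supp_at z L g ->
    bnd h c f -> bnd h c g -> norm (T (cpair f g)) <= C0 * (L * c).
Proof.
intros HT [_ HS] HE; destruct (HS 1 Rlt_0_1) as [h [Hh [eps [Heps H]]]].
exists h, (8 / eps); split; [exact Hh |]; split; [apply Rdiv_lt_0_compat; lra |].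
intros f g z L c HL Hc Tf Tg Sf Sg Hf Hg.
(* After rescaling by k, [L1_norm] gives at most 4 L k c = eps / 2, strictly inside the
   neighbourhood. *)
set (k := eps / (8 * L * c)).
assert (Hk : 0 < k) by (unfold k; apply Rdiv_lt_0_compat; [lra | nra]).
set (f' := fun p x => k * f p x + 0 * f p x); set (g' := fun p x => k * g p x + 0 * g p x).
assert (Tf' : test Beurling f') by (apply test_lin; assumption).
assert (Tg' : test Beurling g') by (apply test_lin; assumption).
assert (Hs : forall u, supp_at z L u -> supp_at z L (fun p x => k * u p x + 0 * u p x)).
{ intros u Su p x Hx; rewrite Su by exact Hx; ring. }
assert (Hb : forall h u, bnd h c u -> bnd h (k * c) (fun p x => k * u p x + 0 * u p x)).
{ intros h' u Hu x p; replace (k * u p x + 0 * u p x) with (k * u p x) by ring.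
  rewrite Rabs_mult, (Rabs_pos_eq k), Rmult_assoc by lra.
  apply Rmult_le_compat_l; [lra | apply Hu]. }
assert (H1 : norm (S (cpair f' g')) < 1).
{ apply H.
  - intros h' Hh'; destruct (proj1 (proj2 Tf') h' Hh') as [C HC];
      destruct (proj1 (proj2 Tg') h' Hh') as [D HD].
    apply (L1_norm h' f' g' z L (Rmax C D)); auto.
    + apply Hs, Sf.
    + apply Hs, Sg.
    + intros x; apply bnd_at_mono with C; [exact Hh' | apply Rmax_l | apply HC].
    + intros x; apply bnd_at_mono with D; [exact Hh' | apply Rmax_r | apply HD].
  - eapply Rbar_le_lt_trans;
      [apply (L1_norm h f' g' z L (k * c)); auto; [apply Hs, Sf | apply Hs, Sg | apply Hb, Hf | apply Hb, Hg] |].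
    simpl; unfold k; replace (4 * L * (eps / (8 * L * c) * c)) with (eps / 2)
      by (field; lra); lra. }
rewrite <- HE in H1 by (apply D_star_pair; assumption).
unfold f', g' in H1; rewrite (T_lin T Beurling) in H1 by assumption.
set (x := T (cpair f g)) in *.
assert (Ex : plus (scal (RtoC k) x) (scal (RtoC 0) x) = scal (RtoC k) x).
{ transitivity (plus (scal (RtoC k) x) (zero : X)); [| apply plus_zero_r].
  f_equal; exact (scal_zero_l (V := X) x). }
rewrite Ex in H1.
assert (E1 : x = scal (RtoC (/ k)) (scal (RtoC k) x)).
{ etransitivity; [symmetry; exact (scal_one (V := X) x) |].
  etransitivity; [| symmetry; exact (scal_assoc (V := X) (RtoC (/ k)) (RtoC k) x)].
  f_equal; unfold mult, one; simpl; rewrite <- RtoC_mult, Rinv_l by lra; reflexivity. }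
rewrite E1.
eapply Rle_trans; [exact (norm_scal (V := X) (RtoC (/ k)) (scal (RtoC k) x)) |].
replace (abs (RtoC (/ k) : C_AbsRing)) with (/ k).
- apply Rle_trans with (/ k * 1).
  + apply Rmult_le_compat_l; [left; apply Rinv_0_lt_compat, Hk | lra].
  + right; unfold k; field; repeat split; lra.
- unfold abs; simpl; rewrite Cmod_R, Rabs_pos_eq; [reflexivity |].
  left; apply Rinv_0_lt_compat, Hk.
Qed.

(** * Mollification *)

Section Mollify.

Variables (rho : nat -> R -> R) (r : R).
Hypotheses (Trho : test Beurling rho) (Hr : 0 < r) (Srho : supp_in r rho)
  (rho_pos : forall x, 0 <= rho 0%nat x) (rho_mass : RInt (rho 0%nat) (- r) r = 1).

Definition step (n : nat) : R := / (INR n + 1).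

Lemma step_pos n : 0 < step n <= 1.
Proof.
unfold step; pose proof (pos_INR n); split; [apply Rinv_0_lt_compat; lra |].
rewrite <- Rinv_1; apply Rinv_le_contravar; lra.
Qed.

Lemma step_small eps : 0 < eps -> exists N, forall n, (N <= n)%nat -> step n < eps.
Proof.
intros He; destruct (nfloor_ex (/ eps)) as [N [_ HN]].
{ left; apply Rinv_0_lt_compat, He. }
exists N; intros n Hn; apply le_INR in Hn; unfold step.
rewrite <- (Rinv_inv eps); apply Rinv_lt_contravar; [| lra].
apply Rmult_lt_0_compat; [apply Rinv_0_lt_compat, He | pose proof (pos_INR N); lra].
Qed.

Definition moll (n : nat) (f : nat -> R -> R) : nat -> R -> R :=
  cnv (rho 0%nat) (- step n) (- r) r f.

Lemma rho_cont x : continuous (rho 0%nat) x.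
Proof. apply jet_cont, (test_jet _ _ Trho). Qed.

(** rho is a probability density, so that averaging against it does not increase a bound; no
    constant is lost by mollification. *)
Lemma rho_average (w : R -> R) K : (forall x, continuous w x) ->
  (forall x, - r <= x <= r -> Rabs (w x) <= K) ->
  Rabs (RInt (fun s => rho 0%nat s * w s) (- r) r) <= K.
Proof.
intros Cw HK.
apply (@norm_RInt_le R_NormedModule (fun s => rho 0%nat s * w s)
         (fun s => K * rho 0%nat s) (- r) r); [lra | | |].
- intros x Hx; change (Rabs (rho 0%nat x * w x) <= K * rho 0%nat x).
  rewrite Rabs_mult, (Rabs_pos_eq (rho 0%nat x)), Rmult_comm by apply rho_pos.
  apply Rmult_le_compat_r; [apply rho_pos | apply HK, Hx].
- apply (@RInt_correct R_CompleteNormedModule), ex_RInt_cont; intros x.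
  apply cont_mult; [apply rho_cont | apply Cw].
- rewrite <- (Rmult_1_r K) at 1; rewrite <- rho_mass.
  apply (is_RInt_scal (rho 0%nat)).
  apply (@RInt_correct R_CompleteNormedModule), ex_RInt_cont, rho_cont.
Qed.

Lemma jet_moll n f : jet f -> (forall p, exists B, forall x, Rabs (f p x) <= B) -> jet (moll n f).
Proof.
intros Jf Bf; destruct (test_bounded Beurling rho Trho 0) as [B HB].
apply jet_cnv with B; [lra | apply rho_cont | exact HB | exact Jf | exact Bf].
Qed.

Lemma moll_bnd n f p K : jet f -> (forall x, Rabs (f p x) <= K) -> forall x, Rabs (moll n f p x) <= K.
Proof.
intros Jf HK x; apply rho_average; [intros; apply cont_affine, jet_cont, Jf | auto].
Qed.

Lemma moll_close n f p K : jet f -> (forall x, Rabs (f (S p) x) <= K) ->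
  forall x, Rabs (moll n f p x - f p x) <= r * step n * K.
Proof.
intros Jf HK x; pose proof (jet_cont f Jf) as Cf; pose proof (step_pos n) as Hs.
assert (E : moll n f p x - f p x
  = RInt (fun s => rho 0%nat s * (f p (- step n * s + x) - f p x)) (- r) r).
{ assert (I1 : ex_RInt (fun s => rho 0%nat s * f p (- step n * s + x)) (- r) r).
  { apply ex_RInt_cont; intros; apply cnv_cont; [apply rho_cont | apply Cf]. }
  destruct (RInt_linR _ _ 1 (- f p x) _ _ I1 (ex_RInt_cont _ (- r) r rho_cont)) as [_ E].
  rewrite rho_mass in E.
  transitivity (1 * moll n f p x + - f p x * 1); [ring |].
  unfold moll, cnv; rewrite <- E; apply RInt_extR; intros; ring. }
rewrite E; apply rho_average.
- intros y; apply (continuous_minus (fun s => f p (- step n * s + x)) (fun _ => f p x));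
    [apply cont_affine, Cf | apply continuous_const].
- intros s Hs'.
  eapply Rle_trans; [apply (mvt_le (f p) (f (S p)) x (- step n * s + x) K)|].
  + intros; apply Jf.
  + intros; apply HK.
  + assert (HK0 : 0 <= K) by (eapply Rle_trans; [apply Rabs_pos | apply (HK 0)]).
    replace (- step n * s + x - x) with (- (step n * s)) by ring.
    rewrite Rabs_Ropp, Rabs_mult, (Rabs_pos_eq (step n)) by lra.
    assert (Rabs s <= r) by (apply Rabs_le; lra).
    rewrite Rmult_comm; apply Rmult_le_compat_r; [exact HK0 |]; nra.
Qed.

Lemma moll_supp n f L : supp_in L f -> supp_in (L + r) (moll n f).
Proof.
intros Sf p x Hx; unfold moll, cnv; apply RInt_zeroR; [lra |]; intros s Hs; rewrite Sf; [apply Rmult_0_r |].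
pose proof (step_pos n) as Hn.
pose proof (Rabs_triang_inv x (step n * s)) as H.
replace (- step n * s + x) with (x - step n * s) by ring.
assert (Rabs (step n * s) <= r); [| lra].
rewrite Rabs_mult, (Rabs_pos_eq (step n)) by lra.
assert (Rabs s <= r) by (apply Rabs_le; lra); nra.
Qed.

Lemma RInt_shrink (f : R -> R) a b a' b' : (forall x, continuous f x) -> a' <= a -> a <= b -> b <= b' ->
  (forall x, x < a \/ b < x -> f x = 0) -> RInt f a' b' = RInt f a b.
Proof.
intros Cf H1 H2 H3 Hz.
assert (Ex : forall u v, ex_RInt f u v) by (intros; apply ex_RInt_cont, Cf).
assert (Z : forall u v, u <= v -> (v <= a \/ b <= u) -> RInt f u v = 0).
{ intros u v Huv Ho; apply RInt_zeroR; [lra |]; intros x Hx; apply Hz; lra. }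
rewrite <- (RInt_ChaslesR f a' a b'), <- (RInt_ChaslesR f a b b') by apply Ex.
rewrite (Z a' a), (Z b b') by lra; rewrite Rplus_0_l, Rplus_0_r; reflexivity.
Qed.

(* The derivatives of [moll n f] can also be put on the mollifier. *)
Lemma test_moll n f L : 0 < L -> jet f -> (forall p, exists B, forall x, Rabs (f p x) <= B) ->
  supp_in L f -> test Beurling (moll n f).
Proof.
intros HL Jf Bf Sf; pose proof (step_pos n) as Hs; set (d := step n) in *.
set (rd := fun p x => (/ d) ^ p * rho p (/ d * x + 0)).
assert (Hd0 : / d <> 0) by (apply Rinv_neq_0_compat; lra).
assert (Trd : test Beurling (fun p x => / d * rd p x + 0 * rd p x)).
{ assert (test Beurling rd) by (apply test_affine; assumption); apply test_lin; assumption. }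
destruct (Bf 0%nat) as [B0 HB0].
assert (Tc : test Beurling (cnv (f 0%nat) (-1) (- L) L (fun p x => / d * rd p x + 0 * rd p x))).
{ apply test_cnv with B0; auto; apply jet_cont, Jf. }
assert (E : moll n f = cnv (f 0%nat) (-1) (- L) L (fun p x => / d * rd p x + 0 * rd p x)).
{ apply functional_extensionality; intros p; apply functional_extensionality; intros t.
  revert p t; apply jet_unique; [apply jet_moll; assumption | exact (test_jet _ _ Tc) |].
  intros t; unfold moll, cnv; fold d.
  set (F := fun s => f 0%nat s * (/ d * rho 0%nat (/ d * (-1 * s + t) + 0))).
  assert (CF : forall x, continuous F x).
  { intros x; apply cont_mult; [apply jet_cont, Jf |].
    apply (continuous_scal_r (/ d) (fun s => rho 0%nat (/ d * (-1 * s + t) + 0))).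
    apply (continuous_ext (fun s => rho 0%nat ((- / d) * s + / d * t))).
    - intros y; f_equal; ring.
    - apply cont_affine, rho_cont. }
  assert (HF1 : forall x, x < - L \/ L < x -> F x = 0).
  { intros x Hx; unfold F; rewrite Sf; [ring |].
    unfold Rabs; destruct Rcase_abs; lra. }
  assert (HF2 : forall x, x < t - d * r \/ t + d * r < x -> F x = 0).
  { intros x Hx; unfold F; rewrite Srho; [ring |].
    assert (Hi : 0 < / d) by (apply Rinv_0_lt_compat; lra).
    replace (/ d * (-1 * x + t) + 0) with (/ d * (t - x)) by ring.
    rewrite Rabs_mult, (Rabs_pos_eq (/ d)) by lra.
    apply Rmult_lt_reg_l with d; [lra |].
    rewrite <- Rmult_assoc, Rinv_r, Rmult_1_l by lra.
    unfold Rabs; destruct Rcase_abs; lra. }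
  (* The substitution s -> t - d s reverses the orientation; the bounds are swapped back
     afterwards. *)
  assert (I : ex_RInt F (- d * - r + t) (- d * r + t)) by (apply ex_RInt_cont, CF).
  pose proof (RInt_comp_lin (V := R_CompleteNormedModule) F (- d) t (- r) r I) as H.
  set (N := L + Rabs t + d * r).
  pose proof (Rle_abs t); pose proof (Rle_abs (- t)) as Ht'; rewrite Rabs_Ropp in Ht'.
  assert (Hdr : 0 < d * r) by nra.
  assert (H1 : RInt F (- L) L = RInt F (t - d * r) (t + d * r)).
  { rewrite <- (RInt_shrink F (- L) L (- N) N), <- (RInt_shrink F (t - d * r) (t + d * r) (- N) N);
      auto; unfold N; pose proof (Rabs_pos t); lra. }
  rewrite (RInt_extR _ (fun s => (-1) * (scal (- d) (F (- d * s + t))) + 0 * (rho 0%nat s))).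
  - assert (I1 : ex_RInt (fun s => scal (- d) (F (- d * s + t))) (- r) r).
    { apply ex_RInt_cont; intros x; apply (continuous_scal_r (- d) (fun s => F (- d * s + t))).
      apply cont_affine, CF. }
    rewrite (proj2 (RInt_linR _ _ (-1) 0 _ _ I1 (ex_RInt_cont _ (- r) r rho_cont))).
    transitivity (RInt F (- L) L).
    + rewrite H1.
      replace (RInt F (t - d * r) (t + d * r)) with (- RInt F (- d * - r + t) (- d * r + t)).
      * rewrite <- H; match goal with |- -1 * ?a + 0 * _ = - ?b => change b with a end; ring.
      * replace (- d * - r + t) with (t + d * r) by ring; replace (- d * r + t) with (t - d * r) by ring.
        exact (opp_RInt_swap (V := R_CompleteNormedModule) F _ _ (ex_RInt_cont _ _ _ CF)).
    + apply RInt_extR; intros x _; unfold F, rd; simpl; ring.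
  - intros s _; unfold F, scal; simpl; unfold mult; simpl.
    replace (/ d * (-1 * (- d * s + t) + t) + 0) with s by (field; lra).
    field; lra. }
rewrite E; exact Tc.
Qed.

Lemma riemann_dist {V : CompleteNormedModule R_AbsRing} (f g : R -> V) a d n e : 0 <= d ->
  (forall x, dist (f x) (g x) <= e) ->
  dist (riemann f a d n) (riemann g a d n) <= INR n * d * e.
Proof.
intros Hd He; induction n as [|n IH]; [simpl; rewrite dist_refl; lra |].
cbn [riemann]; rewrite S_INR; eapply Rle_trans; [apply (dist_plus (X := V)) |].
assert (dist (scal d (f (a + INR n * d))) (scal d (g (a + INR n * d))) <= d * e); [| lra].
set (x := f _); set (y := g _).
assert (E : minus (scal d x) (scal d y) = scal d (minus x y)).
{ symmetry; exact (scal_minus_distr_l (V := V) d x y). }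
eapply Rle_trans; [right; exact (f_equal norm E) |].
eapply Rle_trans; [exact (norm_scal (V := V) d (minus x y)) |].
change (Rabs d * dist x y <= d * e); rewrite Rabs_pos_eq by exact Hd.
apply Rmult_le_compat_l; [exact Hd | apply He].
Qed.

Lemma dist_scal (a b : C) (x y : X) :
  dist (scal a x) (scal b y) <= Cmod (a - b)%C * norm x + Cmod b * dist x y.
Proof.
assert (E : minus (scal a x) (scal b y) = plus (scal (a - b)%C x) (scal b (minus x y))).
{ transitivity (plus (plus (scal a x) (opp (scal b x))) (plus (scal b x) (opp (scal b y)))).
  - exact (minus_trans (scal b x) (scal a x) (scal b y)).
  - f_equal.
    + symmetry; exact (scal_minus_distr_r (V := X) a b x).
    + symmetry; exact (scal_minus_distr_l (V := X) b x y). }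
eapply Rle_trans; [right; exact (f_equal norm E) |].
eapply Rle_trans; [exact (norm_triangle _ _) |].
apply Rplus_le_compat; [exact (norm_scal (V := X) (a - b)%C x) | exact (norm_scal (V := X) b (minus x y))].
Qed.

(** A change of variables proves the case p = 0 and [jet_unique] the others. The derivatives pass
    from v to f, so that the correlation becomes a superposition, with weight v, of reflected
    translates of f. *)
Lemma cnv_swap f v L N : 0 < L -> 0 < N -> jet f -> jet v -> supp_in L f -> supp_in N v ->
  (forall p, exists B, forall x, Rabs (f p x) <= B) ->
  (forall p, exists B, forall x, Rabs (v p x) <= B) ->
  forall p t, cnv (f 0%nat) 1 (- L) L v p t = (-1) ^ p * cnv (v 0%nat) 1 (- N) N f p (-1 * t + 0).
Proof.
intros HL HN Jf Jv Sf Sv Bf Bv.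
destruct (Bf 0%nat) as [B1 H1]; destruct (Bv 0%nat) as [B2 H2].
pose proof (jet_cont f Jf 0) as Cf; pose proof (jet_cont v Jv 0) as Cv.
apply (jet_unique (cnv (f 0%nat) 1 (- L) L v)
         (fun p t => (-1) ^ p * cnv (v 0%nat) 1 (- N) N f p (-1 * t + 0))).
- apply jet_cnv with B1; auto; lra.
- apply jet_affine, jet_cnv with B2; auto; lra.
- intros t; simpl pow; rewrite Rmult_1_l; unfold cnv.
  set (G := fun s => f 0%nat s * v 0%nat (1 * s + t)).
  assert (CG : forall x, continuous G x) by (intros x; apply cont_mult; [apply Cf | apply cont_affine, Cv]).
  assert (I : ex_RInt G (1 * - N + - t) (1 * N + - t)) by (apply ex_RInt_cont, CG).
  pose proof (RInt_comp_lin (V := R_CompleteNormedModule) G 1 (- t) (- N) N I) as H.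
  set (W := L + N + Rabs t).
  pose proof (Rle_abs t); pose proof (Rle_abs (- t)) as Ht'; rewrite Rabs_Ropp in Ht'.
  transitivity (RInt G (1 * - N + - t) (1 * N + - t)).
  + rewrite <- (RInt_shrink G (- L) L (- W) W), <- (RInt_shrink G (1 * - N + - t) (1 * N + - t) (- W) W);
      auto; try (unfold W; pose proof (Rabs_pos t); lra).
    * intros x Hx; unfold G; rewrite Sv; [ring |].
      unfold Rabs; destruct Rcase_abs; lra.
    * intros x Hx; unfold G; rewrite Sf; [ring |].
      unfold Rabs; destruct Rcase_abs; lra.
  + rewrite <- H; apply RInt_extR; intros s _; unfold G, scal; simpl; unfold mult; simpl.
    replace (1 * (1 * s + - t) + t) with s by ring.
    replace (1 * s + (-1 * t + 0)) with (1 * s + - t) by ring; ring.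
Qed.

(** * Convolution with functions of a single index *)

Section Convolve.

Variables (T : (R -> C) -> X) (h0 C0 : R).
Hypotheses (HT : ultradistribution Beurling M T)
  (HAA : forall phi, D_star Beurling M phi -> AA (conv T phi))
  (Hh0 : 0 < h0) (HC0 : 0 < C0)
  (HT1 : forall f g z L c, 0 < L -> 0 < c ->
    test Beurling f -> test Beurling g -> supp_at z L f -> supp_at z L g ->
    bnd h0 c f -> bnd h0 c g -> norm (T (cpair f g)) <= C0 * (L * c)).

(** Both f and f' are bounded with the index h0 for which T is estimated: f' controls the
    mollification error and the variation of the translates. *)
Record convolvable (L C D : R) (f : nat -> R -> R) : Prop := {
  cv_jet : jet f;
  cv_supp : supp_in L f;
  cv_bnd : bnd h0 C f;
  cv_bnd' : bnd h0 D (fun p => f (S p)) }.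

Variables (L C D : R).
Hypotheses (HL : 0 < L) (HC : 0 < C) (HD : 0 < D).

Section OneFunction.

Variable f : nat -> R -> R.
Hypothesis Hf : convolvable L C D f.

Lemma cv_bounded p : exists B, forall x, Rabs (f p x) <= B.
Proof. eexists; intros x; apply (cv_bnd _ _ _ _ Hf). Qed.

Lemma cv_moll n : test Beurling (moll n f).
Proof.
apply test_moll with L; auto; [apply Hf | apply cv_bounded | apply Hf].
Qed.

Lemma cv_moll_bnd n x p : Rabs (moll n f p x) <= C * (M p / h0 ^ p).
Proof.
apply moll_bnd; [apply Hf | intros y; apply (cv_bnd _ _ _ _ Hf)].
Qed.

Lemma cv_moll_bnd' n x p : Rabs (moll n f (S p) x) <= D * (M p / h0 ^ p).
Proof.
apply moll_bnd; [apply Hf | intros y; apply (cv_bnd' _ _ _ _ Hf)].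
Qed.

Lemma cv_moll_close n x p : Rabs (moll n f p x - f p x) <= r * step n * (D * (M p / h0 ^ p)).
Proof.
apply moll_close; [apply Hf | intros y; apply (cv_bnd' _ _ _ _ Hf)].
Qed.

Lemma refl_close n x p t :
  Rabs (refl x (moll n f) p t - refl x f p t) <= r * step n * (D * (M p / h0 ^ p)).
Proof.
unfold refl; rewrite <- Rmult_minus_distr_l, Rabs_mult, pow_1_abs, Rmult_1_l.
apply cv_moll_close.
Qed.

Lemma refl_lip n x y p t :
  Rabs (refl x (moll n f) p t - refl y (moll n f) p t) <= Rabs (x - y) * (D * (M p / h0 ^ p)).
Proof.
unfold refl; rewrite <- Rmult_minus_distr_l, Rabs_mult, pow_1_abs, Rmult_1_l.
rewrite (Rmult_comm (Rabs (x - y))).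
replace (x - y) with ((-1 * t + x) - (-1 * t + y)) by ring.
apply (mvt_le (moll n f p) (moll n f (S p))).
- intros z _; apply (test_jet _ _ (cv_moll n)).
- intros z _; apply cv_moll_bnd'.
Qed.

Lemma refl_bnd n x p t : Rabs (refl x (moll n f) p t) <= C * (M p / h0 ^ p).
Proof.
unfold refl; rewrite Rabs_mult, pow_1_abs, Rmult_1_l; apply cv_moll_bnd.
Qed.

Lemma refl_supp n x : supp_at x (L + r) (refl x (moll n f)).
Proof.
intros p t Ht; unfold refl; rewrite (moll_supp n f L (cv_supp _ _ _ _ Hf)); [ring |].
replace (-1 * t + x) with (- (t - x)) by ring; rewrite Rabs_Ropp; exact Ht.
Qed.

End OneFunction.

Variables (f g : nat -> R -> R).
Hypotheses (Hf : convolvable L C D f) (Hg : convolvable L C D g).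

Definition Fn (n : nat) (x : R) : X := T (cpair (refl x (moll n f)) (refl x (moll n g))).

Lemma Fn_AA n : AA (Fn n).
Proof.
assert (E : Fn n = conv T (cpair (moll n f) (moll n g))).
{ apply functional_extensionality; intros x; unfold Fn, conv; rewrite pair_refl; reflexivity. }
rewrite E; apply HAA, D_star_pair; apply cv_moll; assumption.
Qed.

Lemma T_dist u v u' v' z N c : 0 < N -> 0 < c ->
  test Beurling u -> test Beurling v -> test Beurling u' -> test Beurling v' ->
  (forall p t, N < Rabs (t - z) -> u p t = u' p t /\ v p t = v' p t) ->
  (forall p t, Rabs (u p t - u' p t) <= c * (M p / h0 ^ p)) ->
  (forall p t, Rabs (v p t - v' p t) <= c * (M p / h0 ^ p)) ->
  dist (T (cpair u v)) (T (cpair u' v')) <= C0 * (N * c).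
Proof.
intros HN Hc Tu Tv Tu' Tv' Hs Hu Hv; unfold dist.
rewrite <- (T_minus T Beurling) by assumption.
apply HT1 with z; auto using test_lin.
- intros p t Ht; rewrite (proj1 (Hs p t Ht)); ring.
- intros p t Ht; rewrite (proj2 (Hs p t Ht)); ring.
- intros t p; replace (1 * u p t + -1 * u' p t) with (u p t - u' p t) by ring; apply Hu.
- intros t p; replace (1 * v p t + -1 * v' p t) with (v p t - v' p t) by ring; apply Hv.
Qed.

(** Both mollifications are compared with f itself. The estimate of T is independent of the centre x
    of the supports, so the bound is uniform in x. *)
Lemma Fn_close n m x :
  dist (Fn n x) (Fn m x) <= C0 * ((L + r) * (r * (step n + step m) * D)).
Proof.
pose proof (step_pos n); pose proof (step_pos m).
assert (Hclose : forall w, convolvable L C D w -> forall p t,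
  Rabs (refl x (moll n w) p t - refl x (moll m w) p t)
  <= r * (step n + step m) * D * (M p / h0 ^ p)).
{ intros w Hw p t; pose proof (refl_close w Hw n x p t) as H1.
  pose proof (refl_close w Hw m x p t) as H2; rewrite Rabs_minus_sym in H2.
  replace (refl x (moll n w) p t - refl x (moll m w) p t)
    with ((refl x (moll n w) p t - refl x w p t) + (refl x w p t - refl x (moll m w) p t)) by ring.
  eapply Rle_trans; [apply Rabs_triang |]; lra. }
apply T_dist with x; try (apply test_refl, cv_moll; assumption); [lra | repeat apply Rmult_lt_0_compat; lra | | |].
- intros p t Ht; rewrite !(refl_supp f Hf), !(refl_supp g Hg) by exact Ht; split; reflexivity.
- apply Hclose, Hf.
- apply Hclose, Hg.
Qed.

(** One ball about 0, of radius L + r + N, must contain the supports of both reflections, so the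
    Lipschitz constant depends on N. It is used to estimate Riemann sums on bounded intervals. *)
Lemma Fn_lip n x y N : 0 < N -> Rabs x <= N -> Rabs y <= N ->
  dist (Fn n x) (Fn n y) <= C0 * ((L + r + N) * D) * Rabs (x - y).
Proof.
intros HN Hx Hy; destruct (Req_dec x y) as [-> | Hxy].
{ rewrite dist_refl, Rminus_diag, Rabs_R0; lra. }
assert (Hp : 0 < Rabs (x - y)) by (apply Rabs_pos_lt; lra).
replace (C0 * ((L + r + N) * D) * Rabs (x - y)) with (C0 * ((L + r + N) * (Rabs (x - y) * D))) by ring.
assert (Hfar : forall t z, L + r + N < Rabs (t - 0) -> Rabs z <= N -> L + r < Rabs (t - z)).
{ intros t z Ht Hz; rewrite Rminus_0_r in Ht; pose proof (Rabs_triang_inv t z); lra. }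
apply T_dist with 0; try (apply test_refl, cv_moll; assumption); [lra | repeat apply Rmult_lt_0_compat; lra | | |].
- intros p t Ht.
  rewrite (refl_supp f Hf n x), (refl_supp f Hf n y), (refl_supp g Hg n x), (refl_supp g Hg n y)
    by (apply Hfar; assumption); split; reflexivity.
- intros p t; rewrite Rmult_assoc; apply (refl_lip f Hf).
- intros p t; rewrite Rmult_assoc; apply (refl_lip g Hg).
Qed.

Lemma Fn_limit : exists F : R -> X, AA F /\
  (forall n x, dist (Fn n x) (F x) <= C0 * ((L + r) * (r * (2 * step n) * D))) /\
  (forall N x y, 0 < N -> Rabs x <= N -> Rabs y <= N ->
     dist (F x) (F y) <= C0 * ((L + r + N) * D) * Rabs (x - y)).
Proof.
set (k := C0 * ((L + r) * (r * 2 * D))).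
assert (Hk : 0 < k).
{ unfold k; repeat apply Rmult_lt_0_compat; lra. }
assert (Hstep : forall eps, 0 < eps -> exists K, forall n, (K <= n)%nat -> k * step n < eps).
{ intros eps He; destruct (step_small (eps / k)) as [K HK]; [apply Rdiv_lt_0_compat; lra |].
  exists K; intros n Hn; specialize (HK n Hn).
  apply Rmult_lt_compat_l with (r := k) in HK; [| exact Hk].
  replace (k * (eps / k)) with eps in HK by (field; lra); exact HK. }
assert (Hanti : forall n m, (n <= m)%nat -> step m <= step n).
{ intros n m Hnm; unfold step; apply le_INR in Hnm; pose proof (pos_INR n).
  apply Rinv_le_contravar; lra. }
assert (Hc : forall n m x, (n <= m)%nat -> dist (Fn n x) (Fn m x) <= k * step n).
{ intros n m x Hnm; eapply Rle_trans; [apply Fn_close |]; unfold k.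
  replace (C0 * ((L + r) * (r * 2 * D)) * step n)
    with (C0 * ((L + r) * (r * (step n + step n) * D))) by ring.
  pose proof (Hanti n m Hnm).
  apply Rmult_le_compat_l; [lra |]; apply Rmult_le_compat_l; [lra |].
  apply Rmult_le_compat_r; [lra |]; apply Rmult_le_compat_l; lra. }
assert (HF : forall x, { y : X | filterlim (fun n => Fn n x) eventually (locally y) }).
{ intros x; apply constructive_indefinite_description, cauchy_lim; intros eps He.
  destruct (Hstep eps He) as [K HK]; exists K; intros n m Hn Hm.
  destruct (Nat.le_ge_cases n m) as [H | H].
  - eapply Rle_lt_trans; [apply Hc, H | apply HK, Hn].
  - rewrite dist_sym; eapply Rle_lt_trans; [apply Hc, H | apply HK, Hm]. }
exists (fun x => proj1_sig (HF x)).
assert (Hd : forall n x, dist (Fn n x) (proj1_sig (HF x)) <= k * step n).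
{ intros n x; apply (lim_dist_le (X := X) (fun _ => Fn n x) (fun m => Fn (n + m) x)).
  - apply filterlim_const.
  - apply (lim_sub (X := X) (fun m => Fn m x) (fun m => (n + m)%nat)); [lia |].
    exact (proj2_sig (HF x)).
  - intros m; apply Hc; lia. }
split; [| split].
- apply (AA_uniform_limit X Fn); [apply Fn_AA |]; intros eps He.
  destruct (Hstep eps He) as [K HK]; exists K; intros n Hn x.
  eapply Rle_lt_trans; [apply Hd | apply HK, Hn].
- intros n x; eapply Rle_trans; [apply Hd |]; unfold k; right; ring.
- intros N x y HN Hx Hy.
  apply (lim_dist_le (X := X) (fun n => Fn n x) (fun n => Fn n y));
    [exact (proj2_sig (HF x)) | exact (proj2_sig (HF y)) |].
  intros n; apply Fn_lip; assumption.
Qed.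

(** The mesh of the Riemann sum is tied to the scale of mollification, so both errors are of order
    [step n]. They are measured for all orders p with the weights M_p / h0^p, the norm for which T
    is bounded. *)
Lemma moll_riemann (a b a' b' : R -> R) V V' N (u w : nat -> R -> R) :
  convolvable L C D u -> convolvable L C D w -> 0 < N ->
  (forall x, is_derive a x (a' x)) -> (forall x, is_derive b x (b' x)) ->
  (forall x, Rabs (a x) <= V) -> (forall x, Rabs (b x) <= V) ->
  (forall x, Rabs (a' x) <= V') -> (forall x, Rabs (b' x) <= V') ->
  forall n p t,
  Rabs (RInt (fun x => a x * refl x u p t + b x * refl x w p t) (- N) N
        - riemann (V := R_CompleteNormedModule)
            (fun x => a x * refl x (moll n u) p t + b x * refl x (moll n w) p t)
            (- N) (2 * N * step n) (S n))
  <= step n * (2 * N * (2 * (V * (r * D)) + 2 * N * (2 * (V' * C + V * D)))) * (M p / h0 ^ p).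
Proof.
intros Hu Hw HN Da Db Ba Bb Ba' Bb' n p t.
pose proof (step_pos n) as Hs; set (d := 2 * N * step n).
assert (Hd : 0 < d) by (unfold d; nra).
pose proof (Mh_pos h0 p Hh0) as Hm; set (m := M p / h0 ^ p) in *.
assert (HV : 0 <= V) by (eapply Rle_trans; [apply Rabs_pos | apply (Ba 0)]).
assert (HV' : 0 <= V') by (eapply Rle_trans; [apply Rabs_pos | apply (Ba' 0)]).
assert (Ca : forall x, continuous a x) by (intros x; exact (is_derive_continuous _ _ _ (Da x))).
assert (Cb : forall x, continuous b x) by (intros x; exact (is_derive_continuous _ _ _ (Db x))).
assert (Cr : forall v, jet v -> forall x, continuous (fun x => refl x v p t) x).
{ intros v Jv x; unfold refl; apply (continuous_scal_r ((-1) ^ p) (fun x => v p (-1 * t + x))).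
  apply (continuous_ext (fun x => v p (1 * x + -1 * t))); [intros y; f_equal; ring |].
  apply cont_affine, jet_cont, Jv. }
assert (Ch : forall v v', jet v -> jet v' ->
  forall x, continuous (fun x => a x * refl x v p t + b x * refl x v' p t) x).
{ intros v v' Jv Jv' x.
  apply (continuous_plus (fun x => a x * refl x v p t) (fun x => b x * refl x v' p t));
    apply cont_mult; auto. }
pose proof (test_jet _ _ (cv_moll u Hu n)) as Jun; pose proof (test_jet _ _ (cv_moll w Hw n)) as Jwn.
set (hn := fun x => a x * refl x (moll n u) p t + b x * refl x (moll n w) p t).
assert (H1 : Rabs (RInt (fun x => a x * refl x u p t + b x * refl x w p t) (- N) N - RInt hn (- N) N)
             <= 2 * N * (2 * (V * (r * step n * (D * m))))).
{ assert (I1 : ex_RInt (fun x => a x * refl x u p t + b x * refl x w p t) (- N) N)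
    by (apply ex_RInt_cont, Ch; [apply Hu | apply Hw]).
  assert (I2 : ex_RInt hn (- N) N) by (apply ex_RInt_cont, Ch; assumption).
  destruct (RInt_linR _ _ 1 (-1) _ _ I1 I2) as [I3 E].
  match type of E with _ = ?B => match goal with |- Rabs ?A <= _ =>
    replace A with B by ring end end.
  rewrite <- E; eapply Rle_trans; [apply (abs_RInt_le_const _ (- N) N (2 * (V * (r * step n * (D * m)))));
    [lra | exact I3 |] | right; ring].
  intros x _; unfold hn.
  replace (1 * (a x * refl x u p t + b x * refl x w p t)
           + -1 * (a x * refl x (moll n u) p t + b x * refl x (moll n w) p t))
    with (- (a x * (refl x (moll n u) p t - refl x u p t)
          + b x * (refl x (moll n w) p t - refl x w p t))) by ring.
  rewrite Rabs_Ropp; eapply Rle_trans; [apply Rabs_triang |]; rewrite !Rabs_mult.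
  pose proof (refl_close u Hu n x p t) as K1; pose proof (refl_close w Hw n x p t) as K2.
  fold m in K1, K2.
  pose proof (Rmult_le_compat _ _ _ _ (Rabs_pos (a x)) (Rabs_pos _) (Ba x) K1).
  pose proof (Rmult_le_compat _ _ _ _ (Rabs_pos (b x)) (Rabs_pos _) (Bb x) K2).
  lra. }
assert (H2 : Rabs (RInt hn (- N) N - riemann (V := R_CompleteNormedModule) hn (- N) d (S n))
             <= 2 * N * (2 * (V' * C + V * D) * m * d)).
{ assert (Ed : INR (S n) * d = 2 * N).
  { unfold d, step; rewrite S_INR; pose proof (pos_INR n); field; lra. }
  pose proof (riemann_err (V := R_CompleteNormedModule) hn (- N) d (2 * (V' * C + V * D) * m) (S n) Hd) as H.
  rewrite Ed in H; replace (- N + 2 * N) with N in H by ring.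
  apply H.
  - apply Rmult_le_pos; [| lra]; assert (0 <= V' * C) by nra; assert (0 <= V * D) by nra; lra.
  - apply Ch; assumption.
  - intros x y _ _; change (Rabs (hn x - hn y) <= 2 * (V' * C + V * D) * m * Rabs (x - y)); unfold hn.
    assert (Hone : forall c c' v, (forall x, is_derive c x (c' x)) ->
      (forall x, Rabs (c x) <= V) -> (forall x, Rabs (c' x) <= V') -> convolvable L C D v ->
      Rabs (c x * refl x (moll n v) p t - c y * refl y (moll n v) p t)
      <= (V' * C + V * D) * m * Rabs (x - y)).
    { intros c c' v Dc Bc Bc' Hv.
      replace (c x * refl x (moll n v) p t - c y * refl y (moll n v) p t)
        with ((c x - c y) * refl x (moll n v) p t
              + c y * (refl x (moll n v) p t - refl y (moll n v) p t)) by ring.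
      eapply Rle_trans; [apply Rabs_triang |]; rewrite !Rabs_mult.
      pose proof (mvt_le c c' y x V' (fun z _ => Dc z) (fun z _ => Bc' z)) as K1.
      pose proof (refl_bnd v Hv n x p t) as K2; pose proof (refl_lip v Hv n x y p t) as K3.
      fold m in K2, K3.
      pose proof (Rmult_le_compat _ _ _ _ (Rabs_pos (c x - c y)) (Rabs_pos _) K1 K2).
      pose proof (Rmult_le_compat _ _ _ _ (Rabs_pos (c y)) (Rabs_pos _) (Bc y) K3).
      lra. }
    pose proof (Hone a a' u Da Ba Ba' Hu); pose proof (Hone b b' w Db Bb Bb' Hw).
    match goal with |- Rabs ?A <= _ => replace A with
      ((a x * refl x (moll n u) p t - a y * refl y (moll n u) p t)
       + (b x * refl x (moll n w) p t - b y * refl y (moll n w) p t)) by ring end.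
    eapply Rle_trans; [apply Rabs_triang |]; lra. }
match goal with |- Rabs (?A - ?B) <= _ =>
  replace (A - B) with ((A - RInt hn (- N) N) + (RInt hn (- N) N - B)) by ring end.
eapply Rle_trans; [apply Rabs_triang |].
eapply Rle_trans; [apply Rplus_le_compat; [exact H1 | exact H2] |].
unfold d; right; ring.
Qed.

(** For fixed n the sum is a finite combination of genuine test functions, on which complex
    linearity of T applies. *)
Lemma T_riemann (a b : nat -> R -> R) n c d k :
  T (cpair (fun p t => riemann (V := R_CompleteNormedModule)
             (fun x => a 0%nat x * refl x (moll n f) p t + - b 0%nat x * refl x (moll n g) p t) c d k)
          (fun p t => riemann (V := R_CompleteNormedModule)
             (fun x => a 0%nat x * refl x (moll n g) p t + b 0%nat x * refl x (moll n f) p t) c d k))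
  = riemann (V := restrict_scalars X) (fun x => scal (cpair a b x) (Fn n x)) c d k /\
  test Beurling (fun p t => riemann (V := R_CompleteNormedModule)
             (fun x => a 0%nat x * refl x (moll n f) p t + - b 0%nat x * refl x (moll n g) p t) c d k) /\
  test Beurling (fun p t => riemann (V := R_CompleteNormedModule)
             (fun x => a 0%nat x * refl x (moll n g) p t + b 0%nat x * refl x (moll n f) p t) c d k).
Proof.
induction k as [|k [IH [T1 T2]]].
- split; [exact (T_zero T Beurling HT) | split; exact (test_zero Beurling)].
- set (x := c + INR k * d) in *.
  pose proof (test_refl Beurling x _ (cv_moll f Hf n)) as Tf.
  pose proof (test_refl Beurling x _ (cv_moll g Hg n)) as Tg.
  set (A := fun p t => a 0%nat x * refl x (moll n f) p t + - b 0%nat x * refl x (moll n g) p t).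
  set (B := fun p t => a 0%nat x * refl x (moll n g) p t + b 0%nat x * refl x (moll n f) p t).
  assert (TA : test Beurling A) by (apply test_lin; assumption).
  assert (TB : test Beurling B) by (apply test_lin; assumption).
  set (A1 := fun p t => riemann (V := R_CompleteNormedModule)
     (fun x => a 0%nat x * refl x (moll n f) p t + - b 0%nat x * refl x (moll n g) p t) c d k) in *.
  set (B1 := fun p t => riemann (V := R_CompleteNormedModule)
     (fun x => a 0%nat x * refl x (moll n g) p t + b 0%nat x * refl x (moll n f) p t) c d k) in *.
  assert (EA : (fun p t => riemann (V := R_CompleteNormedModule)
     (fun x => a 0%nat x * refl x (moll n f) p t + - b 0%nat x * refl x (moll n g) p t) c d (S k))
     = fun p t => 1 * A1 p t + d * A p t).
  { apply functional_extensionality; intros p; apply functional_extensionality; intros t.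
    rewrite Rmult_1_l; reflexivity. }
  assert (EB : (fun p t => riemann (V := R_CompleteNormedModule)
     (fun x => a 0%nat x * refl x (moll n g) p t + b 0%nat x * refl x (moll n f) p t) c d (S k))
     = fun p t => 1 * B1 p t + d * B p t).
  { apply functional_extensionality; intros p; apply functional_extensionality; intros t.
    rewrite Rmult_1_l; reflexivity. }
  rewrite EA, EB; split; [| split; apply test_lin; assumption].
  rewrite (T_lin T Beurling 1 d A1 B1 A B HT T1 T2 TA TB), IH.
  unfold A, B; rewrite (T_cscal T Beurling _ _ _ _ HT Tf Tg).
  cbn [riemann]; fold x.
  refine (f_equal2 plus _ _); [exact (scal_one (V := X) _) | reflexivity].
Qed.

(** T is exchanged with Riemann sums of mollified functions in place of the integral; every error is
    a constant times [step n]. *)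
Lemma conv_eq_integral (F : R -> X) (a b : nat -> R -> R) :
  (forall n x, dist (Fn n x) (F x) <= C0 * ((L + r) * (r * (2 * step n) * D))) ->
  (forall N x y, 0 < N -> Rabs x <= N -> Rabs y <= N ->
     dist (F x) (F y) <= C0 * ((L + r + N) * D) * Rabs (x - y)) ->
  test Beurling a -> test Beurling b ->
  ud_conv T (cpair f g) (cpair a b) = ud_of_fun F (cpair a b).
Proof.
intros Hclose Hlip Ta Tb.
destruct (test_supp _ a Ta) as [N1 [HN1 Sa']]; destruct (test_supp _ b Tb) as [N2 [HN2 Sb']].
set (N := N1 + N2); assert (HN : 0 < N) by (unfold N; lra).
assert (Sa : supp_in N a) by (intros p x Hx; apply Sa'; unfold N in Hx; lra).
assert (Sb : supp_in N b) by (intros p x Hx; apply Sb'; unfold N in Hx; lra).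
clear Sa' Sb'; pose proof (test_jet _ _ Ta) as Ja; pose proof (test_jet _ _ Tb) as Jb.
pose proof (test_bounded _ a Ta) as Ba; pose proof (test_bounded _ b Tb) as Bb.
assert (exists V, (forall x, Rabs (a 0%nat x) <= V) /\ (forall x, Rabs (b 0%nat x) <= V) /\
                  (forall x, Rabs (a 1%nat x) <= V) /\ (forall x, Rabs (b 1%nat x) <= V))
  as [V [Ba0 [Bb0 [Ba1 Bb1]]]].
{ destruct (Ba 0%nat) as [V1 H1]; destruct (Bb 0%nat) as [V2 H2].
  destruct (Ba 1%nat) as [V3 H3]; destruct (Bb 1%nat) as [V4 H4].
  exists (V1 + V2 + V3 + V4).
  pose proof (Rle_trans _ _ _ (Rabs_pos _) (H1 0)); pose proof (Rle_trans _ _ _ (Rabs_pos _) (H2 0)).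
  pose proof (Rle_trans _ _ _ (Rabs_pos _) (H3 0)); pose proof (Rle_trans _ _ _ (Rabs_pos _) (H4 0)).
  split; [| split; [| split]]; intros x;
    specialize (H1 x); specialize (H2 x); specialize (H3 x); specialize (H4 x); lra. }
assert (HV : 0 <= V) by (eapply Rle_trans; [apply Rabs_pos | apply (Ba0 0)]).
pose proof (cv_jet _ _ _ _ Hf) as Jf; pose proof (cv_jet _ _ _ _ Hg) as Jg.
pose proof (cv_supp _ _ _ _ Hf) as Sf; pose proof (cv_supp _ _ _ _ Hg) as Sg.
pose proof (cv_bounded f Hf) as Bf; pose proof (cv_bounded g Hg) as Bg.
rewrite (ud_conv_pair T L) by assumption.
set (P := fun p t => 1 * cnv (f 0%nat) 1 (- L) L a p t + -1 * cnv (g 0%nat) 1 (- L) L b p t).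
set (Q := fun p t => 1 * cnv (f 0%nat) 1 (- L) L b p t + 1 * cnv (g 0%nat) 1 (- L) L a p t).
assert (Tcnv : forall u v, jet u -> (forall p, exists B, forall x, Rabs (u p x) <= B) ->
  test Beurling v -> test Beurling (cnv (u 0%nat) 1 (- L) L v)).
{ intros u v Ju Bu Tv; destruct (Bu 0%nat) as [B HB]; apply test_cnv with B; auto.
  apply jet_cont, Ju. }
assert (TP : test Beurling P) by (apply test_lin; apply Tcnv; assumption).
assert (TQ : test Beurling Q) by (apply test_lin; apply Tcnv; assumption).
assert (Ecnv : forall u v p t, convolvable L C D u -> test Beurling v -> supp_in N v ->
  cnv (u 0%nat) 1 (- L) L v p t = RInt (fun x => v 0%nat x * refl x u p t) (- N) N /\
  ex_RInt (fun x => v 0%nat x * refl x u p t) (- N) N).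
{ intros u v p t Hu Tv Sv; pose proof (test_jet _ _ Tv) as Jv.
  rewrite (cnv_swap u v L N HL HN (cv_jet _ _ _ _ Hu) Jv (cv_supp _ _ _ _ Hu) Sv
             (cv_bounded u Hu) (test_bounded _ v Tv)).
  unfold cnv, refl.
  assert (I : ex_RInt (fun s => v 0%nat s * u p (1 * s + (-1 * t + 0))) (- N) N).
  { apply ex_RInt_cont; intros; apply cnv_cont; apply jet_cont; [exact Jv | apply Hu]. }
  destruct (RInt_linR _ _ ((-1) ^ p) 0 _ _ I I) as [I2 E2].
  split.
  - transitivity (RInt (fun s => (-1) ^ p * (v 0%nat s * u p (1 * s + (-1 * t + 0)))
                                 + 0 * (v 0%nat s * u p (1 * s + (-1 * t + 0)))) (- N) N);
      [rewrite E2; ring |].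
    apply RInt_extR; intros s _; replace (1 * s + (-1 * t + 0)) with (-1 * t + s) by ring; ring.
  - revert I2; apply ex_RInt_ext; intros s _.
    change (@eq R ((-1) ^ p * (v 0%nat s * u p (1 * s + (-1 * t + 0)))
                   + 0 * (v 0%nat s * u p (1 * s + (-1 * t + 0))))
                  (v 0%nat s * ((-1) ^ p * u p (-1 * t + s)))).
    replace (1 * s + (-1 * t + 0)) with (-1 * t + s) by ring; ring. }
assert (EP : forall p t, P p t
  = RInt (fun x => a 0%nat x * refl x f p t + - b 0%nat x * refl x g p t) (- N) N).
{ intros p t; destruct (Ecnv f a p t Hf Ta Sa) as [E1 I1]; destruct (Ecnv g b p t Hg Tb Sb) as [E2 I2].
  unfold P; rewrite E1, E2, <- (proj2 (RInt_linR _ _ 1 (-1) _ _ I1 I2)).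
  apply RInt_extR; intros; ring. }
assert (EQ : forall p t, Q p t
  = RInt (fun x => a 0%nat x * refl x g p t + b 0%nat x * refl x f p t) (- N) N).
{ intros p t; destruct (Ecnv f b p t Hf Tb Sb) as [E1 I1]; destruct (Ecnv g a p t Hg Ta Sa) as [E2 I2].
  unfold Q; rewrite E1, E2, <- (proj2 (RInt_linR _ _ 1 1 _ _ I1 I2)).
  apply RInt_extR; intros; ring. }
set (psi := cpair a b); set (h := fun x => scal (psi x) (F x) : restrict_scalars X).
assert (Hpsi : forall x, Cmod (psi x) <= 2 * V).
{ intros x; eapply Rle_trans; [apply Cmod_pair_le |]; pose proof (Ba0 x); pose proof (Bb0 x); lra. }
assert (Hpsi' : forall x y, Cmod (psi x - psi y)%C <= 2 * V * Rabs (x - y)).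
{ intros x y; eapply Rle_trans; [apply (Cmod_pair_le (a 0%nat x + - a 0%nat y) (b 0%nat x + - b 0%nat y)) |].
  pose proof (mvt_le (a 0%nat) (a 1%nat) y x V (fun z _ => Ja 0%nat z) (fun z _ => Ba1 z)).
  pose proof (mvt_le (b 0%nat) (b 1%nat) y x V (fun z _ => Jb 0%nat z) (fun z _ => Bb1 z)).
  unfold Rminus in *; lra. }
assert (Hh : forall R0, 0 < R0 -> exists B, 0 <= B /\ forall x y, Rabs x <= R0 -> Rabs y <= R0 ->
  dist (X := X) (h x) (h y) <= B * Rabs (x - y)).
{ intros R0 HR0; set (k := C0 * ((L + r + R0) * D)).
  assert (Hk : 0 <= k).
  { unfold k; apply Rmult_le_pos; [lra |]; apply Rmult_le_pos; lra. }
  assert (HF0 : forall x, Rabs x <= R0 -> norm (F x) <= norm (F 0) + k * R0).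
  { intros x Hx.
    pose proof (norm_le_dist (X := X) (F x) (F 0)) as E.
    pose proof (Hlip R0 x 0 HR0 Hx ltac:(rewrite Rabs_R0; lra)) as H; fold k in H.
    rewrite Rminus_0_r in H; assert (k * Rabs x <= k * R0) by (apply Rmult_le_compat_l; lra); lra. }
  exists (2 * V * (norm (F 0) + k * R0) + 2 * V * k); split.
  - pose proof (norm_ge_0 (F 0)); assert (0 <= k * R0) by nra.
    assert (0 <= 2 * V * (norm (F 0) + k * R0)) by (apply Rmult_le_pos; lra).
    assert (0 <= 2 * V * k) by (apply Rmult_le_pos; lra); lra.
  - intros x y Hx Hy; eapply Rle_trans; [apply (dist_scal (psi x) (psi y) (F x) (F y)) |].
    pose proof (Hlip R0 x y HR0 Hx Hy) as H; fold k in H.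
    pose proof (Rmult_le_compat _ _ _ _ (Cmod_ge_0 _) (norm_ge_0 (F x)) (Hpsi' x y) (HF0 x Hx)).
    pose proof (Rmult_le_compat _ _ _ _ (Cmod_ge_0 _) (dist_ge_0 (F x) (F y)) (Hpsi y) H).
    lra. }
assert (Ch : forall x, continuous h x).
{ intros t; apply (cont_dist (X := X) (fun x => scal (psi x) (F x))); intros eps He.
  pose proof (Rabs_pos t) as Ht; destruct (Hh (Rabs t + 1) ltac:(lra)) as [B [HB HBl]].
  exists (Rmin 1 (eps / (B + 1))); split.
  - apply Rmin_glb_lt; [lra | apply Rdiv_lt_0_compat; lra].
  - intros x Hx.
    assert (Hx1 : Rabs (x - t) < 1) by (eapply Rlt_le_trans; [exact Hx | apply Rmin_l]).
    assert (Hx2 : Rabs (x - t) < eps / (B + 1)) by (eapply Rlt_le_trans; [exact Hx | apply Rmin_r]).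
    eapply Rle_lt_trans; [apply (HBl x t); [| lra] |].
    + pose proof (Rabs_triang_inv x t); lra.
    + apply Rmult_lt_compat_r with (r := B + 1) in Hx2; [| lra].
      replace (eps / (B + 1) * (B + 1)) with eps in Hx2 by (field; lra).
      pose proof (Rabs_pos (x - t)); nra. }
assert (EI : ud_of_fun F psi = RInt (V := restrict_scalars X) h (- N) N).
{ apply (integral_compact (V := restrict_scalars X) h N HN Ch); intros x Hx.
  unfold h, psi, cpair; rewrite Sa, Sb by exact Hx; exact (scal_zero_l (V := X) (F x)). }
fold psi; rewrite EI.
destruct (Hh N HN) as [B [HB HBl]].
set (c1 := 2 * N * (2 * (V * (r * D)) + 2 * N * (2 * (V * C + V * D)))).
assert (Hc1 : 0 <= c1).
{ unfold c1; assert (0 <= V * (r * D)) by (apply Rmult_le_pos; [lra | nra]).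
  assert (0 <= V * C) by nra; assert (0 <= V * D) by nra.
  apply Rmult_le_pos; [lra |]; assert (0 <= 2 * N * (2 * (V * C + V * D))) by (apply Rmult_le_pos; lra).
  lra. }
set (N' := N + L + r).
(* One summand for each error: [D1] replaces the integral under T by a mollified Riemann sum, [D2]
   replaces [Fn n] by F, [D3] returns from the sum to the integral. The 1 added to c1 gives the
   strict positivity asked for by [T_dist]. *)
set (kap := C0 * (N' * (c1 + 1)) + 2 * N * (2 * V * (C0 * ((L + r) * (r * 2 * D)))) + 2 * N * (B * (2 * N))).
assert (Hmain : forall n, dist (X := X) (T (cpair P Q)) (RInt (V := restrict_scalars X) h (- N) N)
                          <= kap * step n).
{ intros n; pose proof (step_pos n) as Hs; set (d := 2 * N * step n).
  assert (Hd : 0 < d) by (unfold d; nra).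
  assert (Ed : INR (S n) * d = 2 * N).
  { unfold d, step; rewrite S_INR; pose proof (pos_INR n); field; lra. }
  destruct (T_riemann a b n (- N) d (S n)) as [ER [TR1 TR2]].
  match type of TR1 with test _ ?A => set (A1 := A) in * end.
  match type of TR2 with test _ ?A => set (B1 := A) in * end.
  assert (D1 : dist (T (cpair P Q)) (T (cpair A1 B1)) <= C0 * (N' * (step n * (c1 + 1)))).
  { apply T_dist with 0; auto.
    - unfold N'; lra.
    - nra.
    - assert (Hz : forall u p t, supp_in L u -> N' < Rabs (t - 0) -> forall x, - N <= x <= N ->
        refl x u p t = 0 /\ refl x (moll n u) p t = 0).
      { intros u p t Su Ht x Hx; unfold N' in Ht; rewrite Rminus_0_r in Ht.
        assert (Hxt : L + r < Rabs (-1 * t + x)).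
        { assert (Rabs x <= N) by (apply Rabs_le; lra).
          pose proof (Rabs_triang_inv t x); rewrite (Rabs_minus_sym t x) in *.
          replace (-1 * t + x) with (x - t) by ring; lra. }
        unfold refl; rewrite Su by lra; rewrite (moll_supp n u L Su) by exact Hxt; split; ring. }
      assert (HR : forall (w w' : R -> R) u v p t, supp_in L u -> supp_in L v -> N' < Rabs (t - 0) ->
        RInt (fun x => w x * refl x u p t + w' x * refl x v p t) (- N) N = 0 /\
        riemann (V := R_CompleteNormedModule)
          (fun x => w x * refl x (moll n u) p t + w' x * refl x (moll n v) p t) (- N) d (S n) = 0).
      { intros w w' u v p t Su Sv Ht; split.
        - apply RInt_zeroR; [lra |]; intros x Hx.
          rewrite (proj1 (Hz u p t Su Ht x ltac:(lra))), (proj1 (Hz v p t Sv Ht x ltac:(lra))).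
          change (w x * 0 + w' x * 0 = 0); ring.
        - assert (Hk : forall k, (k <= S n)%nat -> riemann (V := R_CompleteNormedModule)
            (fun x => w x * refl x (moll n u) p t + w' x * refl x (moll n v) p t) (- N) d k = 0).
          { induction k as [|k IH]; intros Hk; [reflexivity |]; cbn [riemann].
            rewrite IH by lia.
            assert (Hx : - N <= - N + INR k * d <= N).
            { pose proof (pos_INR k); apply le_INR in Hk; rewrite S_INR in Hk; nra. }
            rewrite (proj2 (Hz u p t Su Ht _ Hx)), (proj2 (Hz v p t Sv Ht _ Hx)).
            change (0 + d * (w (- N + INR k * d) * 0 + w' (- N + INR k * d) * 0) = 0); ring. }
          apply Hk; lia. }
      intros p t Ht; rewrite EP, EQ; unfold A1, B1.
      destruct (HR (a 0%nat) (fun x => - b 0%nat x) f g p t Sf Sg Ht) as [-> ->].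
      destruct (HR (a 0%nat) (b 0%nat) g f p t Sg Sf Ht) as [-> ->]; split; reflexivity.
    - intros p t; rewrite EP.
      eapply Rle_trans; [apply (moll_riemann (a 0%nat) (fun x => - b 0%nat x) (a 1%nat)
        (fun x => - b 1%nat x) V V N f g Hf Hg HN); auto; try (intros; rewrite Rabs_Ropp; auto) |].
      + intros x; apply (is_derive_opp (b 0%nat)), Jb.
      + fold c1; apply Rmult_le_compat_r; [left; apply Mh_pos, Hh0 |].
        apply Rmult_le_compat_l; lra.
    - intros p t; rewrite EQ.
      eapply Rle_trans; [apply (moll_riemann (a 0%nat) (b 0%nat) (a 1%nat)
        (b 1%nat) V V N g f Hg Hf HN); auto |].
      fold c1; apply Rmult_le_compat_r; [left; apply Mh_pos, Hh0 |].
      apply Rmult_le_compat_l; lra. }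
  rewrite ER in D1.
  assert (D2 : dist (X := restrict_scalars X)
    (riemann (V := restrict_scalars X) (fun x => scal (psi x) (Fn n x)) (- N) d (S n))
    (riemann (V := restrict_scalars X) h (- N) d (S n))
    <= INR (S n) * d * (2 * V * (C0 * ((L + r) * (r * (2 * step n) * D))))).
  { apply riemann_dist; [lra |]; intros x.
    eapply Rle_trans; [apply (dist_scal (psi x) (psi x) (Fn n x) (F x)) |].
    replace (psi x - psi x)%C with (RtoC 0) by (unfold Cminus; rewrite Cplus_opp_r; reflexivity).
    rewrite Cmod_0, Rmult_0_l, Rplus_0_l.
    apply Rmult_le_compat; auto using Cmod_ge_0, dist_ge_0. }
  pose proof (riemann_err (V := restrict_scalars X) h (- N) d B (S n) Hd HB Ch) as D3.
  rewrite Ed in D2, D3; replace (- N + 2 * N) with N in D3 by ring.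
  assert (D3' : dist (X := restrict_scalars X) (RInt (V := restrict_scalars X) h (- N) N)
     (riemann (V := restrict_scalars X) h (- N) d (S n)) <= 2 * N * (B * d)).
  { apply D3; intros x y Hx Hy; apply HBl; apply Rabs_le; lra. }
  rewrite dist_sym in D3'.
  eapply Rle_trans; [apply (dist_tri (X := X) _
    (riemann (V := restrict_scalars X) (fun x => scal (psi x) (Fn n x)) (- N) d (S n))) |].
  eapply Rle_trans; [apply Rplus_le_compat; [exact D1 |];
    eapply Rle_trans; [apply (dist_tri (X := restrict_scalars X) _
      (riemann (V := restrict_scalars X) h (- N) d (S n))) |];
    apply Rplus_le_compat; [exact D2 | exact D3'] |].
  unfold kap, d; right; ring. }
apply (dist_eq (X := X)); intros eps He.
assert (Hk0 : 0 < Rabs kap + 1) by (pose proof (Rabs_pos kap); lra).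
destruct (step_small (eps / (Rabs kap + 1))) as [n Hn]; [apply Rdiv_lt_0_compat; lra |].
specialize (Hn n (Nat.le_refl n)); eapply Rle_trans; [apply (Hmain n) |].
pose proof (step_pos n); pose proof (Rle_abs kap).
apply Rmult_lt_compat_r with (r := Rabs kap + 1) in Hn; [| exact Hk0].
replace (eps / (Rabs kap + 1) * (Rabs kap + 1)) with eps in Hn by (field; lra).
nra.
Qed.

End Convolve.

End Mollify.

(** * From smooth test functions to those of one index *)

Lemma L1_conv_AA (T T1 : (R -> C) -> X) : ultradistribution Beurling M T ->
  D'_L1 M T1 -> ud_eq Beurling M T T1 ->
  (forall phi, D_star Beurling M phi -> AA (conv T phi)) ->
  (exists phi x, D_star Beurling M phi /\ phi x <> 0%C) ->
  exists h, 0 < h /\ forall K, compact K -> forall phi, D_MhK M h K phi ->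
    ud_in_AA Beurling M (ud_conv T phi).
Proof.
intros HT HS HE HAA Hnz.
destruct (L1_bounded T T1 HT HS HE) as [h0 [C0 [Hh0 [HC0 HT1]]]].
destruct M2_add as [A [H [HA [HH HM]]]].
destruct (nonzero_bump Hnz) as [rho [r [Trho [Hr [Srho [rho_pos rho_mass]]]]]].
exists (H * h0); split; [nra |]; intros K HK phi Hphi.
destruct (D_MhK_elim (H * h0) K phi ltac:(nra) HK Hphi)
  as [f [g [L [C [-> [Jf [Jg [HL [Sf [Sg [Bf Bg]]]]]]]]]]].
assert (HC : 0 <= C) by (apply (bnd_at_C_pos (H * h0) C f 0); [nra | apply Bf]).
pose proof (M_pos 1) as HM1.
(* D comes from M_{p+1} <= A H^(p+1) M_p M_1: against (H h0)^(p+1) the powers of H cancel, and f' is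
   bounded with index h0. Adding 1 to C makes both constants positive. *)
set (C1 := C + 1); set (D := C1 * A * M 1%nat / h0).
assert (HD : 0 < D).
{ unfold D, C1; apply Rdiv_lt_0_compat; [| exact Hh0]; repeat apply Rmult_lt_0_compat; lra. }
assert (Hcv : forall u, jet u -> supp_in L u -> bnd (H * h0) C u -> convolvable h0 L C1 D u).
{ intros u Ju Su Bu; assert (Bu1 : bnd (H * h0) C1 u).
  { intros x; apply bnd_at_mono with C; [nra | unfold C1; lra | apply Bu]. }
  split; [exact Ju | exact Su | |].
  - intros x; apply bnd_at_anti with (H * h0); [exact Hh0 | nra | apply Bu1].
  - intros x p; eapply Rle_trans; [apply Bu1 |].
    pose proof (HM p 1%nat) as H1; rewrite Nat.add_1_r in H1.
    assert (Hp : 0 < (H * h0) ^ S p) by (apply pow_lt; nra).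
    apply Rle_trans with (C1 * (A * H ^ S p * (M p * M 1%nat) / (H * h0) ^ S p)).
    + apply Rmult_le_compat_l; [unfold C1; lra |].
      apply Rmult_le_compat_r; [left; apply Rinv_0_lt_compat, Hp | exact H1].
    + right; unfold D; rewrite Rpow_mult_distr; simpl; field.
      repeat split; try lra; apply pow_nonzero; lra. }
pose proof (Hcv f Jf Sf Bf) as Hf; pose proof (Hcv g Jg Sg Bg) as Hg.
assert (HC1 : 0 < C1) by (unfold C1; lra).
destruct (Fn_limit rho r Trho Hr Srho rho_pos rho_mass T h0 C0 HT HAA HC0 HT1 L C1 D HL HD f g Hf Hg)
  as [F [HF [Hclose Hlip]]].
exists F; split; [exact HF |]; intros psi Hpsi.
destruct (D_star_elim Beurling psi Hpsi) as [a [b [-> [Ta Tb]]]].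
apply (conv_eq_integral rho r Trho Hr Srho rho_pos rho_mass T h0 C0 HT Hh0 HC0 HT1
         L C1 D HL HC1 HD f g Hf Hg); assumption.
Qed.

Lemma ud_conv_zero (T : (R -> C) -> X) star phi : ultradistribution star M T ->
  ud_conv T phi (fun _ => 0%C) = zero.
Proof.
intros HT; rewrite <- (T_zero T star HT); unfold ud_conv; f_equal.
apply functional_extensionality; intros t.
transitivity (integral (V := C_R_CompleteNormedModule) (fun _ => (0, 0))).
- f_equal; apply functional_extensionality; intros s; apply Cmult_0_r.
- assert (Hc : forall x : R, continuous (fun _ : R => 0) x) by (intros; apply continuous_const).
  rewrite (integral_C_compact (fun _ => 0) (fun _ => 0) 1 Rlt_0_1 Hc Hc) by (intros; split; reflexivity).
  assert (E : RInt (fun _ : R => 0) (- (1)) 1 = 0).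
  { apply is_RInt_unique, (is_RInt_zero_fun (V := R_CompleteNormedModule)); reflexivity. }
  rewrite E; reflexivity.
Qed.

End WeightSequence.

Theorem theorem3p1 (X : CompleteNormedModule C_AbsRing) (M : nat -> R)
    (M_pos : forall p, 0 < M p) (M_0 : M 0%nat = 1)
    (M_1 : cond_M1 M) (M_2 : cond_M2 M) (M_3' : cond_M3' M) :
  (forall (star : ultra_class) (T : (R -> C) -> X),
     ultradistribution star M T ->
     (exists (a : nat -> C) (f g : (R -> C) -> X),
        udo_class star M a /\ D'_AA star M f /\ D'_AA star M g /\
        ud_eq star M T (ud_plus (udo_apply a f) g)) ->
     D'_AA star M T)
  /\
  (forall T : (R -> C) -> X,
     ultradistribution Beurling M T ->
     (exists S, D'_L1 M S /\ ud_eq Beurling M T S) ->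
     (forall phi, D_star Beurling M phi -> AA (conv T phi)) ->
     exists h, 0 < h /\
       forall K, compact K -> forall phi, D_MhK M h K phi ->
         ud_in_AA Beurling M (ud_conv T phi))
  /\
  (forall T : (R -> C) -> X,
     ultradistribution Beurling M T ->
     (exists h, 0 < h /\
        forall K, compact K -> forall phi, D_MhK M h K phi ->
          ud_in_AA Beurling M (ud_conv T phi)) ->
     cond_M3 M ->
     exists (l : R) (f g : R -> X), 0 < l /\ AA f /\ AA g /\
       ud_eq Beurling M T
         (ud_plus (udo_apply (P_coef M l) (ud_of_fun f)) (ud_of_fun g))).
Proof.
assert (Hzero : ~ (exists phi x, D_star Beurling M phi /\ phi x <> 0%C) ->
          forall phi, D_star Beurling M phi -> phi = fun _ => 0%C).
{ intros Hn phi Hphi; apply functional_extensionality; intros x.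
  apply NNPP; intros Hx; apply Hn; exists phi, x; split; assumption. }
split; [| split].
- intros star T HT [a [f [g [Ha [Hf [Hg HE]]]]]].
  apply (AA_udo M M_pos M_0 M_2 X star T f g a); assumption.
- intros T HT [S [HS HE]] HAA.
  destruct (classic (exists phi x, D_star Beurling M phi /\ phi x <> 0%C)) as [Hn | Hn].
  + apply (L1_conv_AA M M_pos M_0 M_1 M_2 X T S); assumption.
  + exists 1; split; [lra |]; intros K _ phi _; exists (fun _ => zero); split; [apply AA_zero |].
    intros psi Hpsi; rewrite (Hzero Hn psi Hpsi), (ud_conv_zero M M_pos M_0 X T Beurling phi HT).
    symmetry; apply ud_of_zero.
- intros T HT HAA HM3.
  destruct (classic (exists phi x, D_star Beurling M phi /\ phi x <> 0%C)) as [Hn | Hn].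
  + apply (parametrix_AA M M_pos M_0 M_1 M_2 M_3' X T); assumption.
  + exists 1, (fun _ => zero), (fun _ => zero).
    split; [lra |]; split; [apply AA_zero |]; split; [apply AA_zero |].
    intros phi Hphi; rewrite (Hzero Hn phi Hphi), (T_zero M M_pos M_0 X T Beurling HT).
    unfold ud_plus, udo_apply; rewrite !ud_of_zero; symmetry; apply plus_zero_l.
Qed.
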